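(* The system $\mathsf{RCA}_0^\omega+\mathsf{BW}_{\mathsf{net}}$ proves $\mathsf{HBU}$. Here $\mathsf{BW}_{\mathsf{net}}$ is the statement that every net in the unit interval $[0,1]$ (indexed by a subset of $\mathbb{N}^{\mathbb{N}}$) has a convergent sub-net, and $\mathsf{HBU}$ is the statement $(\forall \Psi:\mathbb{R}\to\mathbb{R}^+)(\exists \langle y_1,\dots,y_k\rangle)(\forall x\in[0,1])(\exists i\leq k)\big(x\in (y_i-\Psi(y_i),y_i+\Psi(y_i))\big)$, with $y_1,\dots,y_k$ a finite sequence of reals in $[0,1]$.
   Context: Language and base theory. Finite types: $0$ (natural numbers) is a type, and if $\sigma,\tau$ are types then so is $\sigma\to\tau$ (mappings); $1:=0\to 0$ and $n+1:=n\to 0$; $\rho^*$ is the type of finite sequences of type-$\rho$ objects (suitably coded). Superscripts on variables indicate types. $\mathsf{L}_\omega$ is the language with variables of all finite types, constants $0,1,<_0,+_0,\times_0,=_0$, the combinators and recursors. Equality $=_\tau$ and $\leq_\tau$ at type $\tau=\tau_1\to\dots\to\tau_k\to 0$ are defined pointwise from $=_0$, $\leq_0$. Quantifier-free formulas may contain variables of any type. The axiom $\mathsf{QF\text{-}AC}^{\sigma,\tau}$ is $(\forall x^\sigma)(\exists y^\tau)A(x,y)\to(\exists Y^{\sigma\to\tau})(\forall x^\sigma)A(x,Y(x))$ for all quantifier-free $A$. The (classical) system $\mathsf{RCA}_0^\omega$ consists of: the ordered semi-ring axioms for $0,1,<_0,+_0,\times_0$; the defining axioms of the $\Pi$ and $\Sigma$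 (i.e. $K$ and $S$) combinators, yielding $\lambda$-abstraction; the recursor $\mathbf{R}_0$ with $\mathbf{R}_0(f,m,0)=m$ and $\mathbf{R}_0(f,m,n+1)=f(\mathbf{R}_0(f,m,n))$ for $m^0,f^1$; the axiom of extensionality $x=_\rho y\to\varphi(x)=_\tau\varphi(y)$ for all types $\rho,\tau$; induction for quantifier-free formulas; and $\mathsf{QF\text{-}AC}^{1,0}$. Reals. A real is coded by $q_{(\cdot)}:\mathbb{N}\to\mathbb{Q}$ with $|q_n-q_{n+i}|<2^{-n}$ for all $n,i$; $x=_{\mathbb{R}}y$ means $|q_n-r_n|\leq 2^{-(n-1)}$ for all $n$, and $<_{\mathbb{R}}$ is defined similarly. A function $F:\mathbb{R}\to\mathbb{R}$ is given by a $\Phi^{1\to1}$ with $x=_{\mathbb{R}}y\to\Phi(x)=_{\mathbb{R}}\Phi(y)$; $\mathbb{R}^+$ is the set of positive reals. Nets. A set $D\neq\emptyset$ with a binary relation $\preceq$ is directed if $\preceq$ is transitive and reflexive on $D$ and for all $x,y\in D$ there is $z\in D$ with $x\preceq z$ and $y\preceq z$. For such $(D,\preceq)$ and a topological space $X$, a net in $X$ is a mapping $x_d:D\to X$. A net $x_d$ converges to $y\in X$ if for every neighbourhood $U$ of $y$ there is $d\in D$ such that $x_e\in U$ for all $e\succeq d$. A sub-net of a net $x_d$ with directed set $(D,\preceq_D)$ is a net $y_b$ with directed set $(B,\preceq_B)$ for which there is a function $\phi:B\to D$ with $y_b=x_{\phi(b)}$ and $(\forall d\in D)(\exists b_0\in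 B)(\forall b\succeq_B b_0)(\phi(b)\succeq_D d)$. All directed sets considered are subsets of Baire space: a subset $D$ of $\mathbb{N}^{\mathbb{N}}$ is given by a characteristic function $F_D^2\leq_2 1$ ($f\in D$ iff $F_D(f)=1$), and a binary relation $\preceq$ on $D$ by a characteristic function $G_\preceq^{(1\times1)\to0}$ ($f\preceq g$ iff $G_\preceq(f,g)=1$). Via coding, this includes sets of reals and of finite sequences of reals, and relations on these. *)

(* Defs.v *)
(* A deep embedding: the language L_omega, classical many-sorted first-order
   logic over it, and the theory RCA_0^omega. Only Stdlib's lists are used. *)
From Stdlib Require Import List.
Import ListNotations.

Set Implicit Arguments.
Unset Strict Implicit.
Unset Printing Implicit Defensive.

Inductive ty : Type :=
| Nat : ty
| Arr : ty -> ty -> ty.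

Declare Scope ty_scope.
Delimit Scope ty_scope with ty.
Bind Scope ty_scope with ty.
Infix "~>" := Arr (at level 55, right associativity) : ty_scope.
Open Scope ty_scope.

Notation T0 := Nat.
Notation T1 := (T0 ~> T0).
Notation T2 := (T1 ~> T0).

(* A context lists the types of the free variables, innermost binder first. *)
Notation ctx := (list ty).

Inductive var : ctx -> ty -> Type :=
| VZ : forall (G : ctx) (t : ty), var (t :: G) t
| VS : forall (G : ctx) (s t : ty), var G t -> var (s :: G) t.
Arguments VZ {G t}.
Arguments VS {G s t} _.

Inductive term (G : ctx) : ty -> Type :=
| Var : forall t : ty, var G t -> term G t
| App : forall s t : ty, term G (s ~> t) -> term G s -> term G t
| Zero : term G T0
| One : term G T0
| Plus : term G (T0 ~> T0 ~> T0)
| Times : term G (T0 ~> T0 ~> T0)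
| Pi : forall r s : ty, term G (r ~> s ~> r)
| Sigma : forall r s t : ty, term G ((r ~> s ~> t) ~> (r ~> s) ~> r ~> t)
| Rec0 : term G (T1 ~> T0 ~> T0 ~> T0).
Declare Scope term_scope.
Delimit Scope term_scope with term.
Bind Scope term_scope with term.

Arguments Var {G t} _.
Arguments App {G s t} _%_term _%_term.
Arguments Zero {G}.
Arguments One {G}.
Arguments Plus {G}.
Arguments Times {G}.
Arguments Pi {G} r s.
Arguments Sigma {G} r s t.
Arguments Rec0 {G}.

Inductive fm (G : ctx) : Type :=
| Eq : term G T0 -> term G T0 -> fm G
| Lt : term G T0 -> term G T0 -> fm G
| Bot : fm G
| Imp : fm G -> fm G -> fm G
| And : fm G -> fm G -> fm G
| Or : fm G -> fm G -> fm G
| All : forall t : ty, fm (t :: G) -> fm G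
| Ex : forall t : ty, fm (t :: G) -> fm G.
Declare Scope fm_scope.
Delimit Scope fm_scope with fm.
Bind Scope fm_scope with fm.

Arguments Bot {G}.
Arguments Imp {G} _%_fm _%_fm.
Arguments And {G} _%_fm _%_fm.
Arguments Or {G} _%_fm _%_fm.
Arguments All {G} t%_ty _%_fm.
Arguments Ex {G} t%_ty _%_fm.

Fixpoint qf (G : ctx) (A : fm G) : Prop :=
  match A with
  | Eq _ _ | Lt _ _ | Bot => True
  | Imp B C | And B C | Or B C => qf B /\ qf C
  | All _ _ | Ex _ _ => False
  end.

Definition ren (G H : ctx) : Type := forall t : ty, var G t -> var H t.
Definition sub (G H : ctx) : Type := forall t : ty, var G t -> term H t.

Definition vnil (P : ty -> Type) (t : ty) (v : var [] t) : P t :=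
  match v in var L u return match L with [] => P u | _ :: _ => unit end with
  | VZ => tt
  | VS _ => tt
  end.

Definition vcons (P : ty -> Type) (G : ctx) (s : ty) (z : P s)
    (f : forall t : ty, var G t -> P t) (t : ty) (v : var (s :: G) t) : P t :=
  match v in var L u
    return match L with
           | [] => unit
           | s0 :: G0 => P s0 -> (forall t : ty, var G0 t -> P t) -> P u
           end
  with
  | VZ => fun z _ => z
  | VS w => fun _ f => f _ w
  end z f.

Definition up_ren (G H : ctx) (s : ty) (r : ren G H) : ren (s :: G) (s :: H) :=
  vcons (P := var (s :: H)) VZ (fun t v => VS (r t v)).

Fixpoint ren_term (G H : ctx) (r : ren G H) (t : ty) (x : term G t) : term H t :=
  match x with
  | Var v => Var (r _ v)
  | App f a => App (ren_term r f) (ren_term r a)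
  | Zero => Zero
  | One => One
  | Plus => Plus
  | Times => Times
  | Pi a b => Pi a b
  | Sigma a b c => Sigma a b c
  | Rec0 => Rec0
  end.

Fixpoint ren_fm (G H : ctx) (r : ren G H) (A : fm G) : fm H :=
  match A with
  | Eq x y => Eq (ren_term r x) (ren_term r y)
  | Lt x y => Lt (ren_term r x) (ren_term r y)
  | Bot => Bot
  | Imp B C => Imp (ren_fm r B) (ren_fm r C)
  | And B C => And (ren_fm r B) (ren_fm r C)
  | Or B C => Or (ren_fm r B) (ren_fm r C)
  | All t B => All t (ren_fm (up_ren r) B)
  | Ex t B => Ex t (ren_fm (up_ren r) B)
  end.

Definition shift (G : ctx) (s : ty) : ren G (s :: G) := fun t v => VS v.

Definition up_sub (G H : ctx) (s : ty) (r : sub G H) : sub (s :: G) (s :: H) :=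
  vcons (P := term (s :: H)) (Var VZ) (fun t v => ren_term (@shift H s) (r t v)).

Fixpoint sub_term (G H : ctx) (r : sub G H) (t : ty) (x : term G t) : term H t :=
  match x with
  | Var v => r _ v
  | App f a => App (sub_term r f) (sub_term r a)
  | Zero => Zero
  | One => One
  | Plus => Plus
  | Times => Times
  | Pi a b => Pi a b
  | Sigma a b c => Sigma a b c
  | Rec0 => Rec0
  end.

Fixpoint sub_fm (G H : ctx) (r : sub G H) (A : fm G) : fm H :=
  match A with
  | Eq x y => Eq (sub_term r x) (sub_term r y)
  | Lt x y => Lt (sub_term r x) (sub_term r y)
  | Bot => Bot
  | Imp B C => Imp (sub_fm r B) (sub_fm r C)
  | And B C => And (sub_fm r B) (sub_fm r C)
  | Or B C => Or (sub_fm r B) (sub_fm r C)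
  | All t B => All t (sub_fm (up_sub r) B)
  | Ex t B => Ex t (sub_fm (up_sub r) B)
  end.

Definition inst (G : ctx) (s : ty) (A : fm (s :: G)) (x : term G s) : fm G :=
  sub_fm (vcons (P := term G) x (fun t v => Var v)) A.

Definition weaken (G : ctx) (s : ty) (A : fm G) : fm (s :: G) :=
  ren_fm (@shift G s) A.

Definition sentence : Type := fm [].
Definition theory : Type := sentence -> Prop.

(* Natural deduction. Equality is a logical symbol at type 0 only; at higher
   types it is the defined [eq_at] below. *)
Inductive prv (T : theory) : forall G : ctx, list (fm G) -> fm G -> Prop :=
| prv_hyp G (L : list (fm G)) A : In A L -> prv T L A
| prv_ax G (L : list (fm G)) A : T A -> prv T L (ren_fm (@vnil (var G)) A)
| prv_botC G (L : list (fm G)) A : prv T (Imp A Bot :: L) Bot -> prv T L A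
| prv_impI G (L : list (fm G)) A B : prv T (A :: L) B -> prv T L (Imp A B)
| prv_impE G (L : list (fm G)) A B : prv T L (Imp A B) -> prv T L A -> prv T L B
| prv_andI G (L : list (fm G)) A B : prv T L A -> prv T L B -> prv T L (And A B)
| prv_andE1 G (L : list (fm G)) A B : prv T L (And A B) -> prv T L A
| prv_andE2 G (L : list (fm G)) A B : prv T L (And A B) -> prv T L B
| prv_orI1 G (L : list (fm G)) A B : prv T L A -> prv T L (Or A B)
| prv_orI2 G (L : list (fm G)) A B : prv T L B -> prv T L (Or A B)
| prv_orE G (L : list (fm G)) A B C :
    prv T L (Or A B) -> prv T (A :: L) C -> prv T (B :: L) C -> prv T L C
| prv_allI G (L : list (fm G)) s (A : fm (s :: G)) :
    prv T (map (@weaken G s) L) A -> prv T L (All s A)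
| prv_allE G (L : list (fm G)) s (A : fm (s :: G)) (x : term G s) :
    prv T L (All s A) -> prv T L (inst A x)
| prv_exI G (L : list (fm G)) s (A : fm (s :: G)) (x : term G s) :
    prv T L (inst A x) -> prv T L (Ex s A)
| prv_exE G (L : list (fm G)) s (A : fm (s :: G)) (C : fm G) :
    prv T L (Ex s A) -> prv T (A :: map (@weaken G s) L) (weaken s C) -> prv T L C
| prv_refl G (L : list (fm G)) (x : term G T0) : prv T L (Eq x x)
| prv_leibniz G (L : list (fm G)) (x y : term G T0) (A : fm (T0 :: G)) :
    prv T L (Eq x y) -> prv T L (inst A x) -> prv T L (inst A y).

Definition proves (T : theory) (A : sentence) : Prop := prv T [] A.
Notation "T ⊢ A" := (proves T A) (at level 70, no associativity).

Definition add_axiom (T : theory) (A : sentence) : theory := fun B => T B \/ B = A.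
Notation "T ⊕ A" := (add_axiom T A) (at level 50, left associativity).

(* [∀ x : t, A] binds [x] to the de Bruijn variable of the new binder, as a
   term in the extended context; [#x] transports a term to the (larger)
   context of the place where it is used. *)

Class incl (G H : ctx) : Type := incl_ren : ren G H.
#[export] Hint Mode incl ! ! : typeclass_instances.
#[export] Instance incl_refl (G : ctx) : incl G G | 0 := fun t v => v.
#[export] Instance incl_skip (G H : ctx) (s : ty) (i : incl G H) :
  incl G (s :: H) | 1 := fun t v => VS (i t v).

Definition lift (G H : ctx) (i : incl G H) (t : ty) (x : term G t) : term H t :=
  ren_term i x.
Arguments lift {G H i t} x.

Definition all_named (G : ctx) (t : ty) (A : term (t :: G) t -> fm (t :: G)) : fm G :=
  All t (A (Var VZ)).
Definition ex_named (G : ctx) (t : ty) (A : term (t :: G) t -> fm (t :: G)) : fm G :=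
  Ex t (A (Var VZ)).
Arguments all_named {G} t%_ty A.
Arguments ex_named {G} t%_ty A.

Notation "# x" := (lift x) (at level 8, x at level 1, format "# x") : term_scope.
Notation "f · x" := (App f x) (at level 20, left associativity) : term_scope.
Notation "0" := Zero : term_scope.
Notation "1" := One : term_scope.
Notation "x + y" := (App (App Plus x) y) : term_scope.
Notation "x * y" := (App (App Times x) y) : term_scope.

Notation "x = y" := (Eq x y) : fm_scope.
Notation "x < y" := (Lt x y) : fm_scope.
Notation "x <= y" := (Or (Lt x y) (Eq x y)) : fm_scope.
Notation "A ⇒ B" := (Imp A B) (at level 90, right associativity) : fm_scope.
Notation "A /\ B" := (And A B) : fm_scope.
Notation "A \/ B" := (Or A B) : fm_scope.
Notation "~ A" := (Imp A Bot) : fm_scope.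
Notation "∀ x : t , A" := (all_named t (fun x => A))
  (at level 200, x name, t at level 60, A at level 200) : fm_scope.
Notation "∃ x : t , A" := (ex_named t (fun x => A))
  (at level 200, x name, t at level 60, A at level 200) : fm_scope.

Fixpoint eq_at (G : ctx) (t : ty) : term G t -> term G t -> fm G :=
  match t return term G t -> term G t -> fm G with
  | T0 => fun x y => Eq x y
  | s ~> u => fun x y => (∀ z : s, eq_at (#x · #z) (#y · #z))%fm
  end.

Notation "x =[ t ] y" := (@eq_at _ t x y) (at level 70) : fm_scope.

Fixpoint closure (G : ctx) : fm G -> sentence :=
  match G return fm G -> sentence with
  | [] => fun A => A
  | s :: H => fun A => closure (All s A)
  end.

(* The axioms of discretely ordered commutative semirings (for natural
   numbers: [x < y] iff [x + 1 <= y], and [0 <= x]). *)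
Definition semiring_axioms : list sentence :=
  [ (∀ x : T0, ∀ y : T0, ∀ z : T0, (#x + #y) + #z = #x + (#y + #z))%fm;
    (∀ x : T0, ∀ y : T0, #x + #y = #y + #x)%fm;
    (∀ x : T0, #x + 0 = #x)%fm;
    (∀ x : T0, ∀ y : T0, ∀ z : T0, (#x * #y) * #z = #x * (#y * #z))%fm;
    (∀ x : T0, ∀ y : T0, #x * #y = #y * #x)%fm;
    (∀ x : T0, #x * 1 = #x)%fm;
    (∀ x : T0, #x * 0 = 0)%fm;
    (∀ x : T0, ∀ y : T0, ∀ z : T0, #x * (#y + #z) = #x * #y + #x * #z)%fm;
    (∀ x : T0, ~ #x < #x)%fm;
    (∀ x : T0, ∀ y : T0, ∀ z : T0, #x < #y /\ #y < #z ⇒ #x < #z)%fm;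
    (∀ x : T0, ∀ y : T0, #x < #y \/ #x = #y \/ #y < #x)%fm;
    (∀ x : T0, ∀ y : T0, ∀ z : T0, #x < #y ⇒ #x + #z < #y + #z)%fm;
    (∀ x : T0, ∀ y : T0, ∀ z : T0, #x < #y /\ 0 < #z ⇒ #x * #z < #y * #z)%fm;
    (∀ x : T0, 0 <= #x)%fm;
    (0 < 1)%fm;
    (∀ x : T0, ∀ y : T0, #x < #y ⇒ #x + 1 <= #y)%fm ].

(* [A(n+1)], for [A(n)] with the distinguished variable [n] innermost *)
Definition at_succ (G : ctx) (A : fm (T0 :: G)) : fm (T0 :: G) :=
  sub_fm (vcons (P := term (T0 :: G)) (Var VZ + 1)%term (fun t v => Var (VS v))) A.

Definition induction (G : ctx) (A : fm (T0 :: G)) : fm G :=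
  (inst A 0 /\ All T0 (A ⇒ at_succ A) ⇒ All T0 A)%fm.

(* [A(x, Y(x))] in the context [x, Y, G], for [A(x, y)] in the context [y, x, G] *)
Definition at_choice (s t : ty) (G : ctx) (A : fm (t :: s :: G)) :
    fm (s :: (s ~> t) :: G) :=
  sub_fm
    (vcons (P := term (s :: (s ~> t) :: G)) (App (Var (VS VZ)) (Var VZ))
      (vcons (P := term (s :: (s ~> t) :: G)) (Var VZ)
        (fun u v => Var (VS (VS v))))) A.

Definition choice (s t : ty) (G : ctx) (A : fm (t :: s :: G)) : fm G :=
  (All s (Ex t A) ⇒ Ex (s ~> t) (All s (at_choice A)))%fm.

Inductive RCA0w : theory :=
| ax_semiring (A : sentence) : In A semiring_axioms -> RCA0w A
| ax_Pi (r s : ty) :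
    RCA0w (∀ x : r, ∀ y : s, Pi r s · #x · #y =[r] #x)%fm
| ax_Sigma (r s t : ty) :
    RCA0w (∀ x : r ~> s ~> t, ∀ y : r ~> s, ∀ z : r,
             Sigma r s t · #x · #y · #z =[t] #x · #z · (#y · #z))%fm
| ax_Rec0_zero :
    RCA0w (∀ f : T1, ∀ m : T0, Rec0 · #f · #m · 0 = #m)%fm
| ax_Rec0_succ :
    RCA0w (∀ f : T1, ∀ m : T0, ∀ n : T0,
             Rec0 · #f · #m · (#n + 1) = #f · (Rec0 · #f · #m · #n))%fm
| ax_ext (r t : ty) :
    RCA0w (∀ x : r, ∀ y : r, ∀ f : r ~> t,
             #x =[r] #y ⇒ #f · #x =[t] #f · #y)%fm
| ax_ind (G : ctx) (A : fm (T0 :: G)) : qf A -> RCA0w (closure (induction A))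
| ax_QFAC10 (G : ctx) (A : fm (T0 :: T1 :: G)) :
    qf A -> RCA0w (closure (choice (s := T1) (t := T0) A)).

(* [frac] is a formal fraction (p - m) / d; it is only used with d > 0.
   A natural number [c] codes the rational (p - m) / (e + 1), where
   c = <<p, m>, e> for the Cantor pairing <a, b> = (a + b)(a + b + 1)/2 + b.
   Every number is a code, and 0 and 1 code the rationals 0 and 1. *)

Record frac (G : ctx) : Type := Frac
  { fpos : term G T0; fneg : term G T0; fden : term G T0 }.

Definition flift (G H : ctx) (i : incl G H) (q : frac G) : frac H :=
  Frac (lift (fpos q)) (lift (fneg q)) (lift (fden q)).
Arguments flift {G H i} q.

Definition fadd (G : ctx) (q r : frac G) : frac G :=
  Frac (fpos q * fden r + fpos r * fden q)
       (fneg q * fden r + fneg r * fden q)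
       (fden q * fden r).

Definition fsub (G : ctx) (q r : frac G) : frac G :=
  Frac (fpos q * fden r + fneg r * fden q)
       (fneg q * fden r + fpos r * fden q)
       (fden q * fden r).

Definition flt (G : ctx) (q r : frac G) : fm G :=
  (fpos q * fden r + fneg r * fden q < fpos r * fden q + fneg q * fden r)%fm.
Definition fle (G : ctx) (q r : frac G) : fm G :=
  (fpos q * fden r + fneg r * fden q <= fpos r * fden q + fneg q * fden r)%fm.

Declare Scope frac_scope.
Delimit Scope frac_scope with frac.
Bind Scope frac_scope with frac.
Notation "# x" := (flift x) : frac_scope.
Notation "x + y" := (fadd x y) : frac_scope.
Notation "x - y" := (fsub x y) : frac_scope.
Notation "x <Q y" := (flt x%frac y%frac) (at level 70) : fm_scope.
Notation "x <=Q y" := (fle x%frac y%frac) (at level 70) : fm_scope.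

(* [x ↦ x + x], as Sigma Plus (Sigma Pi Pi) *)
Definition double (G : ctx) : term G T1 :=
  (Sigma T0 T0 T0 · Plus · (Sigma T0 T1 T0 · Pi T0 T1 · Pi T0 T0))%term.
Arguments double {G}.

Definition pow2 (G : ctx) (n : term G T0) : term G T0 := (Rec0 · double · 1 · n)%term.

(* 2^(-n) *)
Definition eps (G : ctx) (n : term G T0) : frac G := Frac 1 0 (pow2 n).
(* 2^(-(n-1)) *)
Definition eps' (G : ctx) (n : term G T0) : frac G := Frac (1 + 1) 0 (pow2 n).

Definition is_pair (G : ctx) (c a b : term G T0) : fm G :=
  (c + c = (a + b) * (a + b + 1) + (b + b))%fm.

Definition codes (G : ctx) (c p m e : term G T0) : fm G :=
  (∃ a : T0, is_pair #a #p #m /\ is_pair #c #a #e)%fm.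

(* [A] holds of the rational coded by [c]. *)
Definition decode (G : ctx) (c : term G T0)
    (A : frac (T0 :: T0 :: T0 :: G) -> fm (T0 :: T0 :: T0 :: G)) : fm G :=
  (∃ p : T0, ∃ m : T0, ∃ e : T0,
     codes #c #p #m #e /\ A (Frac #p #m (#e + 1)))%fm.

Notation "'rat' q ':=' c 'in' A" := (decode c%term (fun q => A))
  (at level 200, q name, c at level 69, A at level 200) : fm_scope.

Definition is_real (G : ctx) (x : term G T1) : fm G :=
  (∀ n : T0, ∀ i : T0,
     rat q := #x · #n in rat r := #x · (#n + #i) in
       #q - #r <Q eps #n /\ #r - #q <Q eps #n)%fm.

Definition eqR (G : ctx) (x y : term G T1) : fm G :=
  (∀ n : T0,
     rat q := #x · #n in rat r := #y · #n in
       #q - #r <=Q eps' #n /\ #r - #q <=Q eps' #n)%fm.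

Definition ltR (G : ctx) (x y : term G T1) : fm G :=
  (∃ n : T0,
     rat q := #x · #n in rat r := #y · #n in #q + eps' #n <Q #r)%fm.

Definition leR (G : ctx) (x y : term G T1) : fm G :=
  (∀ n : T0,
     rat q := #x · #n in rat r := #y · #n in #q <=Q #r + eps' #n)%fm.

(* [x <_R y + z] and [y - z <_R x], where the sum and the difference of the
   reals y, z are represented by n ↦ y(n+1) + z(n+1) and n ↦ y(n+1) - z(n+1). *)
Definition lt_addR (G : ctx) (x y z : term G T1) : fm G :=
  (∃ n : T0,
     rat q := #x · #n in rat r := #y · (#n + 1) in rat s := #z · (#n + 1) in
       #q + eps' #n <Q #r + #s)%fm.

Definition sub_ltR (G : ctx) (y z x : term G T1) : fm G :=
  (∃ n : T0,
     rat q := #x · #n in rat r := #y · (#n + 1) in rat s := #z · (#n + 1) in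
       (#r - #s) + eps' #n <Q #q)%fm.

Definition real0 (G : ctx) : term G T1 := (Pi T0 T0 · 0)%term.
Definition real1 (G : ctx) : term G T1 := (Pi T0 T0 · 1)%term.
Arguments real0 {G}.
Arguments real1 {G}.

Definition in_unit (G : ctx) (x : term G T1) : fm G :=
  (is_real x /\ leR real0 x /\ leR x real1)%fm.

Definition pos_realfun (G : ctx) (Psi : term G (T1 ~> T1)) : fm G :=
  ((∀ x : T1, is_real #x ⇒ is_real (#Psi · #x) /\ ltR real0 (#Psi · #x)) /\
   (∀ x : T1, ∀ y : T1,
      is_real #x /\ is_real #y ⇒ eqR #x #y ⇒ eqR (#Psi · #x) (#Psi · #y)))%fm.

(* A finite sequence of type-1 objects is coded by its length [k] and a
   [y] of type 0 -> 1, with entries [y 0, ..., y (k-1)]. *)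
Definition HBU : sentence :=
  (∀ Psi : T1 ~> T1, pos_realfun #Psi ⇒
     ∃ k : T0, ∃ y : T0 ~> T1,
       (∀ i : T0, #i < #k ⇒ in_unit (#y · #i)) /\
       (∀ x : T1, in_unit #x ⇒
          ∃ i : T0, #i < #k /\
            sub_ltR (#y · #i) (#Psi · (#y · #i)) #x /\
            lt_addR #x (#y · #i) (#Psi · (#y · #i))))%fm.

Definition mem (G : ctx) (f : term G T1) (D : term G T2) : fm G := (D · f = 1)%fm.
Notation "f ∈ D" := (mem f D) (at level 70) : fm_scope.

Definition rel (G : ctx) (R : term G (T1 ~> T1 ~> T0)) (f g : term G T1) : fm G :=
  (R · f · g = 1)%fm.

Definition is_set (G : ctx) (D : term G T2) : fm G := (∀ f : T1, #D · #f <= 1)%fm.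

Definition directed (G : ctx) (D : term G T2) (R : term G (T1 ~> T1 ~> T0)) : fm G :=
  (is_set D /\
   (∃ f : T1, #f ∈ #D) /\
   (∀ f : T1, #f ∈ #D ⇒ rel #R #f #f) /\
   (∀ f : T1, ∀ g : T1, ∀ h : T1, #f ∈ #D /\ #g ∈ #D /\ #h ∈ #D ⇒
      rel #R #f #g /\ rel #R #g #h ⇒ rel #R #f #h) /\
   (∀ f : T1, ∀ g : T1, #f ∈ #D /\ #g ∈ #D ⇒
      ∃ h : T1, #h ∈ #D /\ rel #R #f #h /\ rel #R #g #h))%fm.

Definition net (G : ctx) (D : term G T2) (R : term G (T1 ~> T1 ~> T0))
    (x : term G (T1 ~> T1)) : fm G :=
  (directed D R /\ (∀ d : T1, #d ∈ #D ⇒ in_unit (#x · #d)))%fm.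

Definition subnet (G : ctx)
    (B : term G T2) (S : term G (T1 ~> T1 ~> T0)) (y : term G (T1 ~> T1))
    (D : term G T2) (R : term G (T1 ~> T1 ~> T0)) (x : term G (T1 ~> T1)) : fm G :=
  (∃ phi : T1 ~> T1,
     (∀ b : T1, #b ∈ #B ⇒ #phi · #b ∈ #D /\ eqR (#y · #b) (#x · (#phi · #b))) /\
     (∀ d : T1, #d ∈ #D ⇒
        ∃ b0 : T1, #b0 ∈ #B /\
          ∀ b : T1, #b ∈ #B /\ rel #S #b0 #b ⇒ rel #R #d (#phi · #b)))%fm.

(* Neighbourhoods of [l] are given by the open intervals (p, q) with real
   endpoints that contain [l]. *)
Definition converges (G : ctx) (D : term G T2) (R : term G (T1 ~> T1 ~> T0))
    (x : term G (T1 ~> T1)) (l : term G T1) : fm G :=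
  (∀ p : T1, ∀ q : T1, is_real #p /\ is_real #q ⇒ ltR #p #l /\ ltR #l #q ⇒
     ∃ d : T1, #d ∈ #D /\
       ∀ e : T1, #e ∈ #D /\ rel #R #d #e ⇒
         ltR #p (#x · #e) /\ ltR (#x · #e) #q)%fm.

Definition BW_net : sentence :=
  (∀ D : T2, ∀ R : T1 ~> T1 ~> T0, ∀ x : T1 ~> T1, net #D #R #x ⇒
     ∃ B : T2, ∃ S : T1 ~> T1 ~> T0, ∃ y : T1 ~> T1,
       net #B #S #y /\ subnet #B #S #y #D #R #x /\
       ∃ l : T1, in_unit #l /\ converges #B #S #y #l)%fm.

(* Main.v *)
(* By a Henkin completeness theorem it suffices to show that every model of RCA_0^omega +
   BW_net satisfies HBU, which leaves ordinary mathematics inside a model with possibly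
   nonstandard numbers. Fix Psi and assume that no finite sequence of reals covers [0,1].

   If every real in [0,1] lies in the interval around some rational center, then for every n
   some (rational) point avoids, up to a margin vanishing with n, the first n intervals with
   rational centers and rational inner radii; these points form a net, and a cluster point of
   it is not covered by any interval with rational center.

   Otherwise some x0 lies in no interval with rational center, so Psi is discontinuous at x0,
   and Grilliot's trick turns this into the functional E^2 deciding (exists n) f(n) = 1. Thus
   arithmetical predicates have characteristic functions, and one can form the net whose
   indices are the finite sequences of reals in [0,1] together with a point they do not cover,
   ordered by inclusion of the sequences. A cluster point l of this net is approached by points
   that avoid the interval around l, which is impossible. *)
From HB Require Import structures.
From mathcomp Require Import all_boot all_order all_algebra.
From mathcomp Require Import boolp ring lra.
From Stdlib Require Import Eqdep_dec List.
Require Import Defs.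
Import ListNotations.
Import Order.TTheory GRing.Theory Num.Theory.

Set Implicit Arguments.
Unset Strict Implicit.
Unset Printing Implicit Defensive.

(** * Renaming and substitution *)

(** In a model, induction holds only for quantifier-free formulas with parameters, and beyond the
    combinators and the recursor the only source of functionals is choice from type 1 to type 0.
    Every set, search and net below must therefore come with a functional of the model that
    represents it. The predicates [rep] and [dec] keep track of this, and bounded search has to be
    built before subtraction, rationals and pairing functions exist.

    The case distinction has the same origin. For sequences of arbitrary reals, being a real, lying
    in an interval and inclusion all quantify over numbers, so their characteristic functions are
    taken from E^2. Intervals with rational centers and rational inner radii can be numbered, and
    avoiding the first n of them by a margin is decidable outright.

    The discontinuity at x0 arises as follows: Psi is positive there, but a rational center c whose
    interval omits x0 has Psi(c) <= |x0 - c|, so Psi tends to 0 along centers converging to x0. *)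

Lemma var_case (G : ctx) (s : ty) (P : forall t, var (s :: G) t -> Prop) :
  P s VZ -> (forall t (v : var G t), P t (VS v)) -> forall t v, P t v.
Proof.
move=> PZ PS t v; move: P PZ PS.
(* The return clause computes on the context, so the empty context yields [unit] and no equation
   between types has to be inverted. *)
refine (match v in var L u return
  match L return var L u -> Type with
  | nil => fun _ => unit
  | s0 :: G0 => fun v0 => forall P : forall t, var (s0 :: G0) t -> Prop,
      P s0 VZ -> (forall t (w : var G0 t), P t (VS w)) -> P u v0
  end v with VZ _ _ => _ | VS _ _ _ _ => _ end).
- by move=> P PZ _; apply: PZ.
- by move=> P _ PS; apply: PS.
Qed.

Lemma var_nil (P : Prop) t (v : var [] t) : P.
Proof. exact: (vnil (fun=> P) v). Qed.

Lemma var_funext (P : ty -> Type) (G : ctx) (f g : forall t, var G t -> P t) :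
  (forall t v, f t v = g t v) -> f = g.
Proof.
move=> e; apply: functional_extensionality_dep => t.
by apply: functional_extensionality_dep => v.
Qed.

Lemma var_nilE (P : ty -> Type) (f g : forall t, var [] t -> P t) : f = g.
Proof. by apply: var_funext => t v; exact: (var_nil _ v). Qed.

Lemma vconsE (P : ty -> Type) (G : ctx) s (f g : forall t, var (s :: G) t -> P t) :
  f s VZ = g s VZ -> (forall t (v : var G t), f t (VS v) = g t (VS v)) -> f = g.
Proof.
move=> e0 e1; apply: var_funext => t v.
by apply: (@var_case G s (fun t v => f t v = g t v)).
Qed.

Lemma up_ren_id (G : ctx) s : up_ren (s := s) (fun t (v : var G t) => v) = fun t v => v.
Proof. exact: vconsE. Qed.

Lemma up_ren_comp (G H K : ctx) s (r : ren G H) (q : ren H K) :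
  (fun t v => up_ren (s := s) q (up_ren r v)) = up_ren (fun t v => q t (r t v)).
Proof. exact: vconsE. Qed.

Lemma ren_term_comp (G H K : ctx) (r : ren G H) (q : ren H K) t (x : term G t) :
  ren_term q (ren_term r x) = ren_term (fun t v => q t (r t v)) x.
Proof. by elim: x => //= s u f -> a ->. Qed.

Lemma ren_fm_comp (G : ctx) (A : fm G) : forall (H K : ctx) (r : ren G H) (q : ren H K),
  ren_fm q (ren_fm r A) = ren_fm (fun t v => q t (r t v)) A.
Proof.
elim: A => {G} /=.
- by move=> G x y H K r q; rewrite !ren_term_comp.
- by move=> G x y H K r q; rewrite !ren_term_comp.
- by [].
- by move=> G A IA B IB H K r q; rewrite IA IB.
- by move=> G A IA B IB H K r q; rewrite IA IB.
- by move=> G A IA B IB H K r q; rewrite IA IB.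
- by move=> G s A IA H K r q; rewrite IA up_ren_comp.
- by move=> G s A IA H K r q; rewrite IA up_ren_comp.
Qed.

Lemma ren_term_id (G : ctx) t (x : term G t) : ren_term (fun t v => v) x = x.
Proof. by elim: x => //= s u f -> a ->. Qed.

Lemma ren_fm_id (G : ctx) (A : fm G) : ren_fm (fun t v => v) A = A.
Proof.
elim: A => {G} //=.
- by move=> G x y; rewrite !ren_term_id.
- by move=> G x y; rewrite !ren_term_id.
- by move=> G A -> B ->.
- by move=> G A -> B ->.
- by move=> G A -> B ->.
- by move=> G s A; rewrite up_ren_id => ->.
- by move=> G s A; rewrite up_ren_id => ->.
Qed.

Lemma sub_ren_term (G H K : ctx) (r : ren G H) (q : sub H K) t (x : term G t) :
  sub_term q (ren_term r x) = sub_term (fun t v => q t (r t v)) x.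
Proof. by elim: x => //= s u f -> a ->. Qed.

Lemma sub_up_ren (G H K : ctx) s (r : ren G H) (q : sub H K) :
  (fun t v => up_sub (s := s) q (up_ren r v)) = up_sub (fun t v => q t (r t v)).
Proof. exact: vconsE. Qed.

Lemma sub_ren_fm (G : ctx) (A : fm G) : forall (H K : ctx) (r : ren G H) (q : sub H K),
  sub_fm q (ren_fm r A) = sub_fm (fun t v => q t (r t v)) A.
Proof.
elim: A => {G} /=.
- by move=> G x y H K r q; rewrite !sub_ren_term.
- by move=> G x y H K r q; rewrite !sub_ren_term.
- by [].
- by move=> G A IA B IB H K r q; rewrite IA IB.
- by move=> G A IA B IB H K r q; rewrite IA IB.
- by move=> G A IA B IB H K r q; rewrite IA IB.
- by move=> G s A IA H K r q; rewrite IA sub_up_ren.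
- by move=> G s A IA H K r q; rewrite IA sub_up_ren.
Qed.

Lemma ren_sub_term (G H K : ctx) (q : sub G H) (r : ren H K) t (x : term G t) :
  ren_term r (sub_term q x) = sub_term (fun t v => ren_term r (q t v)) x.
Proof. by elim: x => //= s u f -> a ->. Qed.

Lemma ren_up_sub (G H K : ctx) s (q : sub G H) (r : ren H K) :
  (fun t v => ren_term (up_ren (s := s) r) (up_sub q v))
  = up_sub (fun t v => ren_term r (q t v)).
Proof. by apply: vconsE => // t v /=; rewrite !ren_term_comp. Qed.

Lemma ren_sub_fm (G : ctx) (A : fm G) : forall (H K : ctx) (q : sub G H) (r : ren H K),
  ren_fm r (sub_fm q A) = sub_fm (fun t v => ren_term r (q t v)) A.
Proof.
elim: A => {G} /=.
- by move=> G x y H K q r; rewrite !ren_sub_term.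
- by move=> G x y H K q r; rewrite !ren_sub_term.
- by [].
- by move=> G A IA B IB H K q r; rewrite IA IB.
- by move=> G A IA B IB H K q r; rewrite IA IB.
- by move=> G A IA B IB H K q r; rewrite IA IB.
- by move=> G s A IA H K q r; rewrite IA ren_up_sub.
- by move=> G s A IA H K q r; rewrite IA ren_up_sub.
Qed.

Lemma sub_sub_term (G H K : ctx) (q : sub G H) (r : sub H K) t (x : term G t) :
  sub_term r (sub_term q x) = sub_term (fun t v => sub_term r (q t v)) x.
Proof. by elim: x => //= s u f -> a ->. Qed.

Lemma sub_up_sub (G H K : ctx) s (q : sub G H) (r : sub H K) :
  (fun t v => sub_term (up_sub (s := s) r) (up_sub q v))
  = up_sub (fun t v => sub_term r (q t v)).
Proof. by apply: vconsE => // t v /=; rewrite sub_ren_term ren_sub_term. Qed.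

Lemma sub_sub_fm (G : ctx) (A : fm G) : forall (H K : ctx) (q : sub G H) (r : sub H K),
  sub_fm r (sub_fm q A) = sub_fm (fun t v => sub_term r (q t v)) A.
Proof.
elim: A => {G} /=.
- by move=> G x y H K q r; rewrite !sub_sub_term.
- by move=> G x y H K q r; rewrite !sub_sub_term.
- by [].
- by move=> G A IA B IB H K q r; rewrite IA IB.
- by move=> G A IA B IB H K q r; rewrite IA IB.
- by move=> G A IA B IB H K q r; rewrite IA IB.
- by move=> G s A IA H K q r; rewrite IA sub_up_sub.
- by move=> G s A IA H K q r; rewrite IA sub_up_sub.
Qed.

Lemma sub_term_ren (G H : ctx) (r : ren G H) t (x : term G t) :
  sub_term (fun t v => Var (r t v)) x = ren_term r x.
Proof. by elim: x => //= s u f -> a ->. Qed.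

Lemma sub_fm_ren (G : ctx) (A : fm G) : forall (H : ctx) (r : ren G H),
  sub_fm (fun t v => Var (r t v)) A = ren_fm r A.
Proof.
have upE (G' H : ctx) s (r : ren G' H) :
  up_sub (s := s) (fun t v => Var (r t v)) = fun t v => Var (up_ren r v).
  exact: vconsE.
elim: A => {G} /=.
- by move=> G x y H r; rewrite !sub_term_ren.
- by move=> G x y H r; rewrite !sub_term_ren.
- by [].
- by move=> G A IA B IB H r; rewrite IA IB.
- by move=> G A IA B IB H r; rewrite IA IB.
- by move=> G A IA B IB H r; rewrite IA IB.
- by move=> G s A IA H r; rewrite upE IA.
- by move=> G s A IA H r; rewrite upE IA.
Qed.

Lemma sub_term_id (G : ctx) t (x : term G t) : sub_term (fun t v => Var v) x = x.
Proof. by rewrite (sub_term_ren (fun t v => v)) ren_term_id. Qed.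

Lemma sub_fm_id (G : ctx) (A : fm G) : sub_fm (fun t v => Var v) A = A.
Proof. by rewrite (sub_fm_ren A (fun t v => v)) ren_fm_id. Qed.

Lemma inst_sub (G H : ctx) s (q : sub G H) (A : fm (s :: G)) (x : term H s) :
  inst (sub_fm (up_sub q) A) x = sub_fm (vcons x q) A.
Proof.
rewrite /inst sub_sub_fm; congr sub_fm.
by apply: vconsE => // t v /=; rewrite sub_ren_term sub_term_id.
Qed.

Lemma inst_ren (G H : ctx) s (r : ren G H) (A : fm (s :: G)) (x : term H s) :
  inst (ren_fm (up_ren r) A) x = sub_fm (vcons x (fun t v => Var (r t v))) A.
Proof. by rewrite /inst sub_ren_fm; congr sub_fm; exact: vconsE. Qed.

Lemma ren_inst (G H : ctx) s (r : ren G H) (A : fm (s :: G)) (x : term G s) :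
  ren_fm r (inst A x) = inst (ren_fm (up_ren r) A) (ren_term r x).
Proof. by rewrite inst_ren /inst ren_sub_fm; congr sub_fm; exact: vconsE. Qed.

Lemma ren_weaken (G H : ctx) s (r : ren G H) (A : fm G) :
  ren_fm (up_ren r) (weaken s A) = weaken s (ren_fm r A).
Proof. by rewrite /weaken !ren_fm_comp. Qed.

(** * Structural rules of natural deduction *)

(** Renaming and weakening are proved together: with an inclusion of hypotheses in the statement,
    the induction passes under binders, and plain weakening is the identity renaming. *)
Lemma prv_ren T (G : ctx) (L : list (fm G)) A : prv T L A ->
  forall (H : ctx) (r : ren G H) L', List.incl (List.map (ren_fm r) L) L' ->
  prv T L' (ren_fm r A).
Proof.
have inclC (X : Type) (a : X) l l' : List.incl l l' -> List.incl (a :: l) (a :: l').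
  by move=> i x [->|/i]; [left|right].
have inclW (G' H : ctx) s (r : ren G' H) L1 L2 :
    List.incl (List.map (ren_fm r) L1) L2 ->
    List.incl (List.map (ren_fm (up_ren r)) (List.map (@weaken G' s) L1))
      (List.map (@weaken H s) L2).
  move=> i x; rewrite List.map_map => /List.in_map_iff [y [<- yL]].
  by rewrite ren_weaken; apply: List.in_map; apply: i; apply: List.in_map.
elim=> {G L A} /=.
- by move=> G L A iA H r L' i; apply: prv_hyp; apply: i; apply: List.in_map.
- move=> G L A TA H r L' i; rewrite ren_fm_comp.
  by rewrite (var_nilE (fun t v => r t (vnil (var G) v)) (@vnil (var H))); apply: prv_ax.
- move=> G L A _ IH H r L' i; apply: prv_botC; apply: (IH H r).
  exact: inclC.
- move=> G L A B _ IH H r L' i; apply: prv_impI; apply: IH; exact: inclC.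
- move=> G L A B _ IH1 _ IH2 H r L' i.
  by apply: (prv_impE (A := ren_fm r A)); [apply: IH1|apply: IH2].
- by move=> G L A B _ IH1 _ IH2 H r L' i; apply: prv_andI; [apply: IH1|apply: IH2].
- by move=> G L A B _ IH H r L' i; apply: prv_andE1; apply: IH.
- by move=> G L A B _ IH H r L' i; apply: prv_andE2; apply: IH.
- by move=> G L A B _ IH H r L' i; apply: prv_orI1; apply: IH.
- by move=> G L A B _ IH H r L' i; apply: prv_orI2; apply: IH.
- move=> G L A B C _ IH _ IH1 _ IH2 H r L' i.
  by apply: (prv_orE (IH H r L' i)); [apply: IH1|apply: IH2]; apply: inclC.
- move=> G L s A _ IH H r L' i; apply: prv_allI; apply: IH; exact: inclW.
- move=> G L s A x _ IH H r L' i; rewrite ren_inst; apply: prv_allE; exact: IH.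
- move=> G L s A x _ IH H r L' i; apply: (prv_exI (x := ren_term r x)).
  by rewrite -ren_inst; apply: IH.
- move=> G L s A C _ IH1 _ IH2 H r L' i; apply: (prv_exE (IH1 H r L' i)).
  by rewrite -ren_weaken; apply: IH2; apply: inclC; apply: inclW.
- by move=> *; apply: prv_refl.
- move=> G L x y A _ IH1 _ IH2 H r L' i; rewrite ren_inst.
  by apply: (prv_leibniz (x := ren_term r x)); [apply: IH1|rewrite -ren_inst; apply: IH2].
Qed.

Lemma prv_weak T (G : ctx) (L L' : list (fm G)) A : List.incl L L' -> prv T L A -> prv T L' A.
Proof.
move=> i p; rewrite -(ren_fm_id A); apply: (prv_ren p).
move=> x /List.in_map_iff [y [<- yL]]; rewrite ren_fm_id; exact: i.
Qed.

Lemma prv_botE T (G : ctx) (L : list (fm G)) A : prv T L Bot -> prv T L A.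
Proof. by move=> p; apply: prv_botC; apply: prv_weak p => x; right. Qed.

Definition consistent T (G : ctx) (L : list (fm G)) : Prop := ~ prv T L Bot.

Lemma consistent_or T (G : ctx) (L : list (fm G)) A :
  consistent T L -> consistent T (A :: L) \/ consistent T (Imp A Bot :: L).
Proof.
move=> cL; have [pA|] := EM (prv T (A :: L) Bot); last by left.
right=> pN; apply: cL; apply: prv_impE (prv_impI pN) (prv_impI pA).
Qed.

(** The bound variable itself becomes the Henkin witness, as a fresh variable of the extended
    context; no new constants are added to the language. *)
Lemma consistent_witness T (G : ctx) (L : list (fm G)) s (B : fm (s :: G)) :
  consistent T L -> prv T L (Ex s B) -> consistent T (B :: List.map (@weaken G s) L).
Proof. by move=> cL pE p; apply: cL; apply: (prv_exE (C := Bot) pE p). Qed.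

(** * Enumeration of terms and formulas by depth *)

Lemma ty_eq_dec (s t : ty) : {s = t} + {s <> t}.
Proof. decide equality. Defined.

Fixpoint enum_ty (n : nat) : list ty :=
  if n is m.+1 then
    T0 :: List.flat_map (fun s => List.map (Arr s) (enum_ty m)) (enum_ty m)
  else [].

Definition tterm (G : ctx) : Type := {t : ty & term G t}.

Fixpoint enum_var (G : ctx) : list {t : ty & var G t} :=
  match G with
  | [] => []
  | s :: H => existT _ s VZ ::
      List.map (fun v => existT (var (s :: H)) (projT1 v) (VS (projT2 v))) (enum_var H)
  end.

Definition mkapp (G : ctx) (f a : tterm G) : list (tterm G) :=
  match f with
  | existT u f =>
    match u return term G u -> list (tterm G) with
    | T0 => fun _ => []
    | s ~> t => fun f => match ty_eq_dec (projT1 a) s with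
        | left e => [existT _ t (App f (eq_rect _ (term G) (projT2 a) s e))]
        | right _ => []
        end
    end f
  end.

Fixpoint enum_term (n : nat) (G : ctx) : list (tterm G) :=
  if n is m.+1 then
    List.map (fun v => existT (term G) (projT1 v) (Var (projT2 v))) (enum_var G) ++
    [existT _ _ Zero; existT _ _ One; existT _ _ Plus; existT _ _ Times;
     existT _ _ Rec0] ++
    List.flat_map (fun r => List.map (fun s => existT (term G) _ (Pi r s)) (enum_ty m))
      (enum_ty m) ++
    List.flat_map (fun r => List.flat_map (fun s =>
       List.map (fun t => existT (term G) _ (Sigma r s t)) (enum_ty m)) (enum_ty m))
      (enum_ty m) ++
    List.flat_map (fun f => List.flat_map (mkapp f) (enum_term m G)) (enum_term m G)
  else [].

Definition select0 (G : ctx) (x : tterm G) : list (term G T0) :=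
  match ty_eq_dec (projT1 x) T0 with
  | left e => [eq_rect _ (term G) (projT2 x) T0 e]
  | right _ => []
  end.

Definition pairs (X Y : Type) (l l' : list X) (f : X -> X -> Y) : list Y :=
  List.flat_map (fun x => List.map (f x) l') l.

Fixpoint enum_fm (n : nat) (G : ctx) : list (fm G) :=
  if n is m.+1 then
    let tms := List.flat_map (@select0 G) (enum_term m G) in
    let fms := enum_fm m G in
    pairs tms tms (@Eq G) ++ pairs tms tms (@Lt G) ++ [Bot] ++
    pairs fms fms Imp ++ pairs fms fms And ++ pairs fms fms Or ++
    List.flat_map (fun t => List.map (All t) (enum_fm m (t :: G))) (enum_ty m) ++
    List.flat_map (fun t => List.map (Ex t) (enum_fm m (t :: G))) (enum_ty m)
  else [].

Fixpoint depth_ty (t : ty) : nat :=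
  if t is s ~> u then (maxn (depth_ty s) (depth_ty u)).+1 else 0%N.

Fixpoint depth_term (G : ctx) (t : ty) (x : term G t) : nat :=
  match x with
  | App _ _ f a => (maxn (depth_term f) (depth_term a)).+1
  | Pi r s => (maxn (depth_ty r) (depth_ty s)).+1
  | Sigma r s t => (maxn (depth_ty r) (maxn (depth_ty s) (depth_ty t))).+1
  | _ => 0%N
  end.

Fixpoint depth_fm (G : ctx) (A : fm G) : nat :=
  match A with
  | Eq x y | Lt x y => (maxn (depth_term x) (depth_term y)).+1
  | Bot => 0%N
  | Imp B C | And B C | Or B C => (maxn (depth_fm B) (depth_fm C)).+1
  | All t B | Ex t B => (maxn (depth_ty t) (depth_fm B)).+1
  end.

Lemma depth_ren_term (G H : ctx) (r : ren G H) t (x : term G t) :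
  depth_term (ren_term r x) = depth_term x.
Proof. by elim: x => //= s u f -> a ->. Qed.

(** The context grows during the Henkin construction. Depth is invariant under renaming, so a
    formula carried along the stages is eventually reached by an enumeration by depth. *)
Lemma depth_ren_fm (G : ctx) (A : fm G) : forall (H : ctx) (r : ren G H),
  depth_fm (ren_fm r A) = depth_fm A.
Proof.
elim: A => {G} //=.
- by move=> G x y H r; rewrite !depth_ren_term.
- by move=> G x y H r; rewrite !depth_ren_term.
- by move=> G A IA B IB H r; rewrite IA IB.
- by move=> G A IA B IB H r; rewrite IA IB.
- by move=> G A IA B IB H r; rewrite IA IB.
- by move=> G s A IA H r; rewrite IA.
- by move=> G s A IA H r; rewrite IA.
Qed.

Lemma in_flat_mapI (X Y : Type) (f : X -> list Y) l x y :
  List.In x l -> List.In y (f x) -> List.In y (List.flat_map f l).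
Proof. by move=> xl yf; apply/List.in_flat_map; exists x. Qed.

Lemma in_pairs (X Y : Type) (f : X -> X -> Y) l l' x y :
  List.In x l -> List.In y l' -> List.In (f x y) (pairs l l' f).
Proof. by move=> xl yl; apply: (in_flat_mapI xl); apply: List.in_map. Qed.

Lemma in_enum_ty t n : depth_ty t < n -> List.In t (enum_ty n).
Proof.
elim: t n => [|s Is u Iu] [|n] //=; first by left.
rewrite ltnS => d; right; apply: (in_flat_mapI (x := s)).
  by apply: Is; apply: leq_ltn_trans d; apply: leq_maxl.
by apply: List.in_map; apply: Iu; apply: leq_ltn_trans d; apply: leq_maxr.
Qed.

Lemma in_enum_var (G : ctx) t (v : var G t) : List.In (existT _ t v) (enum_var G).
Proof.
elim: v => {G t} [G t|G s t v IH] /=; first by left.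
by right; exact: (List.in_map
  (fun v => existT (var (s :: G)) (projT1 v) (VS (projT2 v))) _ _ IH).
Qed.

Lemma ty_eq_refl (t : ty) : ty_eq_dec t t = left erefl.
Proof.
case: (ty_eq_dec t t) => // e; congr left.
exact: (UIP_dec ty_eq_dec).
Qed.

Lemma in_enum_term (G : ctx) t (x : term G t) n :
  depth_term x < n -> List.In (existT _ t x) (enum_term n G).
Proof.
elim: x n => {t}.
- move=> t v [|n] //= _; apply/List.in_app_iff; left.
  exact: (List.in_map
    (fun v => existT (term G) (projT1 v) (Var (projT2 v))) _ _ (in_enum_var v)).
- move=> s t f If a Ia [|n] //=; rewrite ltnS gtn_max => /andP [df da].
  apply/List.in_app_iff; right; do 5 right; do 2 (apply/List.in_app_iff; right).
  apply: in_flat_mapI (If n df) _; apply: in_flat_mapI (Ia n da) _.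
  by rewrite /mkapp /= ty_eq_refl; left.
- by move=> [|n] //= _; apply/List.in_app_iff; right; left.
- by move=> [|n] //= _; apply/List.in_app_iff; right; do 1 right; left.
- by move=> [|n] //= _; apply/List.in_app_iff; right; do 2 right; left.
- by move=> [|n] //= _; apply/List.in_app_iff; right; do 3 right; left.
- move=> r s [|n] //=; rewrite ltnS gtn_max => /andP [dr ds].
  apply/List.in_app_iff; right; do 5 right; apply/List.in_app_iff; left.
  apply: in_flat_mapI (in_enum_ty dr) _.
  exact: (List.in_map (fun s => existT (term G) _ (Pi r s)) _ _ (in_enum_ty ds)).
- move=> r s t [|n] //=; rewrite ltnS !gtn_max => /and3P [dr ds dt].
  apply/List.in_app_iff; right; do 5 right; apply/List.in_app_iff; right.
  apply/List.in_app_iff; left.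
  apply: in_flat_mapI (in_enum_ty dr) _; apply: in_flat_mapI (in_enum_ty ds) _.
  exact: (List.in_map (fun t => existT (term G) _ (Sigma r s t)) _ _ (in_enum_ty dt)).
- by move=> [|n] //= _; apply/List.in_app_iff; right; do 4 right; left.
Qed.

Lemma in_select0 (G : ctx) (x : term G T0) n : depth_term x < n ->
  List.In x (List.flat_map (@select0 G) (enum_term n G)).
Proof.
move=> d; apply: in_flat_mapI (in_enum_term d) _.
by rewrite /select0 /= ; left.
Qed.

Lemma in_enum_fm (G : ctx) (A : fm G) n : depth_fm A < n -> List.In A (enum_fm n G).
Proof.
elim: A n => {G}.
- move=> G x y [|n] //=; rewrite ltnS gtn_max => /andP [dx dy].
  by apply/List.in_app_iff; left; apply: in_pairs; apply: in_select0.
- move=> G x y [|n] //=; rewrite ltnS gtn_max => /andP [dx dy].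
  apply/List.in_app_iff; right; apply/List.in_app_iff; left.
  by apply: in_pairs; apply: in_select0.
- by move=> G [|n] //= _; do 2 (apply/List.in_app_iff; right); left.
- move=> G A IA B IB [|n] //=; rewrite ltnS gtn_max => /andP [dA dB].
  do 2 (apply/List.in_app_iff; right); right; apply/List.in_app_iff; left.
  by apply: in_pairs; [apply: IA|apply: IB].
- move=> G A IA B IB [|n] //=; rewrite ltnS gtn_max => /andP [dA dB].
  do 2 (apply/List.in_app_iff; right); right; apply/List.in_app_iff; right.
  apply/List.in_app_iff; left.
  by apply: in_pairs; [apply: IA|apply: IB].
- move=> G A IA B IB [|n] //=; rewrite ltnS gtn_max => /andP [dA dB].
  do 2 (apply/List.in_app_iff; right); right; do 2 (apply/List.in_app_iff; right).
  apply/List.in_app_iff; left.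
  by apply: in_pairs; [apply: IA|apply: IB].
- move=> G s A IA [|n] //=; rewrite ltnS gtn_max => /andP [ds dA].
  do 2 (apply/List.in_app_iff; right); right; do 3 (apply/List.in_app_iff; right).
  apply/List.in_app_iff; left.
  by apply: in_flat_mapI (in_enum_ty ds) _; apply: List.in_map; apply: IA.
- move=> G s A IA [|n] //=; rewrite ltnS gtn_max => /andP [ds dA].
  do 2 (apply/List.in_app_iff; right); right; do 4 (apply/List.in_app_iff; right).
  by apply: in_flat_mapI (in_enum_ty ds) _; apply: List.in_map; apply: IA.
Qed.

(** * Models and the Henkin construction *)

(* Equality of the model is Leibniz equality at every type, hence the field [m_ext]. *)
Record model : Type := Model {
  dom : ty -> Type;
  ap : forall s t, dom (s ~> t) -> dom s -> dom t;
  m0 : dom T0;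
  m1 : dom T0;
  mplus : dom (T0 ~> T0 ~> T0);
  mtimes : dom (T0 ~> T0 ~> T0);
  mpi : forall r s, dom (r ~> s ~> r);
  msigma : forall r s t, dom ((r ~> s ~> t) ~> (r ~> s) ~> r ~> t);
  mrec : dom (T1 ~> T0 ~> T0 ~> T0);
  mlt : dom T0 -> dom T0 -> Prop;
  m_ext : forall s t (f g : dom (s ~> t)), (forall x, ap f x = ap g x) -> f = g
}.
Arguments ap {_ s t} _ _.

Definition menv (M : model) (G : ctx) : Type := forall t : ty, var G t -> dom M t.

Fixpoint eval (M : model) (G : ctx) (e : menv M G) (t : ty) (x : term G t) : dom M t :=
  match x with
  | Var _ v => e _ v
  | App _ _ f a => ap (eval e f) (eval e a)
  | Zero => m0 M
  | One => m1 M
  | Plus => mplus M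
  | Times => mtimes M
  | Pi r s => mpi M r s
  | Sigma r s t => msigma M r s t
  | Rec0 => mrec M
  end.

Definition mcons (M : model) (G : ctx) (s : ty) (a : dom M s) (e : menv M G) :
  menv M (s :: G) := vcons (P := dom M) a e.

Fixpoint sat (M : model) (G : ctx) (e : menv M G) (A : fm G) : Prop :=
  match A with
  | Eq x y => eval e x = eval e y
  | Lt x y => mlt (eval e x) (eval e y)
  | Bot => False
  | Imp B C => sat e B -> sat e C
  | And B C => sat e B /\ sat e C
  | Or B C => sat e B \/ sat e C
  | All s B => forall a : dom M s, sat (mcons a e) B
  | Ex s B => exists a : dom M s, sat (mcons a e) B
  end.

Definition mnil (M : model) : menv M [] := vnil (dom M).

(** * Quotients by an equivalence relation *)

Section Quotient.
Variables (X : Type) (E : X -> X -> Prop).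
Hypothesis Erefl : forall x, E x x.
Hypothesis Esym : forall x y, E x y -> E y x.
Hypothesis Etrans : forall x y z, E x y -> E y z -> E x z.

Definition quo : Type := {P : X -> Prop | exists x, P = E x}.
Definition cls (x : X) : quo := exist _ (E x) (ex_intro _ x erefl).

Lemma cls_eq x y : cls x = cls y <-> E x y.
Proof.
split=> [/(congr1 (@proj1_sig _ _)) /= e|xy]; first by rewrite e; exact: Erefl.
apply: eq_exist; apply: funext => z; apply: propext; split.
- by move=> xz; apply: Etrans xz; apply: Esym.
- by move=> yz; apply: Etrans yz.
Qed.

Lemma cls_surj (q : quo) : exists x, cls x = q.
Proof. by case: q => P [x e]; exists x; apply: eq_exist. Qed.

Definition crepr (q : quo) : X := projT1 (cid (cls_surj q)).

Lemma crepr_cls x : E (crepr (cls x)) x.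
Proof. by apply/cls_eq; rewrite /crepr; case: cid. Qed.

Lemma creprK q : cls (crepr q) = q.
Proof. by rewrite /crepr; case: cid. Qed.

End Quotient.

(** * Properties that hold from some stage on *)

Definition eventually (P : nat -> Prop) : Prop := exists n, forall k, (n <= k)%N -> P k.

Lemma ev_all (P : nat -> Prop) : (forall k, P k) -> eventually P.
Proof. by move=> p; exists 0%N. Qed.

Lemma ev_imp (P Q : nat -> Prop) :
  eventually P -> eventually (fun k => P k -> Q k) -> eventually Q.
Proof.
move=> [n p] [m q]; exists (maxn n m) => k; rewrite geq_max => /andP [nk mk].
exact: q (p _ nk).
Qed.

Lemma ev_and (P Q : nat -> Prop) :
  eventually P -> eventually Q -> eventually (fun k => P k /\ Q k).
Proof.
move=> [n p] [m q]; exists (maxn n m) => k; rewrite geq_max => /andP [nk mk].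
by split; [apply: p|apply: q].
Qed.

Lemma ev_mono (P Q : nat -> Prop) :
  (forall k, P k -> Q k) -> eventually P -> eventually Q.
Proof. by move=> pq [n p]; exists n => k nk; apply: pq; apply: p. Qed.

(* A step function applied from stage [n] on, with junk before. *)
Lemma extend_seq (X : nat -> Type) (f : forall k, X k -> X k.+1) (d : forall k, X k) n (x : X n) :
  exists y : forall k, X k, y n = x /\ forall k, (n <= k)%N -> y k.+1 = f k (y k).
Proof.
elim: n X f d x => [|n IH] X f d x.
  exists (fix y k := if k is j.+1 return X k then f j (y j) else x).
  by split.
have [y [yn ys]] := IH (fun k => X k.+1) (fun k => f k.+1) (fun k => d k.+1) x.
exists (fun k => if k is j.+1 return X k then y j else d 0%N); split=> //.
by case=> // k /ys.
Qed.

(** Supplies the junk values of a family of terms before the stage at which it is really defined. *)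
Fixpoint dflt (G : ctx) (t : ty) : term G t :=
  if t is s ~> u then App (Pi u s) (dflt G u) else Zero.

Section Henkin.
Variable T : theory.

(** Completeness and the Henkin property in one predicate, for a formula of an earlier context
    transported by [r]. *)
Definition decided (G H : ctx) (r : ren G H) (L : list (fm H)) (A : fm G) : Prop :=
  (prv T L (ren_fm r A) /\
   match A with
   | Ex s B => exists x : term H s, prv T L (inst (ren_fm (up_ren r) B) x)
   | _ => True
   end)
  \/ prv T L (Imp (ren_fm r A) Bot).

Lemma decided_ren (G H K : ctx) (r : ren G H) (q : ren H K) L L' A :
  List.incl (List.map (ren_fm q) L) L' ->
  decided r L A -> decided (fun t v => q t (r t v)) L' A.
Proof.
move=> i [[p w]|p]; [left|right].
- split; first by rewrite -ren_fm_comp; apply: prv_ren i.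
  case: A p w => //= s B _ [x px]; exists (ren_term q x).
  by have := prv_ren px i; rewrite ren_inst ren_fm_comp up_ren_comp.
- by have := prv_ren p i; rewrite /= ren_fm_comp.
Qed.

Lemma decide_one (G : ctx) (L : list (fm G)) (A : fm G) : consistent T L ->
  exists (H : ctx) (r : ren G H) (L' : list (fm H)),
    [/\ consistent T L', List.incl (List.map (ren_fm r) L) L' & decided r L' A].
Proof.
move=> cL; have [cA|cN] := consistent_or A cL; last first.
  exists G, (fun t v => v), (Imp A Bot :: L); split=> //.
    move=> x /List.in_map_iff [y [<- yL]]; rewrite ren_fm_id; by right.
  by right; rewrite ren_fm_id; apply: prv_hyp; left.
have idcase : (match A with Ex _ _ => False | _ => True end) ->
  exists (H : ctx) (r : ren G H) (L' : list (fm H)),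
    [/\ consistent T L', List.incl (List.map (ren_fm r) L) L' & decided r L' A].
  move=> nE; exists G, (fun t v => v), (A :: L); split=> //.
    move=> x /List.in_map_iff [y [<- yL]]; rewrite ren_fm_id; by right.
  left; split; last by case: A nE {cA}.
  by rewrite ren_fm_id; apply: prv_hyp; left.
case: A cA idcase; try by move=> *; auto.
move=> s B cA _.
exists (s :: G), (@shift G s), (B :: List.map (@weaken G s) (Ex s B :: L)); split.
- by apply: consistent_witness => //; apply: prv_hyp; left.
- by move=> x xL; right; right.
- left; split; first by apply: prv_hyp; right; left.
  exists (Var VZ); rewrite inst_ren; apply: prv_hyp; left.
  rewrite -[LHS]sub_fm_id; congr sub_fm; exact: vconsE.
Qed.

Lemma decide_list (G0 : ctx) (As : list (fm G0)) (G : ctx) (r0 : ren G0 G) (L : list (fm G)) :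
  consistent T L ->
  exists (H : ctx) (r : ren G H) (L' : list (fm H)),
    [/\ consistent T L', List.incl (List.map (ren_fm r) L) L' &
      forall A, List.In A As -> decided (fun t v => r t (r0 t v)) L' A].
Proof.
elim: As G r0 L => [|A As IH] G r0 L cL.
  exists G, (fun t v => v), L; split=> // x /List.in_map_iff [y [<- yL]].
  by rewrite ren_fm_id.
have [H [r [L' [cL' iL dA]]]] := decide_one (ren_fm r0 A) cL.
have [K [q [L'' [cL'' iL' dAs]]]] := IH H (fun t v => r t (r0 t v)) L' cL'.
exists K, (fun t v => q t (r t v)), L''; split=> //.
  move=> x /List.in_map_iff [y [<- yL]]; rewrite -ren_fm_comp.
  by apply: iL'; apply: List.in_map; apply: iL; apply: List.in_map.
move=> B [<-|/dAs //].
have : decided (fun t v => r t (r0 t v)) L' A.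
  case: dA => [[p w]|p]; [left|right]; last by rewrite -ren_fm_comp.
  rewrite -ren_fm_comp; split=> //; case: A p w => //= s B' p [x].
  by rewrite ren_fm_comp up_ren_comp => px; exists x.
exact: decided_ren iL'.
Qed.

Record hstate : Type := HState
  { hctx : ctx; hhyp : list (fm hctx); hcon : consistent T hhyp }.

Definition good_step (k : nat) (s s' : hstate) (r : ren (hctx s) (hctx s')) : Prop :=
  List.incl (List.map (ren_fm r) (hhyp s)) (hhyp s') /\
  forall A, (depth_fm A < k)%N -> decided r (hhyp s') A.

Lemma hstep_ex (k : nat) (s : hstate) :
  exists p : {s' : hstate & ren (hctx s) (hctx s')}, good_step k (projT2 p).
Proof.
have [H [r [L' [cL' iL dA]]]] :=
  decide_list (enum_fm k (hctx s)) (fun t v => v) (@hcon s).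
exists (existT _ (HState cL') r); split=> // A d.
by apply: dA; apply: in_enum_fm.
Qed.

Definition hstep k s := projT1 (cid (hstep_ex k s)).

Variable B0 : sentence.
Hypothesis conB0 : consistent T [B0].

Fixpoint hst (k : nat) : hstate :=
  if k is j.+1 then projT1 (hstep j (hst j)) else HState conB0.

Notation G_ k := (hctx (hst k)).
Notation L_ k := (hhyp (hst k)).

Definition R_ (k : nat) : ren (G_ k) (G_ k.+1) := projT2 (hstep k (hst k)).

Lemma R_good k : good_step k (@R_ k).
Proof. by rewrite /R_ /= /hstep; case: cid. Qed.

Lemma prv_step k A : prv T (L_ k) A -> prv T (L_ k.+1) (ren_fm (@R_ k) A).
Proof. by move=> p; apply: (prv_ren p); case: (R_good k). Qed.

(* The union of the growing chain of contexts [G_ k] is represented without casts: its terms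
   are families, one in each context, that eventually commute with the renamings [R_ k]. *)
Definition coherent (t : ty) (x : forall k, term (G_ k) t) : Prop :=
  eventually (fun k => x k.+1 = ren_term (@R_ k) (x k)).
Definition fam (t : ty) : Type := {x : forall k, term (G_ k) t | coherent x}.
Definition fval t (x : fam t) : forall k, term (G_ k) t := proj1_sig x.

Definition coherent_fm (A : forall k, fm (G_ k)) : Prop :=
  eventually (fun k => A k.+1 = ren_fm (@R_ k) (A k)).

Definition Th (A : forall k, fm (G_ k)) : Prop := eventually (fun k => prv T (L_ k) (A k)).

Lemma fam_eq t (x y : fam t) : (forall k, fval x k = fval y k) -> x = y.
Proof.
by case: x y => x p [y q] e; apply: eq_exist; apply: functional_extensionality_dep.
Qed.

(** From the stage of coherence on, the depth of [A k] is constant, so the growing depth bound of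
    the stages overtakes it. *)
Lemma Th_decided A : coherent_fm A -> eventually (fun k => decided (@R_ k) (L_ k.+1) (A k)).
Proof.
move=> [n c]; exists (maxn n (depth_fm (A n)).+1) => k; rewrite geq_max => /andP [nk dk].
case: (R_good k) => _; apply.
suff -> : depth_fm (A k) = depth_fm (A n) by [].
elim: k nk {dk} => [|k IH]; first by rewrite leqn0 => /eqP ->.
rewrite leq_eqVlt => /orP [/eqP -> //|nk].
by rewrite c // depth_ren_fm IH.
Qed.

Lemma Th_frequently A : coherent_fm A ->
  (forall n, exists2 k, (n <= k)%N & prv T (L_ k) (A k)) -> Th A.
Proof.
move=> [n c] /(_ n) [k nk p]; exists k => j.
elim: j => [|j IH]; first by rewrite leqn0 => /eqP <-.
rewrite leq_eqVlt => /orP [/eqP <- //|kj].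
by rewrite c; [apply: prv_step; apply: IH|apply: leq_trans nk _].
Qed.

(** By [Th_frequently] a single late proof would propagate to all later stages. If [A] is not
    eventually proved, the stages that decide it can therefore only refute it. *)
Lemma Th_em A : coherent_fm A -> Th A \/ Th (fun k => Imp (A k) Bot).
Proof.
move=> cA; have [?|nT] := EM (Th A); first by left.
right; have [n d] := Th_decided cA; have [m c] := cA.
exists (maxn n m).+1 => -[//|k]; rewrite ltnS geq_max => /andP [nk mk].
rewrite c //; case: (d k nk) => // -[p _].
case: nT; apply: Th_frequently => // j.
exists (maxn j k.+1); first exact: leq_maxl.
have: (k < maxn j k.+1)%N by rewrite leq_max leqnn orbT.
elim: (maxn j k.+1) => // i IH.
rewrite ltnS leq_eqVlt => /orP [/eqP <-|ki]; first by rewrite c.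
by rewrite c; [apply: prv_step; apply: IH|apply: leq_trans mk (ltnW ki)].
Qed.

Lemma Th_bot : ~ Th (fun=> Bot).
Proof. by move=> [n /(_ n (leqnn n))]; apply: hcon. Qed.

(** A witness found at one stage, renamed along all later stages, is a coherent family. *)
Lemma Th_ex s (B : forall k, fm (s :: G_ k)) :
  eventually (fun k => B k.+1 = ren_fm (up_ren (@R_ k)) (B k)) ->
  Th (fun k => Ex s (B k)) -> exists x : fam s, Th (fun k => inst (B k) (fval x k)).
Proof.
move=> cB p.
have cE : coherent_fm (fun k => Ex s (B k)) by apply: ev_mono cB => k /= ->.
have [n h] := ev_and (ev_and cB p) (Th_decided cE).
have [[c pn] d] := h n (leqnn n).
have [[_ pn1] _] := h n.+1 (leqnSn n).
case: d => [[_ [x px]]|d]; last first.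
  case: (@hcon (hst n.+1)); apply: prv_impE d _.
  exact: prv_step.
have [y [yn ys]] := @extend_seq (fun k => term (G_ k) s) (fun k => @ren_term _ _ (@R_ k) s)
  (fun k => dflt _ s) n.+1 x.
have cy : coherent y by exists n.+1.
exists (exist _ y cy); exists n.+1 => k /=.
elim: k => // k IH; rewrite leq_eqVlt => /orP [/eqP [<-]|].
  by rewrite /= yn c.
rewrite ltnS => nk; have [[ck _] _] := h k (ltnW nk).
by rewrite ys // ck -ren_inst; apply: prv_step; apply: IH.
Qed.

Definition famsub (G : ctx) : Type := forall t, var G t -> fam t.
Definition famsub_at (G : ctx) (f : famsub G) k : sub G (G_ k) := fun t v => fval (f t v) k.
Definition fcons (G : ctx) s (x : fam s) (f : famsub G) : famsub (s :: G) :=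
  vcons (P := fam) x f.

Lemma famsub_at_cons (G : ctx) s (x : fam s) (f : famsub G) k :
  famsub_at (fcons x f) k = vcons (fval x k) (famsub_at f k).
Proof. exact: vconsE. Qed.

Lemma famsub_coherent (G : ctx) (f : famsub G) :
  eventually (fun k => famsub_at f k.+1 = fun t v => ren_term (@R_ k) (famsub_at f k v)).
Proof.
elim: G f => [|s G IH] f.
  by apply: ev_all => k; apply: var_nilE.
apply: (ev_imp (IH (fun t v => f t (VS v)))).
apply: ev_mono (proj2_sig (f s VZ)) => k e1 e2.
apply: vconsE => [|t v]; first exact: e1.
exact: (congr1 (fun h => h t v) e2).
Qed.

Lemma sub_term_coherent (G : ctx) (f : famsub G) t (x : term G t) :
  coherent (fun k => sub_term (famsub_at f k) x).
Proof. by apply: ev_mono (famsub_coherent f) => k ->; rewrite ren_sub_term. Qed.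

Definition fterm (G : ctx) (f : famsub G) t (x : term G t) : fam t :=
  exist _ _ (sub_term_coherent f x).

Definition tsub (G : ctx) (f : famsub G) (A : fm G) : Prop :=
  Th (fun k => sub_fm (famsub_at f k) A).

Lemma tsub_coherent (G : ctx) (f : famsub G) (A : fm G) :
  coherent_fm (fun k => sub_fm (famsub_at f k) A).
Proof. by apply: ev_mono (famsub_coherent f) => k ->; rewrite ren_sub_fm. Qed.

Lemma tsub_imp (G : ctx) (f : famsub G) (A B : fm G) :
  tsub f (Imp A B) <-> (tsub f A -> tsub f B).
Proof.
split=> [pI pA|h].
  by apply: (ev_imp pA); apply: ev_mono pI => k p q; apply: prv_impE p q.
have [pA|pN] := Th_em (tsub_coherent f A).
  apply: ev_mono (h pA) => k pB; apply: prv_impI; apply: prv_weak pB => x; by right.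
apply: ev_mono pN => k {}pN /=; apply: prv_impI; apply: prv_botE.
apply: (prv_impE (A := sub_fm (famsub_at f k) A)); last by apply: prv_hyp; left.
by apply: prv_weak pN => x; right.
Qed.

Lemma tsub_bot (G : ctx) (f : famsub G) : ~ tsub f Bot.
Proof. exact: Th_bot. Qed.

Lemma tsub_and (G : ctx) (f : famsub G) (A B : fm G) :
  tsub f (And A B) <-> (tsub f A /\ tsub f B).
Proof.
split=> [p|[pA pB]].
  by split; apply: ev_mono p => k /= {}p; [apply: prv_andE1 p|apply: prv_andE2 p].
apply: (ev_imp pA); apply: ev_mono pB => k p q; exact: prv_andI.
Qed.

Lemma tsub_or (G : ctx) (f : famsub G) (A B : fm G) :
  tsub f (Or A B) <-> (tsub f A \/ tsub f B).
Proof.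
split=> [p|[] p]; last 2 first.
- by apply: ev_mono p => k /= {}p; apply: prv_orI1.
- by apply: ev_mono p => k /= {}p; apply: prv_orI2.
have [?|pN] := Th_em (tsub_coherent f A); first by left.
right; apply: (ev_imp p); apply: ev_mono pN => k {}pN pO.
apply: (prv_orE pO); last by apply: prv_hyp; left.
apply: prv_botE; apply: (prv_impE (A := sub_fm (famsub_at f k) A)).
  by apply: prv_weak pN => x; right.
by apply: prv_hyp; left.
Qed.

Lemma inst_famsub (G : ctx) (f : famsub G) s (x : fam s) (A : fm (s :: G)) k :
  inst (sub_fm (up_sub (famsub_at f k)) A) (fval x k) = sub_fm (famsub_at (fcons x f) k) A.
Proof. by rewrite inst_sub famsub_at_cons. Qed.

Lemma tsub_ex (G : ctx) (f : famsub G) s (A : fm (s :: G)) :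
  tsub f (Ex s A) <-> exists x : fam s, tsub (fcons x f) A.
Proof.
split=> [p|[x p]].
  have [|x px] := Th_ex _ p.
    apply: ev_mono (famsub_coherent f) => k ->.
    by rewrite ren_sub_fm ren_up_sub.
  by exists x; apply: ev_mono px => k; rewrite inst_famsub.
by apply: ev_mono p => k; rewrite -inst_famsub; apply: prv_exI.
Qed.

Lemma tsub_all (G : ctx) (f : famsub G) s (A : fm (s :: G)) :
  tsub f (All s A) <-> forall x : fam s, tsub (fcons x f) A.
Proof.
split=> [p x|h].
  by apply: ev_mono p => k {}p; rewrite -inst_famsub; apply: prv_allE.
have [//|pN] := Th_em (tsub_coherent f (All s A)).
(* A refuted universal formula proves the existence of a counterexample; its Henkin witness
   contradicts [h]. *)
suff /tsub_ex [x /tsub_imp px] : tsub f (Ex s (Imp A Bot)).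
  by case: (tsub_bot (px (h x))).
apply: ev_mono pN => k /= {}pN; set C := sub_fm _ _ in pN *.
apply: prv_botC; apply: (prv_impE (prv_weak _ pN)); first by move=> x; right.
apply: prv_allI; apply: prv_botC.
apply: (prv_impE (A := weaken s (Ex s (Imp C Bot)))).
  by apply: prv_hyp; right; left.
apply: (prv_exI (x := Var VZ)).
rewrite -[inst _ _]/(Imp (inst (ren_fm (up_ren (@shift _ s)) C) (Var VZ)) Bot) inst_ren.
have -> : vcons (P := term (s :: G_ k)) (Var VZ) (fun t v => Var (@shift (G_ k) s t v))
    = fun t v => Var v.
  exact: vconsE.
by rewrite sub_fm_id; apply: prv_hyp; left.
Qed.

Definition fapp s t (x : fam (s ~> t)) (y : fam s) : fam t :=
  fterm (fcons x (fcons y (vnil fam))) (App (Var VZ) (Var (VS VZ))).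

(* Semantically extensional equality; it agrees with [eq_at] by [tsub_eq_at]. *)
Fixpoint feq (t : ty) : fam t -> fam t -> Prop :=
  match t return fam t -> fam t -> Prop with
  | T0 => fun x y => Th (fun k => Eq (fval x k) (fval y k))
  | s ~> u => fun x y => forall z, feq (fapp x z) (fapp y z)
  end.

Lemma tsub_eq_at t : forall (G : ctx) (f : famsub G) (x y : term G t),
  tsub f (eq_at x y) <-> feq (fterm f x) (fterm f y).
Proof.
elim: t => [|s _ u IH] G f x y //.
have e z (w : term G (s ~> u)) :
  fterm (fcons z f) (App (lift w) (lift (Var VZ))) = fapp (fterm f w) z.
  by apply: fam_eq => k; rewrite /= sub_ren_term famsub_at_cons.
rewrite [X in tsub _ X]/= /all_named; split.
  by move=> /tsub_all h z; rewrite -!e; apply/IH.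
by move=> h; apply/tsub_all => z; apply/IH; rewrite !e.
Qed.

Lemma feq_refl t (x : fam t) : feq x x.
Proof.
elim: t x => [|s _ u IH] x /=; last by move=> z; apply: IH.
by apply: ev_all => k; apply: prv_refl.
Qed.

Lemma prv_eq_sym (G : ctx) (L : list (fm G)) (x y : term G T0) :
  prv T L (Eq x y) -> prv T L (Eq y x).
Proof.
move=> p.
have := @prv_leibniz T G L x y (Eq (Var VZ) (ren_term (@shift G T0) x)) p.
rewrite /inst /= !sub_ren_term !sub_term_id; apply; exact: prv_refl.
Qed.

Lemma prv_eq_trans (G : ctx) (L : list (fm G)) (x y z : term G T0) :
  prv T L (Eq x y) -> prv T L (Eq y z) -> prv T L (Eq x z).
Proof.
move=> p q.
have := @prv_leibniz T G L y z (Eq (ren_term (@shift G T0) x) (Var VZ)) q.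
by rewrite /inst /= !sub_ren_term !sub_term_id; apply.
Qed.

Lemma prv_lt_congr (G : ctx) (L : list (fm G)) (x x' y y' : term G T0) :
  prv T L (Eq x x') -> prv T L (Eq y y') -> prv T L (Lt x y) -> prv T L (Lt x' y').
Proof.
move=> p q h.
have := @prv_leibniz T G L x x' (Lt (Var VZ) (ren_term (@shift G T0) y)) p.
rewrite /inst /= !sub_ren_term !sub_term_id => /(_ h) h'.
have := @prv_leibniz T G L y y' (Lt (ren_term (@shift G T0) x') (Var VZ)) q.
by rewrite /inst /= !sub_ren_term !sub_term_id; apply.
Qed.

Lemma feq_sym t (x y : fam t) : feq x y -> feq y x.
Proof.
elim: t x y => [|s _ u IH] x y /=; last by move=> h z; apply: IH.
by apply: ev_mono => k; apply: prv_eq_sym.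
Qed.

Lemma feq_trans t (x y z : fam t) : feq x y -> feq y z -> feq x z.
Proof.
elim: t x y z => [|s _ u IH] x y z /=; last first.
  by move=> h h' w; apply: IH (h w) (h' w).
move=> p q; apply: (ev_imp p); apply: ev_mono q => k {}q {}p.
exact: prv_eq_trans p q.
Qed.

Hypothesis T_ext : forall r t, T (∀ x : r, ∀ y : r, ∀ f : r ~> t,
             #x =[r] #y ⇒ #f · #x =[t] #f · #y)%fm.

Lemma tsub_ax (A : sentence) : T A -> tsub (vnil fam) A.
Proof.
move=> TA; apply: ev_all => k.
rewrite (var_nilE (famsub_at (vnil fam) k) (fun t v => Var (vnil (var (G_ k)) v))).
by rewrite sub_fm_ren; apply: prv_ax.
Qed.

(** Here the extensionality axiom enters: it makes application well defined on classes modulo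
    [feq]. *)
Lemma feq_congr s t (f g : fam (s ~> t)) (x y : fam s) :
  feq f g -> feq x y -> feq (fapp f x) (fapp g y).
Proof.
move=> fg xy; apply: feq_trans (fg y).
move/tsub_ax: (T_ext s t).
move=> /tsub_all /(_ x) /tsub_all /(_ y) /tsub_all /(_ f) /tsub_imp.
rewrite !tsub_eq_at.
pose e := fcons f (fcons y (fcons x (vnil fam))); rewrite -/e => h.
have ex : fterm e (lift (Var (VS (VS VZ)))) = x by apply: fam_eq.
have ey : fterm e (lift (Var (VS VZ))) = y by apply: fam_eq.
have ef z w : fterm e z = f -> fterm e w = x -> fterm e (App z w) = fapp f x.
  by move=> <- <-; apply: fam_eq.
have ef' z w : fterm e z = f -> fterm e w = y -> fterm e (App z w) = fapp f y.
  by move=> <- <-; apply: fam_eq.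
have := h _.
rewrite ex ey (ef _ _ _ ex) ?(ef' _ _ _ ey); try exact: fam_eq.
exact.
Qed.

Definition hdom (t : ty) : Type := quo (@feq t).
Definition hcls t (x : fam t) : hdom t := cls (@feq t) x.
Definition hrepr t (x : hdom t) : fam t := crepr x.

Lemma hcls_eq t (x y : fam t) : hcls x = hcls y <-> feq x y.
Proof. exact: (cls_eq (@feq_refl t) (@feq_sym t) (@feq_trans t)). Qed.

Lemma hreprK t (x : hdom t) : hcls (hrepr x) = x.
Proof. exact: creprK. Qed.

Lemma feq_hrepr t (x : fam t) : feq (hrepr (hcls x)) x.
Proof. exact: (crepr_cls (@feq_refl t) (@feq_sym t) (@feq_trans t)). Qed.

Definition hap s t (f : hdom (s ~> t)) (x : hdom s) : hdom t :=
  hcls (fapp (hrepr f) (hrepr x)).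
Definition hlt (x y : hdom T0) : Prop :=
  Th (fun k => Lt (fval (hrepr x) k) (fval (hrepr y) k)).
Definition hconst t (c : term [] t) : hdom t := hcls (fterm (vnil fam) c).

Lemma hapE s t (f : fam (s ~> t)) (x : fam s) : hap (hcls f) (hcls x) = hcls (fapp f x).
Proof. by apply/hcls_eq; apply: feq_congr; apply: feq_hrepr. Qed.

Lemma hltE (x y : fam T0) : hlt (hcls x) (hcls y) <-> Th (fun k => Lt (fval x k) (fval y k)).
Proof.
have main (x' y' z w : fam T0) : feq x' z -> feq y' w ->
    Th (fun k => Lt (fval x' k) (fval y' k)) -> Th (fun k => Lt (fval z k) (fval w k)).
  move=> p q h; apply: (ev_imp (ev_and (ev_and p q) h)); apply: ev_all => k [[{}p {}q]].
  exact: prv_lt_congr.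
by split; apply: main; first [exact: feq_hrepr|apply: feq_sym; exact: feq_hrepr].
Qed.

Lemma hext s t (f g : hdom (s ~> t)) : (forall x, hap f x = hap g x) -> f = g.
Proof.
rewrite -(hreprK f) -(hreprK g) => h; apply/hcls_eq => z.
by apply/hcls_eq; rewrite -!hapE; apply: h.
Qed.

Definition henkin_model : model :=
  Model (hconst Zero) (hconst One) (hconst Plus) (hconst Times)
    (fun r s => hconst (Pi r s)) (fun r s t => hconst (Sigma r s t)) (hconst Rec0) hlt hext.

Definition fenv (G : ctx) (f : famsub G) : menv henkin_model G := fun t v => hcls (f t v).

Lemma eval_henkin (G : ctx) (f : famsub G) t (x : term G t) :
  eval (fenv f) x = hcls (fterm f x).
Proof.
elim: x => {t} /=; try by move=> *; congr hcls; apply: fam_eq.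
move=> s t x Ix y Iy; rewrite Ix Iy hapE; congr hcls; exact: fam_eq.
Qed.

Lemma fenv_cons (G : ctx) s (x : fam s) (f : famsub G) :
  mcons (M := henkin_model) (hcls x) (fenv f) = fenv (fcons x f).
Proof. exact: (@vconsE hdom). Qed.

(** The truth lemma of the Henkin construction. *)
Lemma sat_henkin (G : ctx) (A : fm G) : forall f : famsub G, sat (fenv f) A <-> tsub f A.
Proof.
elim: A => {G} /=.
- move=> G x y f; rewrite !eval_henkin; exact: hcls_eq.
- move=> G x y f; rewrite !eval_henkin; exact: hltE.
- by move=> G f; split=> // /tsub_bot.
- by move=> G A IA B IB f; rewrite IA IB -tsub_imp.
- by move=> G A IA B IB f; rewrite IA IB -tsub_and.
- by move=> G A IA B IB f; rewrite IA IB -tsub_or.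
- move=> G s A IA f; split=> [h|/tsub_all h a].
    by apply/tsub_all => x; apply/IA; rewrite -fenv_cons; apply: h.
  by rewrite -(hreprK a) fenv_cons; apply/IA.
- move=> G s A IA f; split=> [[a]|/tsub_ex [x h]].
    by rewrite -(hreprK a) fenv_cons => /IA h; apply/tsub_ex; exists (hrepr a).
  by exists (hcls x); rewrite fenv_cons; apply/IA.
Qed.

Lemma henkin_sat (A : sentence) : sat (mnil henkin_model) A <-> tsub (vnil fam) A.
Proof. by rewrite -sat_henkin (var_nilE (mnil henkin_model) (fenv (vnil fam))). Qed.

Lemma henkin_axioms (A : sentence) : T A -> sat (mnil henkin_model) A.
Proof. by move=> /tsub_ax /henkin_sat. Qed.

Lemma henkin_B0 : sat (mnil henkin_model) B0.
Proof.
apply/henkin_sat; exists 0%N => k _.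
elim: k => [|k IH].
  rewrite (var_nilE (famsub_at (vnil fam) 0) (fun t v => Var v)) sub_fm_id.
  by apply: prv_hyp; left.
have := prv_step IH; rewrite ren_sub_fm.
by rewrite (var_nilE (famsub_at (vnil fam) k.+1)
  (fun t v => ren_term (@R_ k) (famsub_at (vnil fam) k v))).
Qed.

End Henkin.

(** Extensionality of the theory is assumed because equality in a [model] is Leibniz equality at
    every type. *)
Theorem completeness (T : theory) (B : sentence) :
  (forall r t, T (∀ x : r, ∀ y : r, ∀ f : r ~> t,
             #x =[r] #y ⇒ #f · #x =[t] #f · #y)%fm) ->
  (forall M : model, (forall A, T A -> sat (mnil M) A) -> sat (mnil M) B) ->
  T ⊢ B.
Proof.
move=> T_ext h; apply: contrapT => nB.
have cB : consistent T [Imp B Bot] by move=> p; apply: nB; apply: prv_botC.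
apply: (henkin_B0 cB T_ext); apply: h => A; exact: henkin_axioms.
Qed.

(** * The numbers of a model of RCA_0^omega *)

Record rca : Type := Rca
  { rca_model :> model; rca_axioms : forall A, RCA0w A -> sat (mnil rca_model) A }.

Definition num (W : rca) : Type := dom W T0.
Definition nadd (W : rca) (x y : num W) : num W := ap (ap (mplus W) x) y.
Definition nmul (W : rca) (x y : num W) : num W := ap (ap (mtimes W) x) y.

Lemma semiring_sat (W : rca) k : (k < length semiring_axioms)%N ->
  sat (mnil W) (List.nth k semiring_axioms Bot).
Proof.
by move=> kl; apply: rca_axioms; apply: ax_semiring; apply: List.nth_In; exact/ssrnat.ltP.
Qed.

Section Semiring.
Variable W : rca.
Notation N := (num W).
Implicit Types x y z : N.
Local Notation "x +' y" := (nadd x y) (at level 50).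
Local Notation "x *' y" := (nmul x y) (at level 40).

Lemma naddA' x y z : (x +' y) +' z = x +' (y +' z).
Proof. exact: (@semiring_sat W 0%N isT x y z). Qed.
Lemma naddC : commutative (@nadd W).
Proof. move=> x y; exact: (@semiring_sat W 1%N isT x y). Qed.
Lemma naddA : associative (@nadd W).
Proof. by move=> x y z; rewrite naddA'. Qed.
Lemma nadd0 : left_id (m0 W) (@nadd W).
Proof. move=> x; rewrite naddC; exact: (@semiring_sat W 2%N isT x). Qed.
Lemma nmulA : associative (@nmul W).
Proof. by move=> x y z; symmetry; exact: (@semiring_sat W 3%N isT x y z). Qed.
Lemma nmulC : commutative (@nmul W).
Proof. move=> x y; exact: (@semiring_sat W 4%N isT x y). Qed.
Lemma nmul1 : left_id (m1 W) (@nmul W).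
Proof. move=> x; rewrite nmulC; exact: (@semiring_sat W 5%N isT x). Qed.
Lemma nmul0 : left_zero (m0 W) (@nmul W).
Proof. move=> x; rewrite nmulC; exact: (@semiring_sat W 6%N isT x). Qed.
Lemma nmulDl : left_distributive (@nmul W) (@nadd W).
Proof.
move=> x y z; rewrite !(nmulC _ z); exact: (@semiring_sat W 7%N isT z x y).
Qed.
End Semiring.

HB.instance Definition _ (W : rca) := gen_eqMixin (num W).
HB.instance Definition _ (W : rca) := gen_choiceMixin (num W).
HB.instance Definition _ (W : rca) :=
  GRing.isNmodule.Build (num W) (@naddA W) (@naddC W) (@nadd0 W).

Lemma n1_neq0 (W : rca) : m1 W != 0%R :> num W.
Proof.
apply/eqP => e; have := @semiring_sat W 14%N isT; rewrite /= e.
exact: (@semiring_sat W 8%N isT).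
Qed.

HB.instance Definition _ (W : rca) :=
  GRing.Nmodule_isComNzSemiRing.Build (num W)
    (@nmulA W) (@nmulC W) (@nmul1 W) (@nmulDl W) (@nmul0 W) (n1_neq0 W).

Definition nlt (W : rca) (x y : num W) : Prop := mlt x y.
Notation "x <N y" := (nlt x y) (at level 70).
Notation "x <=N y" := (nlt x y \/ x = y) (at level 70).

Section Order.
Variable W : rca.
Notation N := (num W).
Implicit Types x y z : N.
Local Open Scope ring_scope.

Lemma nltxx x : ~ x <N x.
Proof. exact: (@semiring_sat W 8%N isT x). Qed.
Lemma nlt_trans x y z : x <N y -> y <N z -> x <N z.
Proof. by move=> h h'; apply: (@semiring_sat W 9%N isT x y z). Qed.
Lemma nlt_total x y : x <N y \/ x = y \/ y <N x.
Proof. exact: (@semiring_sat W 10%N isT x y). Qed.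
Lemma nlt_add2r z x y : x <N y -> x + z <N y + z.
Proof. exact: (@semiring_sat W 11%N isT x y z). Qed.
Lemma nlt_mul2r z x y : x <N y -> 0 <N z -> x * z <N y * z.
Proof. by move=> h h'; apply: (@semiring_sat W 12%N isT x y z). Qed.
Lemma nle0 x : 0 <=N x.
Proof. exact: (@semiring_sat W 13%N isT x). Qed.
Lemma nlt01 : (0 : N) <N 1.
Proof. exact: (@semiring_sat W 14%N isT). Qed.
Lemma nlt_succ x y : x <N y -> x + 1 <=N y.
Proof. exact: (@semiring_sat W 15%N isT x y). Qed.

Lemma nle_lt_trans x y z : x <=N y -> y <N z -> x <N z.
Proof. by move=> [h|-> //]; apply: nlt_trans. Qed.
Lemma nlt_le_trans x y z : x <N y -> y <=N z -> x <N z.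
Proof. by move=> h [|<- //]; apply: nlt_trans. Qed.
Lemma nle_trans x y z : x <=N y -> y <=N z -> x <=N z.
Proof. by move=> [h|-> //] h'; left; apply: nlt_le_trans h'. Qed.
Lemma nltS x : x <N x + 1.
Proof. by have := nlt_add2r x nlt01; rewrite add0r addrC. Qed.
Lemma nleSS x y : x <N y + 1 <-> x <=N y.
Proof.
split=> [h|h]; last by apply: nle_lt_trans (nltS y).
have [|[|/nlt_succ h']] := nlt_total x y; [by left|by right|].
by case: (@nltxx x); apply: nlt_le_trans h h'.
Qed.
Lemma nlt_neg x y : ~ x <N y <-> y <=N x.
Proof.
split=> [h|h h']; last by case: (@nltxx x); apply: nlt_le_trans h' h.
by have [//|[->|]] := nlt_total x y; [right|left].
Qed.
Lemma nlt_neq x y : x <N y -> x <> y.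
Proof. by move=> h e; move: h; rewrite e; apply: nltxx. Qed.

Lemma naddI x y z : x + z = y + z -> x = y.
Proof.
by move=> e; have [|[//|]] := nlt_total x y => /(nlt_add2r z); rewrite e => /nltxx.
Qed.
Lemma nlt_add2 x y z : x + z <N y + z <-> x <N y.
Proof.
split; last exact: nlt_add2r.
have [//|[->/nltxx //|/(nlt_add2r z) h h']] := nlt_total x y.
by case: (@nltxx (x + z)); apply: nlt_trans h' h.
Qed.
Lemma nmulI x y z : 0 <N z -> x * z = y * z -> x = y.
Proof.
by move=> z0 e; have [|[//|]] := nlt_total x y => /nlt_mul2r /(_ z0); rewrite e => /nltxx.
Qed.
Lemma nltS0 x : 0 <N x + 1.
Proof. by apply/nleSS; apply: nle0. Qed.
Lemma nltDr x y : 0 <N y -> x <N x + y.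
Proof. by move=> h; have := nlt_add2r x h; rewrite add0r addrC. Qed.
Lemma nleDr x y : x <=N x + y.
Proof. by have [/nltDr|<-] := nle0 y; [left|right; rewrite addr0]. Qed.
Lemma nle_add2r z x y : x <=N y -> x + z <=N y + z.
Proof. by move=> [/(nlt_add2r z)|->]; [left|right]. Qed.

(* In a semiring, a linear combination of equations has to be added on both sides and then
   cancelled. *)
Lemma lincomb (a b x y : N) : a + x = b + y -> x = y -> a = b.
Proof. by move=> e f; move: e; rewrite f => /naddI. Qed.

End Order.

(** * Definable functions and decidable predicates *)

(** Environments as nested pairs: a function of the environment is then written with projections,
    which the tactic [rep_step] recognizes by their shape. *)
Fixpoint tup (M : model) (G : ctx) : Type :=
  if G is s :: H then (dom M s * tup M H)%type else unit.

Inductive tm (M : model) (G : ctx) : ty -> Type :=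
| TV t : var G t -> tm M G t
| TC t : dom M t -> tm M G t
| TA s t : tm M G (s ~> t) -> tm M G s -> tm M G t.

Fixpoint tlook (M : model) (G : ctx) (t : ty) (v : var G t) : tup M G -> dom M t :=
  match v in var L u return tup M L -> dom M u with
  | VZ _ _ => fun e => e.1
  | VS _ _ _ w => fun e => tlook w e.2
  end.

Fixpoint tev (M : model) (G : ctx) (t : ty) (x : tm M G t) (e : tup M G) : dom M t :=
  match x with
  | TV _ v => tlook v e
  | TC _ m => m
  | TA _ _ f a => ap (tev f e) (tev a e)
  end.

Section Lambda.
Variable M : rca.

Definition tmI (G : ctx) (s : ty) : tm M G (s ~> s) :=
  TA (TA (TC G (msigma M s (s ~> s) s)) (TC G (mpi M s (s ~> s)))) (TC G (mpi M s s)).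

Definition tmK (G : ctx) (s t : ty) (x : tm M G t) : tm M G (s ~> t) :=
  TA (TC G (mpi M t s)) x.

(** Bracket abstraction: [Pi] and [Sigma] are the combinators K and S. *)
Fixpoint lam (G : ctx) (s t : ty) (x : tm M (s :: G) t) : tm M G (s ~> t) :=
  match x in tm _ _ t return tm M G (s ~> t) with
  | TV _ v => vcons (P := fun t => tm M G (s ~> t)) (tmI G s) (fun u w => tmK s (TV M w)) v
  | TC _ m => tmK s (TC G m)
  | TA u t f a => TA (TA (TC G (msigma M s u t)) (lam f)) (lam a)
  end.

End Lambda.

Lemma eval_ren (M : model) (G H : ctx) (r : ren G H) (e : menv M H) t (x : term G t) :
  eval e (ren_term r x) = eval (fun t v => e t (r t v)) x.
Proof. by elim: x => //= s u f -> a ->. Qed.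

Lemma eval_lift1 (M : model) (G : ctx) s (a : dom M s) (e : menv M G) t (x : term G t) :
  eval (mcons a e) (lift x) = eval e x.
Proof. exact: eval_ren. Qed.

Lemma sat_eq_at (M : model) t : forall (G : ctx) (e : menv M G) (x y : term G t),
  sat e (eq_at x y) <-> eval e x = eval e y.
Proof.
elim: t => [|s _ u IH] G e x y //.
rewrite [X in sat _ X]/= /all_named [sat _ _]/=; split=> [h|h a].
  apply: m_ext => a; move/IH: (h a).
  by rewrite [eval _ (App _ _)]/= [in RHS]/= !eval_lift1.
by apply/IH; rewrite [LHS]/= [RHS]/= !eval_lift1 h.
Qed.

Section Lambda.
Variable M : rca.

Lemma piE r s (x : dom M r) (y : dom M s) : ap (ap (mpi M r s) x) y = x.
Proof. by have /(_ x y) /sat_eq_at := rca_axioms M (ax_Pi r s). Qed.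

Lemma sigmaE r s t (x : dom M (r ~> s ~> t)) (y : dom M (r ~> s)) (z : dom M r) :
  ap (ap (ap (msigma M r s t) x) y) z = ap (ap x z) (ap y z).
Proof. by have /(_ x y z) /sat_eq_at := rca_axioms M (ax_Sigma r s t). Qed.

Lemma lamE (G : ctx) s t (x : tm M (s :: G) t) (e : tup M G) (a : dom M s) :
  ap (tev (lam x) e) a = tev x (a, e).
Proof.
elim: x => {t} [t v|t m|u t f If b Ib] /=.
- move: t v; apply: var_case => [|t v] /=; last by rewrite piE.
  by rewrite sigmaE !piE.
- by rewrite piE.
- by rewrite sigmaE If Ib.
Qed.

Definition rep (G : ctx) (t : ty) (f : tup M G -> dom M t) : Prop :=
  exists x : tm M G t, forall e, tev x e = f e.

Lemma rep_ext (G : ctx) t (f g : tup M G -> dom M t) : f =1 g -> rep f -> rep g.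
Proof. by move=> fg [x xE]; exists x => e; rewrite xE. Qed.

Lemma rep_const (G : ctx) t (m : dom M t) : rep (G := G) (fun=> m).
Proof. by exists (TC G m). Qed.

Lemma rep_app (G : ctx) s t (f : tup M G -> dom M (s ~> t)) g :
  rep f -> rep g -> rep (fun e => ap (f e) (g e)).
Proof. by move=> [x xE] [y yE]; exists (TA x y) => e /=; rewrite xE yE. Qed.

Lemma rep_v0 (G : ctx) s : rep (G := s :: G) (t := s) (fun e => e.1).
Proof. by exists (TV M VZ). Qed.
Lemma rep_v1 (G : ctx) s u : rep (G := u :: s :: G) (t := s) (fun e => e.2.1).
Proof. by exists (TV M (VS VZ)). Qed.
Lemma rep_v2 (G : ctx) s u v : rep (G := v :: u :: s :: G) (t := s) (fun e => e.2.2.1).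
Proof. by exists (TV M (VS (VS VZ))). Qed.
Lemma rep_v3 (G : ctx) s u v w :
  rep (G := w :: v :: u :: s :: G) (t := s) (fun e => e.2.2.2.1).
Proof. by exists (TV M (VS (VS (VS VZ)))). Qed.
Lemma rep_v4 (G : ctx) s u v w x :
  rep (G := x :: w :: v :: u :: s :: G) (t := s) (fun e => e.2.2.2.2.1).
Proof. by exists (TV M (VS (VS (VS (VS VZ))))). Qed.
Lemma rep_v5 (G : ctx) s u v w x y :
  rep (G := y :: x :: w :: v :: u :: s :: G) (t := s) (fun e => e.2.2.2.2.2.1).
Proof. by exists (TV M (VS (VS (VS (VS (VS VZ)))))). Qed.

(** Combinatory completeness. The new functional is again represented in the remaining environment,
    so abstractions can be iterated. *)
Lemma rep_lam (G : ctx) s t (f : tup M (s :: G) -> dom M t) : rep f ->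
  exists F : tup M G -> dom M (s ~> t), rep F /\ forall e a, ap (F e) a = f (a, e).
Proof.
move=> [x xE]; exists (tev (lam x)); split; first by exists (lam x).
by move=> e a; rewrite lamE xE.
Qed.

Lemma rep_fun1 a t (f : dom M a -> dom M t) :
  rep (G := [:: a]) (fun e => f e.1) -> exists F, forall x, ap F x = f x.
Proof. by move=> /rep_lam [F [_ FE]]; exists (F tt) => x; rewrite FE. Qed.

Lemma rep_fun2 a b t (f : dom M a -> dom M b -> dom M t) :
  rep (G := [:: b; a]) (fun e => f e.2.1 e.1) -> exists F, forall x y, ap (ap F x) y = f x y.
Proof.
move=> /rep_lam [F [rF FE]]; have [|H HE] := rep_fun1 (f := fun x => F (x, tt)).
  by apply: rep_ext rF => -[x []].
by exists H => x y; rewrite HE FE.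
Qed.

Lemma rep_fun3 a b c t (f : dom M a -> dom M b -> dom M c -> dom M t) :
  rep (G := [:: c; b; a]) (fun e => f e.2.2.1 e.2.1 e.1) ->
  exists F, forall x y z, ap (ap (ap F x) y) z = f x y z.
Proof.
move=> /rep_lam [F [rF FE]].
have [|H HE] := rep_fun2 (f := fun x y => F (y, (x, tt))).
  by apply: rep_ext rF => -[y [x []]].
by exists H => x y z; rewrite HE FE.
Qed.

Lemma rep_add (G : ctx) (f g : tup M G -> num M) :
  rep f -> rep g -> rep (t := T0) (fun e => f e + g e)%R.
Proof. by move=> rf rg; apply: rep_app rg; apply: rep_app rf; apply: rep_const. Qed.
Lemma rep_mul (G : ctx) (f g : tup M G -> num M) :
  rep f -> rep g -> rep (t := T0) (fun e => f e * g e)%R.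
Proof. by move=> rf rg; apply: rep_app rg; apply: rep_app rf; apply: rep_const. Qed.

End Lambda.

Section Arithmetic.
Variable W : rca.
Notation N := (num W).
Implicit Types x y z : N.
Local Open Scope ring_scope.

Definition iter (f : dom W T1) (m n : N) : N := ap (ap (ap (mrec W) f) m) n.

Lemma iter0 f m : iter f m 0 = m.
Proof. exact: (rca_axioms W ax_Rec0_zero f m). Qed.
Lemma iterS f m n : iter f m (n + 1) = ap f (iter f m n).
Proof. exact: (rca_axioms W ax_Rec0_succ f m n). Qed.

(* Characteristic functions of equality and order from quantifier-free choice, the two
   arguments being the values [f 0] and [f 1] of one function argument. *)
Lemma pair_fun : exists P : dom W (T0 ~> T0 ~> T1), forall x y,
  ap (ap (ap P x) y) (0 : N) = x /\ ap (ap (ap P x) y) (1 : N) = y.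
Proof.
(* Recursion from [x] with the constant step function [y] has value [x] at 0 and [y] at 1. *)
pose K := mpi W T0 T0.
have : rep (G := [:: T0; T0; T0]) (t := T0)
   (fun e => ap (ap (ap (mrec W) (ap K e.2.1)) e.2.2.1) e.1).
  by repeat first [exact: rep_const | exact: rep_v0 | exact: rep_v1 | exact: rep_v2
                  | apply: rep_app].
move=> /rep_lam [F [/rep_lam [H [/rep_lam [P [_ PE]] HE]] FE]].
exists (P tt) => x y; rewrite PE HE !FE /=; split; first exact: iter0.
have e := iterS (ap K y) x 0; rewrite add0r in e.
by rewrite -[LHS]/(iter (ap K y) x 1) e; apply: piE.
Qed.

(* In a model, only predicates whose indicator is represented by a functional of the model can
   be used in induction; these are the predicates satisfying [dec] below. *)
Definition ind (P : Prop) : N := if pselect P then 1 else 0.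

Definition cond (P : Prop) (x y : N) : N := if pselect P then x else y.

Lemma condT (P : Prop) x y : P -> cond P x y = x.
Proof. by rewrite /cond; case: pselect. Qed.
Lemma condF (P : Prop) x y : ~ P -> cond P x y = y.
Proof. by rewrite /cond; case: pselect. Qed.

Lemma ind1 P : P -> ind P = 1.
Proof. by rewrite /ind; case: pselect. Qed.
Lemma ind0 P : ~ P -> ind P = 0.
Proof. by rewrite /ind; case: pselect. Qed.
Lemma indP P : ind P = 1 <-> P.
Proof.
by rewrite /ind; case: pselect => // nP; split=> // /esym /eqP; rewrite oner_eq0.
Qed.
Lemma ind_iff P Q : (P <-> Q) -> ind P = ind Q.
Proof. by move=> h; rewrite (propext h). Qed.

Lemma lt_char : exists E : dom W (T0 ~> T0 ~> T0), forall x y : N,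
  ap (ap E x) y = ind (x <N y).
Proof.
have [P PE] := pair_fun.
pose v : term [:: T0; T1] T0 := Var VZ.
pose c := Lt (App (Var (VS VZ)) (Zero : term [:: T0; T1] T0)) (App (Var (VS VZ)) One).
(* [A] says that [v] is the truth value of f(0) < f(1); a choice functional for it decides the
   order. *)
pose A := Or (And c (Eq v One)) (And (Imp c Bot) (Eq v Zero)).
have qA : qf A by [].
have [|Y YE] := rca_axioms W (@ax_QFAC10 [::] A qA).
  move=> f; have [e|n] := EM (mlt (ap f (0 : N)) (ap f (1 : N))).
    by exists (1 : N); left.
  by exists (0 : N); right.
have [|E EE] := @rep_fun2 W T0 T0 T0 (fun x y => ap Y (ap (ap P x) y)).
  by repeat first [exact: rep_const | exact: rep_v0 | exact: rep_v1 | apply: rep_app].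
exists E => x y; rewrite EE; have := YE (ap (ap P x) y).
have [e0 e1] : ap (ap (ap P x) y) (m0 W) = x /\ ap (ap (ap P x) y) (m1 W) = y := PE x y.
rewrite /= e0 e1.
by case=> -[h ->]; symmetry; [apply: ind1|apply: ind0 => /h].
Qed.

Lemma numeral_induction (F : dom W T1) :
  ap F (0 : N) = 1 :> N -> (forall n : N, ap F n = 1 :> N -> ap F (n + 1) = 1 :> N) ->
  forall n : N, ap F n = 1 :> N.
Proof.
pose A := Eq (App (Var (VS VZ)) (Var VZ)) (One : term [:: T0; T1] T0).
have qA : qf A by [].
move=> F0 FS; exact: (rca_axioms W (@ax_ind [:: T1] A qA) F (conj F0 FS)).
Qed.

Definition ltc : dom W (T0 ~> T0 ~> T0) := projT1 (cid lt_char).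

Lemma ltcE x y : ap (ap ltc x) y = ind (x <N y).
Proof. exact: (projT2 (cid lt_char)). Qed.

Definition dec (G : ctx) (P : tup W G -> Prop) : Prop := rep (t := T0) (fun e => ind (P e)).

Section Dec.
Variable G : ctx.
Implicit Types (P Q : tup W G -> Prop) (f g : tup W G -> N).

Lemma dec_lt f g : rep (t := T0) f -> rep (t := T0) g -> dec (fun e => f e <N g e).
Proof.
move=> rf rg; apply: (rep_ext (f := fun e => ap (ap ltc (f e)) (g e))).
  by move=> e; apply: ltcE.
by apply: rep_app rg; apply: rep_app rf; apply: rep_const.
Qed.

Lemma dec_iff P Q : (forall e, P e <-> Q e) -> dec P -> dec Q.
Proof. by move=> PQ; apply: rep_ext => e; apply: ind_iff. Qed.

Lemma ind_lt1 (p : Prop) : ind p <N 1 <-> ~ p.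
Proof.
rewrite /ind; case: pselect => h; split=> //; first by move=> /nltxx.
by move=> _; apply: nlt01.
Qed.

Lemma rep_1 : rep (t := T0) (fun _ : tup W G => 1 : N).
Proof. exact: rep_const. Qed.

Lemma dec_not P : dec P -> dec (fun e => ~ P e).
Proof.
by move=> dP; apply: dec_iff (dec_lt dP rep_1) => e; apply: ind_lt1.
Qed.

Lemma dec_and P Q : dec P -> dec Q -> dec (fun e => P e /\ Q e).
Proof.
move=> dP dQ; apply: rep_ext (rep_mul dP dQ) => e.
have [p|p] := EM (P e); have [q|q] := EM (Q e).
- by rewrite !ind1 ?mulr1.
- by rewrite (ind0 q) mulr0 ind0 // => -[].
- by rewrite (ind0 p) mul0r ind0 // => -[].
- by rewrite (ind0 p) mul0r ind0 // => -[].
Qed.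

Lemma dec_imp P Q : dec P -> dec Q -> dec (fun e => P e -> Q e).
Proof.
move=> dP dQ; apply: dec_iff (dec_not (dec_and dP (dec_not dQ))) => e.
by split=> [h p|h [p]]; [apply: contrapT => q; apply: h|apply; apply: h].
Qed.

Lemma dec_or P Q : dec P -> dec Q -> dec (fun e => P e \/ Q e).
Proof.
move=> dP dQ; apply: dec_iff (dec_imp (dec_not dP) dQ) => e.
by split=> [h|[p|q] h //]; have [p|p] := EM (P e); [left|right; apply: h].
Qed.

Lemma dec_eq f g : rep (t := T0) f -> rep (t := T0) g -> dec (fun e => f e = g e).
Proof.
move=> rf rg; apply: dec_iff (dec_and (dec_not (dec_lt rf rg)) (dec_not (dec_lt rg rf))) => e.
split=> [[h h']|->]; last by split; apply: nltxx.
by have [|[]] := nlt_total (f e) (g e).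
Qed.

Lemma dec_True : dec (fun _ : tup W G => True).
Proof. by apply: rep_ext rep_1 => e; rewrite ind1. Qed.

Lemma rep_if P f g : dec P -> rep (t := T0) f -> rep (t := T0) g ->
  rep (t := T0) (fun e => cond (P e) (f e) (g e)).
Proof.
move=> dP rf rg.
apply: rep_ext (rep_add (rep_mul dP rf) (rep_mul (dec_not dP) rg)) => e.
by rewrite /ind /cond; do 2 case: pselect => // ?; rewrite mul1r mul0r ?addr0 ?add0r.
Qed.
End Dec.

(** Quantifier-free induction for the equation [ap F n = 1], with the indicator functional [F] of
    [P] as a parameter. *)
Lemma n_ind (P : N -> Prop) : dec (G := [:: T0]) (fun e => P e.1) ->
  P 0 -> (forall n, P n -> P (n + 1)) -> forall n, P n.
Proof.
move=> /(rep_fun1 (f := fun x => ind (P x) : dom W T0)) [F FE] P0 PS n.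
apply/indP; rewrite -[LHS]FE; apply: numeral_induction; first by rewrite FE; apply/indP.
by move=> k; rewrite !FE => /indP h; apply/indP; apply: PS.
Qed.
End Arithmetic.

Ltac rep_step :=
  lazymatch goal with
  | |- dec (fun _ => True) => exact (dec_True _ _)
  | |- dec (fun e => nlt (@?f e) (@?g e)) => refine (dec_lt (f := f) (g := g) _ _)
  | |- dec (fun e => @?f e = @?g e) => refine (dec_eq (f := f) (g := g) _ _)
  | |- dec (fun e => @?P e /\ @?Q e) => refine (dec_and (P := P) (Q := Q) _ _)
  | |- dec (fun e => @?P e \/ @?Q e) => refine (dec_or (P := P) (Q := Q) _ _)
  | |- dec (fun e => @?P e -> False) => refine (dec_not (P := P) _)
  | |- dec (fun e => ~ @?P e) => refine (dec_not (P := P) _)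
  | |- dec (fun e => @?P e -> @?Q e) => refine (dec_imp (P := P) (Q := Q) _ _)
  | |- rep (fun e => fst e) => exact (rep_v0 _ _ _)
  | |- rep fst => exact (rep_v0 _ _ _)
  | |- rep (fun e => fst (snd e)) => exact (rep_v1 _ _ _ _)
  | |- rep (fun e => fst (snd (snd e))) => exact (rep_v2 _ _ _ _ _)
  | |- rep (fun e => fst (snd (snd (snd e)))) => exact (rep_v3 _ _ _ _ _ _)
  | |- rep (fun e => fst (snd (snd (snd (snd e))))) => exact (rep_v4 _ _ _ _ _ _ _)
  | |- rep (fun e => fst (snd (snd (snd (snd (snd e)))))) => exact (rep_v5 _ _ _ _ _ _ _ _)
  | |- rep (fun e => @GRing.add _ (@?f e) (@?g e)) => refine (rep_add (f := f) (g := g) _ _)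
  | |- rep (fun e => @GRing.mul _ (@?f e) (@?g e)) => refine (rep_mul (f := f) (g := g) _ _)
  | |- rep (fun e => cond (@?P e) (@?f e) (@?g e)) =>
      refine (rep_if (P := P) (f := f) (g := g) _ _ _)
  | |- rep (fun e => ap (@?f e) (@?g e)) => refine (rep_app (f := f) (g := g) _ _)
  | |- rep _ => exact (rep_const _ _)
  end; cbv beta.
(** An extension point: redefined once pairing, rational codes and quantification through E^2 have
    their own closure lemmas. *)
Ltac rep_hook := fail.
Ltac solve_rep := cbv beta; solve [repeat (first [assumption | rep_hook | rep_step])].

(** * Bounded search, subtraction and predecessor *)

Section Search.
Variable W : rca.
Notation N := (num W).
Implicit Types x y z k : N.
Local Open Scope ring_scope.

(* The least [m < n] with [P m], or [n] if there is none. *)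
Definition is_bmin (P : N -> Prop) (n m : N) : Prop :=
  [/\ m <=N n, m <N n -> P m & forall k, k <N m -> ~ P k].

Lemma is_bmin_unique P n m m' : is_bmin P n m -> is_bmin P n m' -> m = m'.
Proof.
move=> [mn pm im] [m'n pm' im']; have [h|[//|h]] := nlt_total m m'.
  by case: (im' _ h); apply: pm; apply: nlt_le_trans h m'n.
by case: (im _ h); apply: pm'; apply: nlt_le_trans h mn.
Qed.

Definition bmin (P : N -> Prop) (n : N) : N :=
  if pselect (exists m, is_bmin P n m) is left e then projT1 (cid e) else 0.

Lemma bminE P n m : is_bmin P n m -> bmin P n = m.
Proof.
move=> h; rewrite /bmin; case: pselect => [e|[]]; last by exists m.
by case: cid => m' /= h'; apply: is_bmin_unique h' h.
Qed.

(* Iterating [m |-> if P m then m else m + 1] from [0] searches for the least [m] with [P m]. *)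
Definition search_step (P : N -> Prop) (m : N) : N := cond (P m) m (m + 1).

Section Fixed.
Variables (P : N -> Prop) (h : dom W T1).
Hypothesis hE : forall m : N, ap h m = search_step P m.

(** A number is fixed by the step function exactly when it satisfies [P], so comparing [h m] with
    [m] decides [P]. *)
Lemma search_dec : dec (G := [:: T0]) (fun e : tup W [:: T0] => P e.1).
Proof.
have d : dec (G := [:: T0]) (fun e : tup W [:: T0] => ap h e.1 = e.1) by solve_rep.
apply: dec_iff d => e; rewrite hE /search_step /cond; case: pselect => p; split=> // q.
by case: (nlt_neq (nltS (e.1 : N))); rewrite [RHS]q.
Qed.

(** The search stands still once [P] holds, so an invariant has to survive only those increments at
    which [P] fails. *)
Lemma search_inv (Q : N -> Prop) : dec (G := [:: T0]) (fun e : tup W [:: T0] => Q e.1) ->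
  Q 0 -> (forall m, ~ P m -> Q m -> Q (m + 1)) -> forall n, Q (iter h 0 n).
Proof.
move=> /(rep_fun1 (f := fun m => ind W (Q m) : dom W T0)) [F FE] Q0 QS.
apply: (n_ind (P := fun n => Q (iter h 0 n))).
- have : dec (G := [:: T0])
    (fun e : tup W [:: T0] => ap F (ap (ap (ap (mrec W) h) (0 : N)) e.1) = (1 : N)) by solve_rep.
  by move=> d; apply: dec_iff d => e; rewrite FE; apply: indP.
- by rewrite iter0.
- move=> n q; rewrite iterS hE /search_step.
  by have [p|p] := EM (P (iter h 0 n)); [rewrite condT|rewrite condF //; apply: QS].
Qed.

Lemma search_stop n : P (iter h 0 n) \/ iter h 0 n = n.
Proof.
move: n; apply: n_ind.
- have dP := search_dec; have [F FE] := rep_fun1 (f := fun m => ind W (P m) : dom W T0) dP.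
  have : dec (G := [:: T0]) (fun e : tup W [:: T0] =>
      ap F (ap (ap (ap (mrec W) h) (0 : N)) e.1) = (1 : N) \/
      ap (ap (ap (mrec W) h) (0 : N)) e.1 = e.1) by solve_rep.
  by move=> d; apply: dec_iff d => e; rewrite FE indP.
- by right; rewrite iter0.
- move=> n; rewrite iterS hE /search_step.
  have [p _|p [/p //|e]] := EM (P (iter h 0 n)); first by rewrite condT; [left|].
  by rewrite condF // e; right.
Qed.

Lemma search_is_bmin n : is_bmin P n (iter h 0 n).
Proof.
split.
- move: n; apply: n_ind.
  + have : dec (G := [:: T0]) (fun e : tup W [:: T0] =>
      (ap (ap (ap (mrec W) h) (0 : N)) e.1 : N) <=N e.1) by solve_rep.
    by move=> d; apply: dec_iff d => e.
  + by right; rewrite iter0.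
  + move=> n nh; rewrite iterS hE /search_step.
    have [p|p] := EM (P (iter h 0 n)); last by rewrite condF //; apply: nle_add2r.
    by rewrite condT //; left; apply: nle_lt_trans nh (nltS n).
- by case: (search_stop n) => // -> /nltxx.
- move=> k; apply: (search_inv (Q := fun m => k <N m -> ~ P k)).
  + have := search_dec; have : dec (G := [:: T0]) (fun e : tup W [:: T0] => k <N e.1).
      by solve_rep.
    move=> d _; apply: dec_imp d _.
    by apply: (rep_ext (f := fun=> ind W (~ P k))) => //; apply: rep_const.
  + by move=> k0; case: (@nltxx _ k); apply: nlt_le_trans k0 (nle0 k).
  + by move=> m nP hm /nleSS [/hm //|->].
Qed.

End Fixed.

Lemma search_fun (G : ctx) (P : N -> tup W G -> Prop) :
  dec (G := T0 :: G) (fun e : tup W (T0 :: G) => P e.1 e.2) ->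
  exists2 H : tup W G -> dom W T1, rep H &
    forall e m, ap (H e) m = search_step (P^~ e) m.
Proof.
move=> dP.
have : rep (G := T0 :: G) (fun e : tup W (T0 :: G) =>
  cond (P e.1 e.2) (e.1 : N) ((e.1 : N) + 1) : dom W T0) by solve_rep.
by move=> /rep_lam [H [rH HE]]; exists H => // e m; rewrite HE.
Qed.

Lemma bminP (G : ctx) (P : N -> tup W G -> Prop) :
  dec (G := T0 :: G) (fun e : tup W (T0 :: G) => P e.1 e.2) ->
  forall e n, is_bmin (P^~ e) n (bmin (P^~ e) n).
Proof.
move=> /search_fun [H _ HE] e n.
by rewrite (bminE (search_is_bmin (HE e) n)); apply: search_is_bmin.
Qed.

Lemma rep_bmin (G : ctx) (P : N -> tup W G -> Prop) (f : tup W G -> N) :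
  dec (G := T0 :: G) (fun e : tup W (T0 :: G) => P e.1 e.2) -> rep (t := T0) f ->
  rep (t := T0) (fun e => bmin (P^~ e) (f e)).
Proof.
move=> /search_fun [H rH HE] rf.
have : rep (fun e : tup W G => ap (ap (ap (mrec W) (H e)) (0 : N)) (f e)) by solve_rep.
by apply: rep_ext => e; rewrite (bminE (search_is_bmin (HE e) (f e))).
Qed.

Lemma dec_bex (G : ctx) (P : N -> tup W G -> Prop) (f : tup W G -> N) :
  dec (G := T0 :: G) (fun e : tup W (T0 :: G) => P e.1 e.2) -> rep (t := T0) f ->
  dec (fun e => exists m, m <N f e /\ P m e).
Proof.
move=> dP rf; have rb := rep_bmin dP rf; apply: dec_iff (dec_lt rb rf) => e.
have [le st mi] := bminP dP e (f e); split=> [h|[m [mf Pm]]].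
  by exists (bmin (P^~ e) (f e)); split=> //; apply: st.
case: le => // eb; rewrite eb in mi; by case: (mi m mf).
Qed.

Lemma dec_ball (G : ctx) (P : N -> tup W G -> Prop) (f : tup W G -> N) :
  dec (G := T0 :: G) (fun e : tup W (T0 :: G) => P e.1 e.2) -> rep (t := T0) f ->
  dec (fun e => forall m, m <N f e -> P m e).
Proof.
move=> dP rf; have dE := dec_bex (P := fun m e => ~ P m e) (dec_not dP) rf.
apply: dec_iff (dec_not dE) => e; split=> [h m mf|h [m [mf nP]]]; last exact: nP (h m mf).
by apply: contrapT => nP; apply: h; exists m.
Qed.

(** Subtraction is not among the semiring axioms; the difference is found as the least [m] with
    [y <=N x + m]. *)
Lemma nsub_ex x y : x <=N y -> exists z, x + z = y.
Proof.
move=> xy; have [|H _ HE] := search_fun (G := [::]) (P := fun m _ => y <=N x + m).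
  by solve_rep.
(* The counter increases only while [x + m] is below [y], so the sum never exceeds [y]. *)
have inv : forall n, x + iter (H tt) 0 n <=N y.
  apply: (search_inv (HE tt) (Q := fun m => x + m <=N y)); first by solve_rep.
    by rewrite addr0.
  move=> m nh _; rewrite addrA; apply: nlt_succ; apply: contrapT => h; apply: nh.
  exact/nlt_neg.
(* After [y + 1] steps the search has stopped: otherwise the counter would be [y + 1], against
   [inv]. *)
exists (iter (H tt) 0 (y + 1)).
have [h|e] := search_stop (HE tt) (y + 1).
  by case: h => // h; case: (@nltxx _ y); apply: nlt_le_trans h (inv _).
case: (@nltxx _ y); apply: nlt_le_trans (nltS y) _.
apply: nle_trans (inv (y + 1)); rewrite e [x + _]addrC; exact: nleDr.
Qed.

Lemma npred_ex x : 0 <N x -> exists y, x = y + 1.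
Proof. by move=> /nlt_succ /nsub_ex [z <-]; exists z; rewrite add0r addrC. Qed.

End Search.

Local Open Scope ring_scope.

(** * The ordered field of rationals of a model *)

Section PreRational.
Variable W : rca.
Notation N := (num W).

(* [(p, m, e)] stands for (p - m) / (e + 1). *)
Definition prat : Type := (N * N * N)%type.
Definition pden (x : prat) : N := x.2 + 1.

Definition prat_eq (x y : prat) : Prop :=
  x.1.1 * pden y + y.1.2 * pden x = y.1.1 * pden x + x.1.2 * pden y.

Lemma pden_gt0 x : 0 <N pden x.
Proof. exact: nltS0. Qed.

Lemma prat_eq_refl x : prat_eq x x. Proof. by []. Qed.
Lemma prat_eq_sym x y : prat_eq x y -> prat_eq y x.
Proof. by rewrite /prat_eq => h; rewrite h. Qed.
Lemma prat_eq_trans x y z : prat_eq x y -> prat_eq y z -> prat_eq x z.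
Proof.
rewrite /prat_eq => h h'; apply: (@nmulI W _ _ (pden y)); first exact: pden_gt0.
have e := f_equal2 +%R (f_equal (fun t => pden z * t) h) (f_equal (fun t => pden x * t) h').
symmetry in e; apply: lincomb e; ring.
Qed.

Definition padd (x y : prat) : prat :=
  (x.1.1 * pden y + y.1.1 * pden x, x.1.2 * pden y + y.1.2 * pden x,
   x.2 * y.2 + x.2 + y.2).
Definition pmul (x y : prat) : prat :=
  (x.1.1 * y.1.1 + x.1.2 * y.1.2, x.1.1 * y.1.2 + x.1.2 * y.1.1,
   x.2 * y.2 + x.2 + y.2).
Definition popp (x : prat) : prat := (x.1.2, x.1.1, x.2).
Definition pnat (n : N) : prat := (n, 0, 0).

Lemma padd_eq x x' y y' : prat_eq x x' -> prat_eq y y' -> prat_eq (padd x y) (padd x' y').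
Proof.
rewrite /prat_eq /padd /pden /= => h h'.
have e := f_equal2 +%R (f_equal (fun t => (y.2 + 1) * (y'.2 + 1) * t) h)
  (f_equal (fun t => (x.2 + 1) * (x'.2 + 1) * t) h').
symmetry in e; apply: lincomb e; ring.
Qed.

Lemma pmul_eq1 x x' y : prat_eq x x' -> prat_eq (pmul x y) (pmul x' y).
Proof.
rewrite /prat_eq /pmul /pden /= => h.
have e := f_equal2 +%R (f_equal (fun t => y.1.1 * (y.2 + 1) * t) h)
  (f_equal (fun t => y.1.2 * (y.2 + 1) * t) (esym h)).
symmetry in e; apply: lincomb e; ring.
Qed.

Lemma pmulC x y : pmul x y = pmul y x.
Proof. by rewrite /pmul; congr (_, _, _); ring. Qed.

Lemma pmul_eq x x' y y' : prat_eq x x' -> prat_eq y y' -> prat_eq (pmul x y) (pmul x' y').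
Proof.
move=> h h'; apply: prat_eq_trans (pmul_eq1 y h) _.
by rewrite ![pmul x' _]pmulC; apply: pmul_eq1.
Qed.

Lemma popp_eq x x' : prat_eq x x' -> prat_eq (popp x) (popp x').
Proof.
by rewrite /prat_eq /popp /pden /= => h; rewrite [LHS]addrC [RHS]addrC -h.
Qed.

Definition rational : Type := quo prat_eq.
Definition qcls (x : prat) : rational := cls prat_eq x.

Lemma qcls_eq x y : qcls x = qcls y <-> prat_eq x y.
Proof. exact: (cls_eq prat_eq_refl prat_eq_sym prat_eq_trans). Qed.

Lemma qcls_surj (q : rational) : exists x, q = qcls x.
Proof. by have [x <-] := cls_surj q; exists x. Qed.

Definition qrep (q : rational) : prat := projT1 (cid (qcls_surj q)).
Lemma qrepK q : qcls (qrep q) = q.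
Proof. by rewrite /qrep; case: cid. Qed.
Lemma qrep_cls x : prat_eq (qrep (qcls x)) x.
Proof. by apply/qcls_eq; rewrite qrepK. Qed.

Definition qadd (q r : rational) : rational := qcls (padd (qrep q) (qrep r)).
Definition qmul (q r : rational) : rational := qcls (pmul (qrep q) (qrep r)).
Definition qopp (q : rational) : rational := qcls (popp (qrep q)).

Lemma qaddE x y : qadd (qcls x) (qcls y) = qcls (padd x y).
Proof. by apply/qcls_eq; apply: padd_eq; apply: qrep_cls. Qed.
Lemma qmulE x y : qmul (qcls x) (qcls y) = qcls (pmul x y).
Proof. by apply/qcls_eq; apply: pmul_eq; apply: qrep_cls. Qed.
Lemma qoppE x : qopp (qcls x) = qcls (popp x).
Proof. by apply/qcls_eq; apply: popp_eq; apply: qrep_cls. Qed.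

Ltac qelim := repeat (let q := fresh "q" in move=> q; have [? ->] := qcls_surj q);
  rewrite !(qaddE, qmulE, qoppE);
  apply/qcls_eq; rewrite /prat_eq /padd /pmul /popp /pnat /pden /=; ring.

Lemma qaddA : associative qadd. Proof. qelim. Qed.
Lemma qaddC : commutative qadd. Proof. qelim. Qed.
Lemma qadd0 : left_id (qcls (pnat 0)) qadd. Proof. qelim. Qed.
Lemma qaddN : left_inverse (qcls (pnat 0)) qopp qadd. Proof. qelim. Qed.
Lemma qmulA : associative qmul. Proof. qelim. Qed.
Lemma qmulC : commutative qmul. Proof. qelim. Qed.
Lemma qmul1 : left_id (qcls (pnat 1)) qmul. Proof. qelim. Qed.
Lemma qmulDl : left_distributive qmul qadd. Proof. qelim. Qed.

Lemma qcls0 x : qcls x = qcls (pnat 0) <-> x.1.1 = x.1.2.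
Proof. by rewrite qcls_eq /prat_eq /pnat /pden /= !add0r !mulr1 !mul0r addr0 add0r. Qed.

Lemma qone_neq0 : qcls (pnat 1) <> qcls (pnat 0).
Proof. by move=> /qcls0 /= /eqP; rewrite oner_eq0. Qed.

Lemma qinv_ex q : q <> qcls (pnat 0) -> exists r, qmul r q = qcls (pnat 1).
Proof.
have [[[p m] e] ->] := qcls_surj q.
have [pm|[pm []|mp _]] := nlt_total p m; last 2 first.
- exact/qcls0.
- have [|k ek] := @nsub_ex W m p; first by left.
  have [|j ej] := @npred_ex W k.
    by have [//|k0] := nle0 k; case: (nlt_neq mp); rewrite -ek -k0 addr0.
  exists (qcls (e + 1, 0, j)); rewrite qmulE; apply/qcls_eq.
  by rewrite /prat_eq /pmul /pnat /pden /= -ek ej; ring.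
- move=> _; have [|k ek] := @nsub_ex W p m; first by left.
  have [|j ej] := @npred_ex W k.
    by have [//|k0] := nle0 k; case: (nlt_neq pm); rewrite -ek -k0 addr0.
  exists (qcls (0, e + 1, j)); rewrite qmulE; apply/qcls_eq.
  by rewrite /prat_eq /pmul /pnat /pden /= -ek ej; ring.
Qed.

(** The default value is the inverse of 0 that the field structure prescribes. *)
Definition qinv (q : rational) : rational :=
  if pselect (exists r, qmul r q = qcls (pnat 1)) is left e then projT1 (cid e)
  else qcls (pnat 0).

Definition qge0 (q : rational) : Prop := exists p m e, q = qcls (p, m, e) /\ m <=N p.

Lemma qge0E p m e : qge0 (qcls (p, m, e)) <-> m <=N p.
Proof.
split=> [[p' [m' [e' [/qcls_eq h h']]]]|]; last by exists p, m, e.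
apply/nlt_neg => pm; rewrite /prat_eq /pden /= in h.
have d0 : 0 <N e' + 1 by apply: nltS0.
have h1 := nlt_mul2r pm d0.
have h2 : m' * (e + 1) <=N p' * (e + 1).
  by case: h' => [h'|->]; [left; apply: nlt_mul2r => //; apply: nltS0|right].
have := nlt_add2r (m' * (e + 1)) h1; rewrite h.
have := nle_add2r (m * (e' + 1)) h2; rewrite [m' * _ + _]addrC => h3 h4.
exact: (nltxx (nlt_le_trans h4 h3)).
Qed.

Lemma qge0_add q r : qge0 q -> qge0 r -> qge0 (qadd q r).
Proof.
have [[[p m] e] ->] := qcls_surj q; have [[[p' m'] e'] ->] := qcls_surj r.
rewrite qaddE !qge0E /pden /= => h h'; apply: (nle_trans (y := p * (e' + 1) + m' * (e + 1))).
  apply: nle_add2r; case: h => [h|->]; [left; apply: nlt_mul2r => //; apply: nltS0|by right].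
rewrite [X in X <N _]addrC [X in X = _]addrC [X in _ <N X]addrC [X in _ = X]addrC.
apply: nle_add2r; case: h' => [h'|->]; [left; apply: nlt_mul2r => //; apply: nltS0|by right].
Qed.

Lemma qge0_mul q r : qge0 q -> qge0 r -> qge0 (qmul q r).
Proof.
have [[[p m] e] ->] := qcls_surj q; have [[[p' m'] e'] ->] := qcls_surj r.
rewrite qmulE !qge0E /= => /nsub_ex [k <-] /nsub_ex [l <-].
suff -> : (m + k) * (m' + l) + m * m' = (m + k) * m' + m * (m' + l) + k * l by apply: nleDr.
by ring.
Qed.

Lemma qge0_anti q : qge0 q -> qge0 (qopp q) -> q = qcls (pnat 0).
Proof.
have [[[p m] e] ->] := qcls_surj q; rewrite qoppE !qge0E /= => h h'; apply/qcls0 => /=.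
by case: h => // h; case: (@nltxx W m); apply: nlt_le_trans h h'.
Qed.

Lemma qge0_total q : qge0 q \/ qge0 (qopp q).
Proof.
have [[[p m] e] ->] := qcls_surj q; rewrite qoppE !qge0E /=.
by have [|[->|]] := nlt_total p m; [right; left|left; right|left; left].
Qed.

End PreRational.

HB.instance Definition _ (W : rca) := gen_eqMixin (rational W).
HB.instance Definition _ (W : rca) := gen_choiceMixin (rational W).
HB.instance Definition _ (W : rca) :=
  GRing.isZmodule.Build (rational W) (@qaddA W) (@qaddC W) (@qadd0 W) (@qaddN W).

Lemma qone_neq0b (W : rca) : qcls (pnat 1) != 0 :> rational W.
Proof. by apply/eqP; apply: qone_neq0. Qed.

HB.instance Definition _ (W : rca) :=
  GRing.Zmodule_isComNzRing.Build (rational W)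
    (@qmulA W) (@qmulC W) (@qmul1 W) (@qmulDl W) (qone_neq0b W).

Lemma qmulVf (W : rca) (q : rational W) : q != 0 -> qinv q * q = 1.
Proof.
move=> /eqP /qinv_ex h; rewrite /qinv; case: pselect => // e.
by case: cid.
Qed.

Lemma qinv0 (W : rca) : qinv (0 : rational W) = 0.
Proof.
rewrite /qinv; case: pselect => // -[r e]; exfalso; move: e.
by rewrite -[qmul r 0]/(r * 0) mulr0 => /esym /qone_neq0.
Qed.

HB.instance Definition _ (W : rca) :=
  GRing.ComNzRing_isField.Build (rational W) (@qmulVf W) (@qinv0 W).

Section RationalOrder.
Variable W : rca.
Notation Q := (rational W).
Implicit Types x y : Q.

Definition qle x y : bool := `[< qge0 (y - x) >].
Definition qlt x y : bool := (y != x) && qle x y.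
Definition qnorm x : Q := if `[< qge0 x >] then x else - x.

Lemma qle0E x : qle 0 x = `[< qge0 x >].
Proof. by rewrite /qle subr0. Qed.

Lemma qle0_add x y : qle 0 x -> qle 0 y -> qle 0 (x + y).
Proof. by rewrite !qle0E => /asboolP h /asboolP h'; apply/asboolP; apply: qge0_add. Qed.
Lemma qle0_mul x y : qle 0 x -> qle 0 y -> qle 0 (x * y).
Proof. by rewrite !qle0E => /asboolP h /asboolP h'; apply/asboolP; apply: qge0_mul. Qed.
Lemma qle0_anti x : qle 0 x -> qle x 0 -> x = 0.
Proof.
by rewrite qle0E /qle sub0r => /asboolP h /asboolP h'; apply: qge0_anti.
Qed.
Lemma qsub_ge0 x y : qle 0 (y - x) = qle x y.
Proof. by rewrite qle0E. Qed.
Lemma qle0_total x : qle 0 x || qle x 0.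
Proof.
rewrite qle0E /qle sub0r; apply/orP.
by have [h|h] := qge0_total x; [left|right]; apply/asboolP.
Qed.
Lemma qnormN x : qnorm (- x) = qnorm x.
Proof.
rewrite /qnorm opprK; case: asboolP => h; case: asboolP => h' //.
- by rewrite (qge0_anti h' h); apply: oppr0.
- by case: (qge0_total x).
Qed.
Lemma qge0_norm x : qle 0 x -> qnorm x = x.
Proof. by rewrite qle0E /qnorm => ->. Qed.
Lemma qlt_def x y : qlt x y = (y != x) && qle x y.
Proof. by []. Qed.
End RationalOrder.

HB.instance Definition _ (W : rca) :=
  Num.IntegralDomain_isLeReal.Build (rational W)
    (@qle0_add W) (@qle0_mul W) (@qle0_anti W) (@qsub_ge0 W) (@qle0_total W)
    (@qnormN W) (@qge0_norm W) (@qlt_def W).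

(** * Embedding of the numbers into the rationals *)

Section Embedding.
Variable W : rca.
Notation N := (num W).
Notation Q := (rational W).

Definition rnq (n : N) : Q := qcls (pnat n).

Lemma rnq0 : rnq 0 = 0. Proof. by []. Qed.
Lemma rnq1 : rnq 1 = 1. Proof. by []. Qed.
Lemma rnqD x y : rnq (x + y) = rnq x + rnq y.
Proof.
rewrite -[RHS]/(qadd _ _) qaddE; apply/qcls_eq.
by rewrite /prat_eq /pnat /padd /pden /=; ring.
Qed.
Lemma rnqM x y : rnq (x * y) = rnq x * rnq y.
Proof.
rewrite -[RHS]/(qmul _ _) qmulE; apply/qcls_eq.
by rewrite /prat_eq /pnat /padd /pden /=; ring.
Qed.
Lemma rnq_le x y : rnq x <= rnq y <-> x <=N y.
Proof.
rewrite -subr_ge0 -[0 <= _]/(qle 0 _) qle0E.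
rewrite -[rnq y - rnq x]/(qadd _ (qopp _)) qoppE qaddE /padd /popp /pden /=.
split=> [/asboolP /qge0E|h]; last (apply/asboolP/qge0E; move: h).
all: by rewrite !mul0r !add0r !addr0 !mulr1.
Qed.
Lemma rnq_lt x y : rnq x < rnq y <-> x <N y.
Proof.
rewrite real_ltNge ?num_real //; split=> [/negP h|h].
  by apply: contrapT => /nlt_neg /rnq_le.
by apply/negP => /rnq_le /nlt_neg.
Qed.
Lemma qclsE p m e : qcls (p, m, e) = (rnq p - rnq m) / (rnq e + 1).
Proof.
have d : rnq e + 1 != 0.
  by rewrite gt_eqF // -rnq1 -rnqD -rnq0; apply/rnq_lt; apply: nltS0.
apply: (mulIf d); rewrite divfK // -rnq1 -rnqD.
rewrite -[LHS]/(qmul _ _) -[RHS]/(qadd _ (qopp _)) qmulE qoppE qaddE.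
by apply/qcls_eq; rewrite /prat_eq /padd /pmul /popp /pnat /pden /=; ring.
Qed.

(* Sealed behind [Qed] so that unification never unfolds the quotient construction. *)
Lemma rational_field : {F : realFieldType & {f : N -> F |
  [/\ f 0 = 0, f 1 = 1, {morph f : x y / x + y}, {morph f : x y / x * y} &
    (forall x y, f x < f y <-> x <N y) /\
    (forall q, exists p m e, q = (f p - f m) / (f e + 1))]}}.
Proof.
exists (rational W : realFieldType), rnq; split=> //.
- exact: rnqD.
- exact: rnqM.
- split=> [|q]; first exact: rnq_lt.
  by have [[[p m] e] ->] := qcls_surj q; exists p, m, e; apply: qclsE.
Qed.

Definition ratf : realFieldType := projT1 rational_field.
Definition nq : N -> ratf := proj1_sig (projT2 rational_field).

Lemma nq0 : nq 0 = 0. Proof. by case: (proj2_sig (projT2 rational_field)). Qed.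
Lemma nq1 : nq 1 = 1. Proof. by case: (proj2_sig (projT2 rational_field)). Qed.
Lemma nqD x y : nq (x + y) = nq x + nq y.
Proof. by case: (proj2_sig (projT2 rational_field)). Qed.
Lemma nqM x y : nq (x * y) = nq x * nq y.
Proof. by case: (proj2_sig (projT2 rational_field)). Qed.
Lemma nq_lt x y : nq x < nq y <-> x <N y.
Proof. by case: (proj2_sig (projT2 rational_field)) => _ _ _ _ []. Qed.
Lemma nq_surj (q : ratf) : exists p m e, q = (nq p - nq m) / (nq e + 1).
Proof. by case: (proj2_sig (projT2 rational_field)) => _ _ _ _ []. Qed.
Lemma nq_le x y : nq x <= nq y <-> x <=N y.
Proof.
rewrite leNgt -nlt_neg -nq_lt; split=> [/negP //|h]; exact/negP.
Qed.
Lemma nq_inj : injective nq.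
Proof.
move=> x y e; have [|[//|]] := nlt_total x y => /nq_lt; rewrite e ltxx //.
Qed.
Lemma nq_ge0 n : 0 <= nq n.
Proof. by rewrite -nq0; apply/nq_le; apply: nle0. Qed.
End Embedding.

(** * Pairing and powers of two *)

Section Pairing.
Variable W : rca.
Notation N := (num W).
Notation Q := (ratf W).
Implicit Types a b c n x y : N.

Lemma nq_le' x y : x <=N y -> nq x <= nq y. Proof. by move=> h; apply/nq_le. Qed.
Lemma nq_lt' x y : x <N y -> nq x < nq y. Proof. by move=> h; apply/nq_lt. Qed.
Lemma nq_succ x y : x <N y -> nq x + 1 <= nq y.
Proof. by move=> /nlt_succ /nq_le'; rewrite nqD nq1. Qed.

(** Cantor pairing with both sides doubled, which avoids a division by 2. *)
Definition pairing c a b : Prop := c + c = (a + b) * (a + b + 1) + (b + b).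

Lemma pairingQ c a b : pairing c a b <->
  nq c + nq c = (nq a + nq b) * (nq a + nq b + 1) + (nq b + nq b).
Proof.
rewrite -nq1 -!nqD -nqM -nqD; split; last exact: nq_inj.
by move=> h; congr nq.
Qed.

(** Codes grow from one diagonal to the next: for s = a + b, 2c is at most s(s+1) + 2s, which is
    less than (s+1)(s+2). *)
Lemma pairing_sum_le c a b a' b' : pairing c a b -> pairing c a' b' -> ~ a + b <N a' + b'.
Proof.
move=> /pairingQ h /pairingQ h' /nq_succ; rewrite !nqD => lt.
have := nq_ge0 a; have := nq_ge0 b; have := nq_ge0 a'; have := nq_ge0 b'.
set A := nq a in h lt *; set B := nq b in h lt *.
set A' := nq a' in h' lt *; set B' := nq b' in h' lt *.
move=> b'0 a'0 b0 a0.
have : 0 <= (A' + B' - (A + B + 1)) * (A' + B' + (A + B + 1)) by apply: mulr_ge0; lra.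
by nra.
Qed.

Lemma pairing_unique c a b a' b' : pairing c a b -> pairing c a' b' -> a = a' /\ b = b'.
Proof.
move=> h h'.
have e : a + b = a' + b'.
  have [/(pairing_sum_le h h') //|[//|/(pairing_sum_le h' h) //]] := nlt_total (a + b) (a' + b').
suff eb : b = b' by split=> //; apply: (naddI (z := b)); rewrite {2}eb.
apply: (@nq_inj W); move/pairingQ: h; move/pairingQ: h'.
by have := congr1 (@nq W) e; rewrite !nqD => ->; lra.
Qed.

Lemma pairing_bound c a b : pairing c a b -> a <N c + c + 1 /\ b <N c + c + 1.
Proof.
move=> /pairingQ h; have a0 := nq_ge0 a; have b0 := nq_ge0 b.
by split; apply/nq_lt; rewrite !nqD nq1; nra.
Qed.

(** The successor of a code is the next point of the walk through the diagonals: (a+1, b) moves to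
    (a, b+1), and (0, b) to (b+1, 0). The bounds on [a] and [b] make the statement decidable, as
    [n_ind] demands. *)
Lemma pairing_ex c : exists a, a <N c + c + 1 /\ exists b, b <N c + c + 1 /\ pairing c a b.
Proof.
move: c; apply: n_ind.
- rewrite /=; apply: (dec_bex (P := fun a (e : tup W [:: T0]) =>
    exists b, b <N (e.1 : N) + e.1 + 1 /\ pairing e.1 a b)); last solve_rep.
  apply: (dec_bex (P := fun b (e : tup W [:: T0; T0]) => pairing e.2.1 e.1 b));
    rewrite /pairing; solve_rep.
- by exists 0; split; [|exists 0; split]; rewrite /pairing ?addr0 ?mul0r; first [exact: nltS|ring].
- move=> c [a [_ [b [_ h]]]].
  suff [a' [b' h']] : exists a' b', pairing (c + 1) a' b'.
    by have [ha hb] := pairing_bound h'; exists a'; split=> //; exists b'.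
  have [/npred_ex [a' ea]|a0] := nle0 a.
    exists a', (b + 1); move: h; rewrite /pairing ea => h.
    have {}h := congr1 (fun t => t + (1 + 1)) h.
    by apply: etrans (etrans _ h) _; ring.
  exists (b + 1), 0; move: h; rewrite /pairing -a0 => h.
  have {}h := congr1 (fun t => t + (1 + 1)) h.
  by apply: etrans (etrans _ h) _; ring.
Qed.

(** It remains to halve s(s+1); the triangular number is found by induction on s, again with a bound
    that keeps the claim decidable. *)
Lemma pairing_mk a b : exists c, pairing c a b.
Proof.
have triangle (s : N) : exists t, t <N s * (s + 1) + 1 /\ t + t = s * (s + 1).
  move: s; apply: n_ind.
  - rewrite /=; apply: (dec_bex
      (P := fun t (e : tup W [:: T0]) => t + t = (e.1 : N) * ((e.1 : N) + 1)));
      solve_rep.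
  - by exists 0; rewrite !mul0r !add0r; split=> //; apply: nlt01.
  - move=> s [t [_ h]]; exists (t + s + 1); split; last first.
      by have {}h := congr1 (fun u => u + (s + s + 1 + 1)) h; apply: etrans (etrans _ h) _; ring.
    apply/nq_lt; have := congr1 (@nq W) h; have := nq_ge0 t; have := nq_ge0 s.
    rewrite !(nqD, nqM) nq1; nra.
have [t [_ h]] := triangle (a + b); exists (t + b); rewrite /pairing -h; ring.
Qed.

Lemma bmin_found (P : N -> Prop) k n : dec (G := [:: T0]) (fun e : tup W [:: T0] => P e.1) ->
  P k -> k <N n -> P (bmin P n).
Proof.
move=> dP Pk kn; have [le st mi] := bminP (G := [::]) (P := fun m _ => P m) dP tt n.
case: le => // e; case: (mi k _ Pk); by rewrite e.
Qed.

Lemma pair_funs : exists p : dom W (T0 ~> T0 ~> T0) * dom W T1 * dom W T1,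
  (forall a b, pairing (ap (ap p.1.1 a) b) a b) /\
  (forall c, pairing c (ap p.1.2 c) (ap p.2 c)).
Proof.
have [|F FE] := @rep_fun2 W T0 T0 T0
  (fun a b => bmin (fun c => pairing c a b) ((a + b : N) * (a + b + 1) + (b + b) + 1)).
  apply: (rep_bmin (P := fun c (e : tup W [:: T0; T0]) => pairing c e.2.1 e.1)); last solve_rep.
  rewrite /pairing; solve_rep.
have [|F1 FE1] := @rep_fun1 W T0 T0
  (fun c => bmin (fun a => exists b, b <N (c : N) + c + 1 /\ pairing c a b) ((c : N) + c + 1)).
  apply: (rep_bmin (P := fun a (e : tup W [:: T0]) =>
    exists b, b <N (e.1 : N) + e.1 + 1 /\ pairing e.1 a b)); last solve_rep.
  apply: (dec_bex (P := fun b (e : tup W [:: T0; T0]) => pairing e.2.1 e.1 b)); last solve_rep.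
  rewrite /pairing; solve_rep.
have [|F2 FE2] := @rep_fun1 W T0 T0
  (fun c => bmin (fun b => pairing c (ap F1 c) b) ((c : N) + c + 1)).
  apply: (rep_bmin (P := fun b (e : tup W [:: T0]) => pairing e.1 (ap F1 e.1) b)); last solve_rep.
  rewrite /pairing; solve_rep.
exists (F, F1, F2); split=> [a b|c] /=.
- have [c h] := pairing_mk a b; rewrite FE; apply: (bmin_found (P := fun c => pairing c a b) _ h).
    by rewrite /pairing; solve_rep.
  apply/nq_lt; have := congr1 (@nq W) h; have := nq_ge0 c.
  by rewrite !(nqD, nqM) nq1; lra.
- have [a [ab [b [bb h]]]] := pairing_ex c.
  have [b' [b'b h']] : exists b, b <N c + c + 1 /\ pairing c (ap F1 c) b.
    rewrite FE1.
    apply: (bmin_found (P := fun a => exists b, b <N c + c + 1 /\ pairing c a b) _ _ ab).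
      apply: (dec_bex (P := fun b (e : tup W [:: T0]) => pairing c e.1 b));
        rewrite /pairing; solve_rep.
    by exists b.
  rewrite FE2; apply: (bmin_found (P := fun b => pairing c (ap F1 c) b) _ h' b'b).
  rewrite /pairing; solve_rep.
Qed.

Definition prF := (projT1 (cid pair_funs)).1.1.
Definition pj1F := (projT1 (cid pair_funs)).1.2.
Definition pj2F := (projT1 (cid pair_funs)).2.
Definition pr a b : N := ap (ap prF a) b.
Definition pj1 c : N := ap pj1F c.
Definition pj2 c : N := ap pj2F c.

Lemma pr_pairing a b : pairing (pr a b) a b.
Proof. by rewrite /pr /prF; case: cid => /= p []. Qed.
Lemma pj_pairing c : pairing c (pj1 c) (pj2 c).
Proof. by rewrite /pj1 /pj2 /pj1F /pj2F; case: cid => /= p []. Qed.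
Lemma pj1K a b : pj1 (pr a b) = a.
Proof. by case: (pairing_unique (pj_pairing (pr a b)) (pr_pairing a b)). Qed.
Lemma pj2K a b : pj2 (pr a b) = b.
Proof. by case: (pairing_unique (pj_pairing (pr a b)) (pr_pairing a b)). Qed.

Lemma rep_pr G (f g : tup W G -> N) : rep (t := T0) f -> rep (t := T0) g ->
  rep (t := T0) (fun e => pr (f e) (g e)).
Proof. by rewrite /pr => rf rg; solve_rep. Qed.
Lemma rep_pj1 G (f : tup W G -> N) : rep (t := T0) f -> rep (t := T0) (fun e => pj1 (f e)).
Proof. by rewrite /pj1 => rf; solve_rep. Qed.
Lemma rep_pj2 G (f : tup W G -> N) : rep (t := T0) f -> rep (t := T0) (fun e => pj2 (f e)).
Proof. by rewrite /pj2 => rf; solve_rep. Qed.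

Definition p2 n : N := ap (ap (ap (mrec W) (eval (mnil W) double)) (1 : N)) n.
Definition e2 n : Q := (nq (p2 n))^-1.

Lemma p2_0 : p2 0 = 1. Proof. exact: iter0. Qed.
Lemma p2S n : p2 (n + 1) = p2 n + p2 n.
Proof. by rewrite /p2 -/(iter _ _ _) iterS /= !sigmaE !piE. Qed.
Lemma p2_gt0 n : 0 <N p2 n.
Proof.
move: n; apply: n_ind; first by rewrite /p2; solve_rep.
- by rewrite p2_0; apply: nlt01.
- by move=> n h; rewrite p2S; apply: nlt_trans h (nltDr _ h).
Qed.
Lemma p2_gt n : n <N p2 n.
Proof.
move: n; apply: n_ind; first by rewrite /p2; solve_rep.
- by rewrite p2_0; apply: nlt01.
- by move=> n /nq_succ h; rewrite p2S; apply/nq_lt; rewrite !nqD nq1; have := nq_ge0 n; lra.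
Qed.
Lemma p2_qgt0 n : 0 < nq (p2 n). Proof. by rewrite -nq0; apply/nq_lt; apply: p2_gt0. Qed.
Lemma e2_gt0 n : 0 < e2 n. Proof. by rewrite invr_gt0 p2_qgt0. Qed.
Lemma e2S n : e2 n = e2 (n + 1) + e2 (n + 1).
Proof.
rewrite /e2 p2S nqD; have := p2_qgt0 n => h; field.
by rewrite (gt_eqF h) /= gt_eqF //; lra.
Qed.
Lemma e2_le m n : m <=N n -> e2 n <= e2 m.
Proof.
move=> /nsub_ex [k <-]; rewrite /e2 lef_pV2 ?posrE ?p2_qgt0 //; apply/nq_le.
move: k; apply: n_ind; first by rewrite /p2; solve_rep.
- by right; rewrite addr0.
- by move=> k h; rewrite addrA p2S; apply: nle_trans h (nleDr _ _).
Qed.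

(** The Archimedean property relative to the possibly nonstandard numbers of the model; with it the
    values [e2 n] become arbitrarily small. *)
Lemma val_bound (q : Q) : exists n : N, q < nq n.
Proof.
have [p [m [e ->]]] := nq_surj q; exists (p + 1); rewrite nqD nq1.
have := nq_ge0 p; have := nq_ge0 m; have := nq_ge0 e => e0 m0 p0.
rewrite ltr_pdivrMr; nra.
Qed.

Lemma e2_small (d : Q) : 0 < d -> exists n, e2 n < d.
Proof.
move=> d0; have [n h] := val_bound d^-1; exists n.
have h' := lt_trans h (nq_lt' (p2_gt n)).
by rewrite /e2 -[d]invrK ltf_pV2 ?posrE ?p2_qgt0 ?invr_gt0.
Qed.

End Pairing.

(** * Rational codes and the meaning of the formulas on reals *)

Section Codes.
Variable W : rca.
Notation N := (num W).
Notation Q := (ratf W).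

Definition cpos (c : N) : N := pj1 (pj1 c).
Definition cneg (c : N) : N := pj2 (pj1 c).
Definition cden (c : N) : N := pj2 c.
Definition val (c : N) : Q := (nq (cpos c) - nq (cneg c)) / (nq (cden c) + 1).

Lemma val_surj (q : Q) : exists c, val c = q.
Proof.
have [p [m [e ->]]] := nq_surj q; exists (pr (pr p m) e).
by rewrite /val /cpos /cneg /cden !(pj1K, pj2K).
Qed.

Lemma val_0 : val 0 = 0.
Proof.
have [e1 e2] : 0 = pj1 (0 : N) /\ 0 = pj2 (0 : N).
  by apply: (pairing_unique (c := 0)) (pj_pairing _); rewrite /pairing; ring.
by rewrite /val /cpos /cneg -!e1 -e2 subrr mul0r.
Qed.

Lemma val_1 : val 1 = 1.
Proof.
have [e1 e2] : 1 = pj1 (1 : N) /\ 0 = pj2 (1 : N).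
  by apply: (pairing_unique (c := 1)) (pj_pairing _); rewrite /pairing; ring.
by rewrite /val /cpos /cneg /cden -!e1 -e2 nq1 nq0 subr0 add0r divr1.
Qed.

Definition fq (G : ctx) (r : menv W G) (q : frac G) : Q :=
  (nq (eval r (fpos q)) - nq (eval r (fneg q))) / nq (eval r (fden q)).
Definition fok (G : ctx) (r : menv W G) (q : frac G) : Prop := nq (eval r (fden q)) != 0.

Lemma nq_plus (x y : N) : nq (ap (ap (mplus W) x) y : N) = nq x + nq y.
Proof. exact: nqD. Qed.
Lemma nq_times (x y : N) : nq (ap (ap (mtimes W) x) y : N) = nq x * nq y.
Proof. exact: nqM. Qed.

Section Frac.
Variables (G : ctx) (r : menv W G).
Implicit Types q s : frac G.

Lemma fok_gt0 q : fok r q -> 0 < nq (eval r (fden q)).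
Proof. by rewrite lt_neqAle nq_ge0 andbT eq_sym. Qed.

Lemma fq_add q s : fok r q -> fok r s -> fq r (fadd q s) = fq r q + fq r s.
Proof.
rewrite /fok /fq /fadd /= !(nq_plus, nq_times) => h h'.
by field; rewrite h h'.
Qed.
Lemma fok_add q s : fok r q -> fok r s -> fok r (fadd q s).
Proof. by rewrite /fok /fadd /= nq_times => h h'; apply: mulf_neq0. Qed.
Lemma fq_sub q s : fok r q -> fok r s -> fq r (fsub q s) = fq r q - fq r s.
Proof.
rewrite /fok /fq /fsub /= !(nq_plus, nq_times) => h h'.
by field; rewrite h h'.
Qed.
Lemma fok_sub q s : fok r q -> fok r s -> fok r (fsub q s).
Proof. by rewrite /fok /fsub /= nq_times => h h'; apply: mulf_neq0. Qed.

Lemma fq_cmp q s : fok r q -> fok r s ->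
  (fq r q < fq r s <-> nq (eval r (fpos q)) * nq (eval r (fden s)) +
      nq (eval r (fneg s)) * nq (eval r (fden q)) <
      nq (eval r (fpos s)) * nq (eval r (fden q)) +
      nq (eval r (fneg q)) * nq (eval r (fden s))).
Proof.
move=> /fok_gt0 h /fok_gt0 h'; rewrite /fq ltr_pdivrMr // mulrAC ltr_pdivlMr //.
by split=> k; lra.
Qed.

Lemma sat_flt q s : fok r q -> fok r s -> (sat r (flt q s) <-> fq r q < fq r s).
Proof.
move=> h h'; rewrite fq_cmp //.
by rewrite -!nq_times -!nq_plus nq_lt.
Qed.

Lemma sat_fle q s : fok r q -> fok r s -> (sat r (fle q s) <-> fq r q <= fq r s).
Proof.
move=> h h'; rewrite leNgt; transitivity (~ fq r s < fq r q); last by split=> /negP.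
rewrite fq_cmp // -!nq_times -!nq_plus nq_lt nlt_neg /fle /=.
by [].
Qed.

Lemma fq_eps (n : term G T0) : fq r (eps n) = e2 (eval r n).
Proof.
by rewrite -[LHS]/((nq 1 - nq 0) / nq (p2 (eval r n : N))) nq0 nq1 subr0 mul1r.
Qed.
Lemma fok_eps (n : term G T0) : fok r (eps n).
Proof. by rewrite /fok gt_eqF // p2_qgt0. Qed.
Lemma fq_eps' (n : term G T0) : fq r (eps' n) = e2 (eval r n) + e2 (eval r n).
Proof.
rewrite -[LHS]/((nq (1 + 1) - nq 0) / nq (p2 (eval r n : N))) nqD nq0 nq1 subr0.
by rewrite mulrDl !mul1r.
Qed.
Lemma fok_eps' (n : term G T0) : fok r (eps' n).
Proof. by rewrite /fok gt_eqF // p2_qgt0. Qed.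
End Frac.

Lemma sat_codes (G : ctx) (r : menv W G) (c p m e : term G T0) :
  sat r (codes c p m e) <->
  [/\ eval r p = cpos (eval r c), eval r m = cneg (eval r c) & eval r e = cden (eval r c)].
Proof.
have -> : sat r (codes c p m e) <->
    exists a, pairing a (eval r p : N) (eval r m) /\ pairing (eval r c : N) a (eval r e).
  by rewrite /codes /ex_named /=; split=> -[a h]; exists a; move: h; rewrite !eval_lift1.
split=> [[a [h h']]|[-> -> ->]]; last first.
  by exists (pj1 (eval r c)); split; apply: pj_pairing.
have [ea ee] := pairing_unique h' (pj_pairing _); move: h; rewrite ea => h.
by have [ep em] := pairing_unique h (pj_pairing _); split.
Qed.

Definition decode_env (G : ctx) (r : menv W G) (c : N) : menv W (T0 :: T0 :: T0 :: G) :=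
  mcons (M := W) (cden c : dom W T0) (mcons (M := W) (cneg c : dom W T0)
    (mcons (M := W) (cpos c : dom W T0) r)).

Definition decode_frac (G : ctx) : frac (T0 :: T0 :: T0 :: G) :=
  Frac (Var (VS (VS VZ))) (Var (VS VZ)) (App (App Plus (Var VZ)) One).

Lemma fok_decode (G : ctx) (r : menv W (T0 :: T0 :: T0 :: G)) : fok r (decode_frac G).
Proof.
rewrite /fok /= nq_plus nq1 gt_eqF //; have := nq_ge0 (r T0 VZ : N); lra.
Qed.

Lemma sat_decode (G : ctx) (r : menv W G) (c : term G T0) A :
  sat r (decode c A) <-> sat (decode_env r (eval r c)) (A (decode_frac G)).
Proof.
rewrite /decode /ex_named [sat r _]/=.
have codesE p m e : sat (mcons e (mcons m (mcons p r)))
   (codes (lift c) (lift (Var (VS (VS VZ)))) (lift (Var (VS VZ))) (lift (Var VZ))) <->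
   [/\ p = cpos (eval r c), m = cneg (eval r c) & e = cden (eval r c)].
  by rewrite sat_codes /= eval_ren.
split=> [[p [m [e [/codesE [-> -> ->] h]]]]|h]; first exact: h.
exists (cpos (eval r c)), (cneg (eval r c)), (cden (eval r c)); split; last exact: h.
exact/codesE.
Qed.

End Codes.

Lemma iff_forall (X : Type) (P Q : X -> Prop) :
  (forall x, P x <-> Q x) -> ((forall x, P x) <-> (forall x, Q x)).
Proof. by move=> h; split=> p x; apply/h. Qed.
Lemma iff_exists (X : Type) (P Q : X -> Prop) :
  (forall x, P x <-> Q x) -> ((exists x, P x) <-> (exists x, Q x)).
Proof. by move=> h; split=> -[x /h p]; exists x. Qed.

Section Reals.
Variable W : rca.
Notation N := (num W).
Notation Q := (ratf W).

Definition V (x : dom W T1) (n : N) : Q := val (ap x n : N).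

Definition isreal (x : dom W T1) : Prop :=
  forall n i : N, V x n - V x (n + i) < e2 n /\ V x (n + i) - V x n < e2 n.

Lemma fq_flift_decode (G H : ctx) (i : incl (T0 :: T0 :: T0 :: G) H) (e : menv W H) (c : N) :
  e T0 (i T0 (VS (VS VZ))) = cpos c -> e T0 (i T0 (VS VZ)) = cneg c ->
  e T0 (i T0 VZ) = cden c -> fq e (flift (decode_frac G)) = val c.
Proof. by move=> hp hm he; rewrite /fq /val /= nq_plus nq1 hp hm he. Qed.
Lemma fok_flift_decode (G H : ctx) (i : incl (T0 :: T0 :: T0 :: G) H) (e : menv W H) :
  fok e (flift (decode_frac G)).
Proof. exact: (fok_decode (fun t v => e t (i t v))). Qed.

Lemma sat_all (G : ctx) (r : menv W G) s A :
  sat r (all_named s A) = forall a, sat (mcons a r) (A (Var VZ)).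
Proof. by []. Qed.
Lemma sat_ex (G : ctx) (r : menv W G) s A :
  sat r (ex_named s A) = exists a, sat (mcons a r) (A (Var VZ)).
Proof. by []. Qed.
Lemma sat_and (G : ctx) (r : menv W G) A B : sat r (And A B) = (sat r A /\ sat r B).
Proof. by []. Qed.

Ltac fok_tac := repeat lazymatch goal with
  | |- is_true true => reflexivity
  | |- fok _ (flift (decode_frac _)) => apply fok_flift_decode
  | |- fok _ (eps _) => apply fok_eps
  | |- fok _ (eps' _) => apply fok_eps'
  | |- fok _ (fadd _ _) => apply fok_add
  | |- fok _ (fsub _ _) => apply fok_sub
  end.

Ltac fq_tac := repeat match goal with
  | |- context [@fq ?W ?H ?e (@flift ?K ?H ?i (decode_frac ?G))] =>
      let v := eval lazy beta delta [decode_env mcons vcons incl_skip incl_refl] iota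
        in (e T0 (i T0 VZ)) in
      match v with cden ?c =>
        rewrite (@fq_flift_decode G H i e c erefl erefl erefl)
      end
  end.

Ltac sat_tac :=
  rewrite !sat_decode ?sat_and !(sat_flt, sat_fle); fok_tac;
  rewrite ?(fq_add, fq_sub); fok_tac;
  rewrite ?(fq_add, fq_sub); fok_tac;
  rewrite ?fq_eps ?fq_eps'; fq_tac; rewrite /lift /= !eval_ren.

Definition eqreal (x y : dom W T1) : Prop :=
  forall n : N, V x n - V y n <= e2 n + e2 n /\ V y n - V x n <= e2 n + e2 n.
Definition ltreal (x y : dom W T1) : Prop :=
  exists n : N, V x n + (e2 n + e2 n) < V y n.
Definition lereal (x y : dom W T1) : Prop :=
  forall n : N, V x n <= V y n + (e2 n + e2 n).
Definition lt_addreal (x y z : dom W T1) : Prop :=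
  exists n : N, V x n + (e2 n + e2 n) < V y (n + 1) + V z (n + 1).
Definition sub_ltreal (y z x : dom W T1) : Prop :=
  exists n : N, V y (n + 1) - V z (n + 1) + (e2 n + e2 n) < V x n.
Definition rzero : dom W T1 := ap (mpi W T0 T0) (0 : N).
Definition rone : dom W T1 := ap (mpi W T0 T0) (1 : N).
Definition inunit (x : dom W T1) : Prop :=
  isreal x /\ lereal rzero x /\ lereal x rone.

Section Sat.
Variables (G : ctx) (r : menv W G).

Lemma sat_is_real (x : term G T1) : sat r (is_real x) <-> isreal (eval r x).
Proof.
rewrite /is_real sat_all /isreal; apply: iff_forall => n.
rewrite sat_all; apply: iff_forall => i.
sat_tac.
by [].
Qed.

Lemma sat_eqR (x y : term G T1) : sat r (eqR x y) <-> eqreal (eval r x) (eval r y).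
Proof. rewrite /eqR sat_all; apply: iff_forall => n; sat_tac; by []. Qed.

Lemma sat_ltR (x y : term G T1) : sat r (ltR x y) <-> ltreal (eval r x) (eval r y).
Proof. rewrite /ltR sat_ex; apply: iff_exists => n; sat_tac; by []. Qed.

Lemma sat_leR (x y : term G T1) : sat r (leR x y) <-> lereal (eval r x) (eval r y).
Proof. rewrite /leR sat_all; apply: iff_forall => n; sat_tac; by []. Qed.

Lemma sat_lt_addR (x y z : term G T1) :
  sat r (lt_addR x y z) <-> lt_addreal (eval r x) (eval r y) (eval r z).
Proof. rewrite /lt_addR sat_ex; apply: iff_exists => n; sat_tac; by []. Qed.

Lemma sat_sub_ltR (x y z : term G T1) :
  sat r (sub_ltR x y z) <-> sub_ltreal (eval r x) (eval r y) (eval r z).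
Proof. rewrite /sub_ltR sat_ex; apply: iff_exists => n; sat_tac; by []. Qed.

Lemma sat_in_unit (x : term G T1) : sat r (in_unit x) <-> inunit (eval r x).
Proof. by rewrite /in_unit !sat_and sat_is_real !sat_leR. Qed.

End Sat.
End Reals.

(** * Real numbers in a model *)

Section RealFacts.
Variable W : rca.
Notation N := (num W).
Notation Q := (ratf W).
Implicit Types (x y z l : dom W T1) (n m k c : N) (r d : Q).

Lemma nmax m n : exists k, m <=N k /\ n <=N k.
Proof. by exists (m + n); split; [|rewrite addrC]; apply: nleDr. Qed.

Lemma e2_small_above d m : 0 < d -> exists n, m <=N n /\ e2 n < d.
Proof.
move=> /e2_small [n h]; have [k [mk nk]] := nmax m n; exists k; split=> //.
exact: le_lt_trans (e2_le nk) h.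
Qed.

Lemma real_dist x m n : isreal x -> m <=N n ->
  V x m - V x n < e2 m /\ V x n - V x m < e2 m.
Proof. by move=> hx /nsub_ex [i <-]; apply: hx. Qed.

Lemma real_dist2 x m n : isreal x ->
  V x m - V x n < e2 m + e2 n /\ V x n - V x m < e2 m + e2 n.
Proof.
move=> hx; have em := e2_gt0 m; have en := e2_gt0 n.
have [h|h] : m <=N n \/ n <=N m.
  by have [|[|]] := nlt_total m n; [left; left|left; right|right; left].
  by have [] := real_dist hx h; split; lra.
by have [] := real_dist hx h; split; lra.
Qed.

(** |x - y| <= r for reals, with the slack that [eqR] allows at each index. *)
Definition dle x y r : Prop := forall n,
  V x n - V y n <= r + (e2 n + e2 n) /\ V y n - V x n <= r + (e2 n + e2 n).

Lemma dle_intro x y n r : isreal x -> isreal y ->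
  V x n - V y n <= r -> V y n - V x n <= r -> dle x y (r + (e2 n + e2 n)).
Proof.
move=> hx hy h h' m; have [] := real_dist2 m n hx; have [] := real_dist2 m n hy.
by split; lra.
Qed.

(* Letting the index tend to infinity makes the constant in front of [e2 n] irrelevant. *)
Lemma dle_relax x y r : isreal x -> isreal y ->
  (forall n, V x n - V y n <= r + 8%:R * e2 n /\ V y n - V x n <= r + 8%:R * e2 n) ->
  dle x y r.
Proof.
move=> hx hy h n.
suff : forall d, 0 < d -> V x n - V y n <= r + (e2 n + e2 n) + d /\
    V y n - V x n <= r + (e2 n + e2 n) + d.
  by move=> k; split; apply/ler_addgt0Pr => d /k [].
(* Moving from index n to m costs the two [e2 n] that [dle] grants anyway; the remaining 8 [e2 m]
   must stay below d. *)
move=> d d0; have [|m [nm hm]] := @e2_small_above (d / 8%:R) n; first lra.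
have [] := real_dist hx nm; have [] := real_dist hy nm; have [] := h m.
by move=> *; split; lra.
Qed.

(* |x - y| < z for reals, witnessed by rational approximations. *)
Definition near x y z : Prop := exists n m,
  V x n - V y n + (e2 n + e2 n) + e2 m < V z m /\ V y n - V x n + (e2 n + e2 n) + e2 m < V z m.

Lemma near_dle x y z : isreal x -> isreal y -> near x y z ->
  exists r m, dle x y r /\ r + e2 m < V z m.
Proof.
move=> hx hy [n [m [h h']]].
exists (Num.max (V x n - V y n) (V y n - V x n) + (e2 n + e2 n)), m; split.
  by apply: dle_intro => //; rewrite le_max lexx ?orbT.
by rewrite /Num.max; case: ifP.
Qed.

Lemma near_intro x y z r m : dle x y r -> r + e2 m < V z m -> near x y z.
Proof.
move=> h hm; have [|n hn] := @e2_small W ((V z m - e2 m - r) / 8%:R); first lra.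
have := e2_gt0 n; have [] := h n; exists n, m; split; lra.
Qed.

Lemma near_interval x y z : isreal x -> isreal y -> isreal z -> near x y z ->
  sub_ltreal y z x /\ lt_addreal x y z.
Proof.
move=> hx hy hz /(near_dle hx hy) [r [m [h hm]]].
have [|n [mn hn]] := @e2_small_above ((V z m - e2 m - r) / 8%:R) m; first lra.
have [] := h n; have [] := hy n 1.
have [] := real_dist hz (nle_trans mn (nleDr n 1)) => *.
have := e2_gt0 n => *.
by split; exists n; lra.
Qed.

Definition cst (c : N) : dom W T1 := ap (mpi W T0 T0) c.

Lemma V_cst c n : V (cst c) n = val c.
Proof. by rewrite /V /cst piE. Qed.

Lemma isreal_cst c : isreal (cst c).
Proof. by move=> n i; rewrite !V_cst; have := e2_gt0 n; split; lra. Qed.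

Lemma rep_cst G (f : tup W G -> N) : rep (t := T0) f -> rep (t := T1) (fun e => cst (f e)).
Proof. by rewrite /cst => rf; solve_rep. Qed.

(** Truncation to [0,1] on codes. It lets every number name a rational point of the unit
    interval. *)
Lemma clamp_fun : exists F : dom W T1, forall c : N,
  [\/ val c <= 0 /\ val (ap F c : N) = 0, 1 <= val c /\ val (ap F c : N) = 1 |
      0 <= val c <= 1 /\ val (ap F c : N) = val c].
Proof.
have [|F FE] := @rep_fun1 W T0 T0 (fun c : N =>
  cond (cpos c <=N cneg c) 0 (cond (cneg c + (cden c + 1) <=N cpos c) 1 c)).
  rewrite /cpos /cneg /cden /pj1 /pj2; solve_rep.
have valE c : [/\ val c <= 0 <-> cpos c <=N cneg c &
    1 <= val c <-> cneg c + (cden c + 1) <=N cpos c].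
  have d0 : 0 < nq (cden c) + 1 by have := nq_ge0 (cden c); lra.
  rewrite -!nq_le !nqD nq1 /val ler_pdivrMr // ler_pdivlMr // mul0r mul1r.
  by split; split=> h; lra.
exists F => c; have [h0 h1] := valE c; rewrite FE.
have [p0|p0] := EM (cpos c <=N cneg c).
  by constructor 1; rewrite condT //; split; [apply/h0|apply: val_0].
rewrite condF //; have [p1|p1] := EM (cneg c + (cden c + 1) <=N cpos c).
  by constructor 2; rewrite condT //; split; [apply/h1|apply: val_1].
rewrite condF //; constructor 3; split=> //.
by apply/andP; split; apply: ltW; rewrite ltNge; apply/negP => h;
  first [apply: p0; exact/h0|apply: p1; exact/h1].
Qed.

Definition clampF : dom W T1 := projT1 (cid clamp_fun).
Definition clamp (c : N) : N := ap clampF c.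

Lemma clampP c : [\/ val c <= 0 /\ val (clamp c) = 0, 1 <= val c /\ val (clamp c) = 1 |
      0 <= val c <= 1 /\ val (clamp c) = val c].
Proof. exact: (projT2 (cid clamp_fun)). Qed.

Lemma clamp_unit c : 0 <= val (clamp c) <= 1.
Proof. by case: (clampP c) => -[? ->]; rewrite ?lexx ?ler01. Qed.

Lemma clamp_lipschitz c c' d : val c - val c' < d -> val c' - val c < d ->
  val (clamp c) - val (clamp c') < d /\ val (clamp c') - val (clamp c) < d.
Proof.
move=> h h'; case: (clampP c) => -[hc ->]; case: (clampP c') => -[hc' ->];
  try (case/andP: hc => ? ?); try (case/andP: hc' => ? ?); split; lra.
Qed.

Lemma V_rzero n : V (rzero W) n = 0.
Proof. by rewrite /V /rzero piE; apply: val_0. Qed.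
Lemma V_rone n : V (rone W) n = 1.
Proof. by rewrite /V /rone piE; apply: val_1. Qed.

Lemma clamp_unit_dist x n : inunit x ->
  V x n - val (clamp (ap x n : N)) <= e2 n + e2 n /\
  val (clamp (ap x n : N)) - V x n <= e2 n + e2 n.
Proof.
move=> [_ [/(_ n) h0 /(_ n) h1]]; move: h0 h1; rewrite V_rzero V_rone /V => h0 h1.
have := e2_gt0 n; case: (clampP (ap x n : N)) => -[h ->]; first by split; lra.
  by split; lra.
by case/andP: h => *; split; lra.
Qed.

Lemma inunit_V x : isreal x -> (forall n, 0 <= V x n <= 1) -> inunit x.
Proof.
move=> hx h; split=> //; split=> n; rewrite ?V_rzero ?V_rone; have := e2_gt0 n;
  by case/andP: (h n) => *; lra.
Qed.

Lemma inunit_clamp c : inunit (cst (clamp c)).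
Proof. by apply: inunit_V (isreal_cst _) _ => n; rewrite V_cst; apply: clamp_unit. Qed.

(** The field of rationals lies outside the model. A rational-valued function counts as represented
    when it is a fraction of represented numerical functions, so that comparisons reduce to
    decidable ones between numbers. *)
Definition ratrep (G : ctx) (q : tup W G -> Q) : Prop :=
  exists a b c : tup W G -> N, [/\ rep (t := T0) a, rep (t := T0) b, rep (t := T0) c &
    forall e, q e = (nq (a e) - nq (b e)) / nq (c e) /\ 0 < nq (c e)].

Section RatRep.
Variable G : ctx.
Implicit Types q s : tup W G -> Q.

Lemma ratrep_val (f : tup W G -> N) : rep (t := T0) f -> ratrep (fun e => val (f e)).
Proof.
move=> rf; exists (fun e => cpos (f e)), (fun e => cneg (f e)), (fun e => cden (f e) + 1).
rewrite /cpos /cneg /cden /pj1 /pj2; split; [solve_rep|solve_rep|solve_rep|] => e.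
rewrite nqD nq1; split=> //; have := nq_ge0 (cden (f e)); rewrite /cden /pj2; lra.
Qed.

Lemma ratrep_V (f : tup W G -> dom W T1) (g : tup W G -> N) :
  rep f -> rep (t := T0) g -> ratrep (fun e => V (f e) (g e)).
Proof. by move=> rf rg; apply: ratrep_val; solve_rep. Qed.

Lemma ratrep_const (a : Q) : ratrep (fun _ : tup W G => a).
Proof.
have [c <-] := val_surj a; apply: (ratrep_val (f := fun=> c)).
exact: (@rep_const W _ T0).
Qed.

Lemma ratrep_e2 (f : tup W G -> N) : rep (t := T0) f -> ratrep (fun e => e2 (f e)).
Proof.
move=> rf; exists (fun=> 1), (fun=> 0), (fun e => p2 (f e)).
split; [exact: (@rep_const W _ T0)|exact: (@rep_const W _ T0)|rewrite /p2; solve_rep|].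
by move=> e; rewrite nq0 nq1 subr0 mul1r; split=> //; apply: p2_qgt0.
Qed.

Lemma ratrep_add q s : ratrep q -> ratrep s -> ratrep (fun e => q e + s e).
Proof.
move=> [a [b [c [ra rb rc qE]]]] [a' [b' [c' [ra' rb' rc' sE]]]].
exists (fun e => a e * c' e + a' e * c e), (fun e => b e * c' e + b' e * c e),
  (fun e => c e * c' e); split; [solve_rep|solve_rep|solve_rep|] => e.
have [-> h] := qE e; have [-> h'] := sE e; rewrite !(nqD, nqM); split.
  by field; rewrite !gt_eqF.
exact: mulr_gt0.
Qed.

Lemma ratrep_opp q : ratrep q -> ratrep (fun e => - q e).
Proof.
move=> [a [b [c [ra rb rc qE]]]]; exists b, a, c; split=> // e.
by have [-> h] := qE e; rewrite -mulNr opprB.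
Qed.

Lemma dec_qlt q s : ratrep q -> ratrep s -> dec (fun e => q e < s e).
Proof.
move=> [a [b [c [ra rb rc qE]]]] [a' [b' [c' [ra' rb' rc' sE]]]].
have d : dec (fun e => a e * c' e + b' e * c e <N a' e * c e + b e * c' e) by solve_rep.
apply: dec_iff d => e; rewrite -nq_lt.
have [-> h] := qE e; have [-> h'] := sE e; rewrite !(nqD, nqM).
rewrite ltr_pdivrMr // mulrAC ltr_pdivlMr //.
by split=> k; lra.
Qed.

Lemma dec_qle q s : ratrep q -> ratrep s -> dec (fun e => q e <= s e).
Proof.
move=> rq rs; apply: dec_iff (dec_not (dec_qlt rs rq)) => e.
by rewrite leNgt; split=> [/negP|/negP].
Qed.

End RatRep.

(** Kleene's functional E^2, in the model. *)
Definition has_E2 : Prop :=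
  exists E : dom W T2, forall f, ap E f = ind W (exists n : N, ap f n = 1 :> N).

(** * Arithmetical comprehension from E^2 *)

Section Comprehension.
Hypothesis E2 : has_E2.

Lemma dec_ex (G : ctx) (P : tup W G -> N -> Prop) :
  dec (G := T0 :: G) (fun e : tup W (T0 :: G) => P e.2 e.1) -> dec (fun e => exists n, P e n).
Proof.
move=> /rep_lam [F [rF FE]]; have [E EE] := E2.
have : rep (fun e : tup W G => ap E (F e)) by solve_rep.
apply: rep_ext => e; rewrite EE; apply: ind_iff; split=> -[n h]; exists n.
  by move: h; rewrite FE => /indP.
by rewrite FE; apply/indP.
Qed.

Lemma dec_all (G : ctx) (P : tup W G -> N -> Prop) :
  dec (G := T0 :: G) (fun e : tup W (T0 :: G) => P e.2 e.1) -> dec (fun e => forall n, P e n).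
Proof.
move=> dP; have dE := dec_ex (P := fun e n => ~ P e n) (dec_not dP).
apply: dec_iff (dec_not dE) => e; split=> [h n|h [n nP]]; last exact: nP (h n).
by apply: contrapT => nP; apply: h; exists n.
Qed.

End Comprehension.

End RealFacts.

Ltac rep_hook ::= lazymatch goal with
  | |- rep (fun e => pr (@?f e) (@?g e)) => refine (rep_pr (f := f) (g := g) _ _)
  | |- rep (fun e => pj1 (@?f e)) => refine (rep_pj1 (f := f) _)
  | |- rep (fun e => pj2 (@?f e)) => refine (rep_pj2 (f := f) _)
  | |- rep (fun e => cst (@?f e)) => refine (rep_cst (f := f) _)
  | |- rep (fun e => clamp (@?f e)) =>
      refine (rep_app (f := fun=> clampF _) (g := f) (rep_const _ _) _)
  | |- ratrep (fun e => V (@?f e) (@?g e)) => refine (ratrep_V (f := f) (g := g) _ _)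
  | |- ratrep (fun e => val (@?f e)) => refine (ratrep_val (f := f) _)
  | |- ratrep (fun e => e2 (@?f e)) => refine (ratrep_e2 (f := f) _)
  | |- ratrep (fun e => @GRing.add _ (@?q e) (@?s e)) =>
      refine (ratrep_add (q := q) (s := s) _ _)
  | |- ratrep (fun e => @GRing.opp _ (@?q e)) => refine (ratrep_opp (q := q) _)
  | |- ratrep _ => exact (ratrep_const _ _)
  | |- dec (fun e => is_true (@Order.lt _ _ (@?q e) (@?s e))) =>
      refine (dec_qlt (q := q) (s := s) _ _)
  | |- dec (fun e => is_true (@Order.le _ _ (@?q e) (@?s e))) =>
      refine (dec_qle (q := q) (s := s) _ _)
  | E : has_E2 _ |- dec (fun e => exists n, @?P e n) => refine (dec_ex E (P := P) _)
  | E : has_E2 _ |- dec (fun e => forall n : num _, @?P e n) => refine (dec_all E (P := P) _)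
  end; cbv beta.

(** * Nets in a model *)

Section Nets.
Variable W : rca.
Notation N := (num W).
Notation Q := (ratf W).

Definition memP (D : dom W T2) (f : dom W T1) : Prop := ap D f = 1 :> N.
Definition relP (R : dom W (T1 ~> T1 ~> T0)) (f g : dom W T1) : Prop :=
  ap (ap R f) g = 1 :> N.

Definition directedP (D : dom W T2) (R : dom W (T1 ~> T1 ~> T0)) : Prop :=
  (forall f, (ap D f : N) <=N 1) /\
  (exists f, memP D f) /\
  (forall f, memP D f -> relP R f f) /\
  (forall f g h, memP D f /\ memP D g /\ memP D h -> relP R f g /\ relP R g h -> relP R f h) /\
  (forall f g, memP D f /\ memP D g -> exists h, memP D h /\ relP R f h /\ relP R g h).

Definition netP D R (X : dom W (T1 ~> T1)) : Prop :=
  directedP D R /\ forall d, memP D d -> inunit (ap X d).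

Definition subnetP B S (Y : dom W (T1 ~> T1)) D R (X : dom W (T1 ~> T1)) : Prop :=
  exists phi : dom W (T1 ~> T1),
    (forall b, memP B b -> memP D (ap phi b) /\ eqreal (ap Y b) (ap X (ap phi b))) /\
    (forall d, memP D d -> exists b0, memP B b0 /\
       forall b, memP B b /\ relP S b0 b -> relP R d (ap phi b)).

Definition convergesP D R (X : dom W (T1 ~> T1)) l : Prop :=
  forall p q, isreal p /\ isreal q -> ltreal p l /\ ltreal l q ->
    exists d, memP D d /\ forall e, memP D e /\ relP R d e ->
      ltreal p (ap X e) /\ ltreal (ap X e) q.

Lemma BW_netP : sat (mnil W) BW_net -> forall D R X, netP D R X ->
  exists B S Y, netP B S Y /\ subnetP B S Y D R X /\ exists l, inunit l /\ convergesP B S Y l.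
Proof.
move=> bw D R X [dD hX]; have {bw} := bw D R X.
case=> [|B [S [Y [[dB hY] [[phi [h1 h2]] [l [hl hc]]]]]]].
  by split=> // d Dd; apply/sat_in_unit; apply: hX.
exists B, S, Y; split; first by split=> // d Bd; move/sat_in_unit: (hY d Bd).
split.
  exists phi; split=> // b Bb; have [Db eb] := h1 b Bb; split=> //.
  by move/sat_eqR: eb.
exists l; split; first by move/sat_in_unit: hl.
move=> p q [hp hq] [pl lq].
have [||d [Bd hd]] := hc p q.
- by split; apply/sat_is_real.
- by split; apply/sat_ltR.
exists d; split=> // e ed; have [he he'] := hd e ed.
by split; [move/sat_ltR: he|move/sat_ltR: he'].
Qed.

Definition posfun (Psi : dom W (T1 ~> T1)) : Prop :=
  (forall x, isreal x -> isreal (ap Psi x) /\ ltreal (rzero W) (ap Psi x)) /\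
  (forall x y, isreal x /\ isreal y -> eqreal x y -> eqreal (ap Psi x) (ap Psi y)).

(** HBU is reduced to covering by [near], which implies membership in the open interval and depends
    on rational approximations alone. *)
Lemma HBUP :
  (forall Psi, posfun Psi -> exists (k : N) (y : dom W (T0 ~> T1)),
     (forall i : N, i <N k -> inunit (ap y i)) /\
     (forall x, inunit x -> exists i : N, i <N k /\
        near x (ap y i) (ap Psi (ap y i)))) ->
  sat (mnil W) HBU.
Proof.
move=> h Psi [hp he].
have pPsi : posfun Psi.
  split=> [x xr|x y [xr yr] xy].
    have [|hx hx'] := hp x; first by apply/sat_is_real.
    by split; [move/sat_is_real: hx|move/sat_ltR: hx'].
  have xyr : sat (mcons y (mcons x (mcons Psi (mnil W))))
      (And (is_real (Var (VS VZ))) (is_real (Var VZ))) by split; apply/sat_is_real.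
  have exy : sat (mcons y (mcons x (mcons Psi (mnil W)))) (eqR (Var (VS VZ)) (Var VZ)).
    exact/sat_eqR.
  by have /sat_eqR := he x y xyr exy.
have [k [y [hy hx]]] := h Psi pPsi; exists k, y; split.
  by move=> i ik; apply/sat_in_unit; apply: hy.
move=> x /sat_in_unit xu; have [i [ik /near_interval hn]] := hx x xu; exists i; split=> //.
have [ry _] := hy i ik; have [rx _] := xu; have [rP _] := pPsi.1 _ ry.
have [h1 h2] := hn rx ry rP.
by split; [apply/sat_sub_ltR|apply/sat_lt_addR].
Qed.

Lemma dle_V_cst x c (r : Q) n : V x n - val c <= r -> val c - V x n <= r -> isreal x ->
  dle x (cst c) (r + (e2 n + e2 n)).
Proof.
move=> h h' hx; apply: dle_intro => //; rewrite ?V_cst //; exact: isreal_cst.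
Qed.

(** The endpoints are the rationals at distance 2 [e2 k] from the k-th approximation of [l]. That
    approximation is within [e2 k] of [l], which gives the factor 3. *)
Lemma interval_around l k : isreal l ->
  exists p q : dom W T1, [/\ isreal p /\ isreal q, ltreal p l /\ ltreal l q &
   forall y z, isreal y -> isreal z -> ltreal p y /\ ltreal y q -> eqreal y z ->
     dle z l (3%:R * e2 k)].
Proof.
move=> hl.
have [p pE] := val_surj (V l k - 2%:R * e2 k); have [q qE] := val_surj (V l k + 2%:R * e2 k).
have s1 := e2S k; have s2 := e2S (k + 1).
have kn : k <=N (k + 1 + 1) by apply: nle_trans (nleDr k 1) (nleDr _ 1).
have [d1 d2] := real_dist hl kn.
have ek := e2_gt0 k.
exists (cst p), (cst q); split.
- by split; apply: isreal_cst.
- by split; exists (k + 1 + 1); rewrite V_cst ?pE ?qE; lra.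
move=> y z hy hz [[n hn] [m hm]] yz; apply: dle_relax => // j.
move: hn hm; rewrite !V_cst pE qE.
have [] := yz j; have [] := real_dist2 n j hy; have [] := real_dist2 m j hy.
have [] := real_dist2 k j hl; have := e2_gt0 j; have := e2_gt0 n; have := e2_gt0 m.
by move=> *; split; lra.
Qed.

(** The form in which BW_net is used: the limit of a convergent sub-net is a cluster point of the
    net. Given [d0], an index of the sub-net above both the one that forces [phi b] beyond [d0] and
    the one that forces closeness to [l] provides [d]. *)
Lemma cluster_point (DP : dom W T1 -> Prop) (RP : dom W T1 -> dom W T1 -> Prop)
    (X : dom W (T1 ~> T1)) : sat (mnil W) BW_net ->
  dec (G := [:: T1]) (fun e : tup W [:: T1] => DP e.1) ->
  dec (G := [:: T1; T1]) (fun e : tup W [:: T1; T1] => RP e.2.1 e.1) ->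
  (exists d, DP d) -> (forall d, DP d -> RP d d) ->
  (forall d e f, DP d -> DP e -> DP f -> RP d e -> RP e f -> RP d f) ->
  (forall d e, DP d -> DP e -> exists f, [/\ DP f, RP d f & RP e f]) ->
  (forall d, DP d -> inunit (ap X d)) ->
  exists l, inunit l /\ forall d0, DP d0 -> forall k,
    exists d, [/\ DP d, RP d0 d & dle (ap X d) l (3%:R * e2 k)].
Proof.
move=> bw /(rep_fun1 (f := fun d => ind W (DP d) : dom W T0)) [D DE].
move=> /(rep_fun2 (f := fun d e => ind W (RP d e) : dom W T0)) [R RE] ne refl trans dir hX.
have memE d : memP D d <-> DP d by rewrite /memP DE; apply: indP.
have relE d e : relP R d e <-> RP d e by rewrite /relP RE; apply: indP.
have net : netP D R X.
  split; last by move=> d /memE; apply: hX.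
  split; first by move=> f; rewrite DE /ind; case: pselect => h; [right|left; apply: nlt01].
  split; first by have [d Dd] := ne; exists d; apply/memE.
  split; first by move=> f /memE Df; apply/relE; apply: refl.
  split.
    move=> f g h [/memE Df [/memE Dg /memE Dh]] [/relE fg /relE gh].
    by apply/relE; apply: trans fg gh.
  move=> f g [/memE Df /memE Dg]; have [h [Dh fh gh]] := dir f g Df Dg.
  by exists h; split; [apply/memE|split; apply/relE].
have [B [S [Y [[[_ [_ [_ [_ dirB]]]] hY] [[phi [h1 h2]] [l [hl hc]]]]]]] := BW_netP bw net.
exists l; split=> // d0 /memE Dd0 k.
have [p [q [pq plq hpq]]] := interval_around k (proj1 hl).
have [b1 [Bb1 hb1]] := hc p q pq plq.
have [b0 [Bb0 hb0]] := h2 d0 Dd0.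
have [b [Bb [b0b b1b]]] := dirB b0 b1 (conj Bb0 Bb1).
have [/memE Dphi eb] := h1 b Bb.
exists (ap phi b); split=> //.
  by apply/relE; apply: hb0.
apply: hpq eb; [by case: (hY b Bb)|by case: (hX _ Dphi)|exact: hb1].
Qed.

End Nets.

(** * Covering the unit interval *)

Section Cover.
Variable W : rca.
Notation N := (num W).
Notation Q := (ratf W).
Hypothesis bw : sat (mnil W) BW_net.
Variable Psi : dom W (T1 ~> T1).
Hypothesis pPsi : posfun Psi.
Hypothesis no_cover : forall (k : N) (y : dom W (T0 ~> T1)),
  (forall i : N, i <N k -> inunit (ap y i)) ->
  exists x, inunit x /\ forall i : N, i <N k -> ~ near x (ap y i) (ap Psi (ap y i)).

Definition center (c : N) : dom W T1 := cst (clamp c).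
Definition radius (c : N) : dom W T1 := ap Psi (center c).

(** * First case: the rational centers cover the unit interval *)

Section RationalCenters.
Hypothesis rational_cover : forall l, inunit l -> exists c, near l (center c) (radius c).

(* [d] codes a pair (n, z): the point [z] avoids the first [n] of the intervals with rational
   centers, approximated from inside with a margin that vanishes as [n] grows. *)
Definition avoids (d : dom W T1) : Prop := forall j : N, j <N ap d (0 : N) ->
  ~ (val (clamp (ap d (1 : N))) - val (clamp (pj1 j)) + e2 (pj2 j) +
       (e2 (ap d (0 : N)) + e2 (ap d (0 : N)) + (e2 (ap d (0 : N)) + e2 (ap d (0 : N))))
       < V (radius (pj1 j)) (pj2 j) /\
     val (clamp (pj1 j)) - val (clamp (ap d (1 : N))) + e2 (pj2 j) +
       (e2 (ap d (0 : N)) + e2 (ap d (0 : N)) + (e2 (ap d (0 : N)) + e2 (ap d (0 : N))))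
       < V (radius (pj1 j)) (pj2 j)).

Lemma dec_avoids : dec (G := [:: T1]) (fun e : tup W [:: T1] => avoids e.1).
Proof.
rewrite /avoids /radius /center.
refine (dec_ball (f := fun e : tup W [:: T1] => ap e.1 (0 : N)) (P := fun j e => ~ _) _ _).
  solve_rep.
solve_rep.
Qed.

(** Take a real outside the intervals around the centers of the codes j < n and clamp its n-th
    approximation. Half of the margin 4 [e2 n] pays for the approximation, half for clamping. *)
Lemma avoids_ex (n : N) : exists2 d, avoids d & ap d (0 : N) = n.
Proof.
have [|y yE] := @rep_fun1 W T0 T1 (fun j => center (pj1 (j : N))).
  by rewrite /center; solve_rep.
have [|x [hx hn]] := no_cover (k := n) (y := y).
  by move=> i _; rewrite yE; apply: inunit_clamp.
have [P PE] := pair_fun W; have [d0 d1] := PE n (ap x n : N).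
exists (ap (ap P n) (ap x n)) => // j; rewrite d0 d1 => jn [h h'].
apply: (hn j jn); rewrite yE.
set c := pj1 j in h h' *; set z := clamp (ap x n : N) in h h'.
pose r := Num.max (val z - val (clamp c)) (val (clamp c) - val z).
have r1 : val z - val (clamp c) <= r by rewrite le_max lexx.
have r2 : val (clamp c) - val z <= r by rewrite le_max lexx orbT.
have [u1 u2] := clamp_unit_dist n hx.
apply: (near_intro (r := r + (e2 n + e2 n) + (e2 n + e2 n)) (m := pj2 j)).
  by apply: dle_V_cst; [rewrite -/z in u1 u2; lra|rewrite -/z in u1 u2; lra|case: hx].
by rewrite -/(radius c) /r /Num.max; case: ifP; lra.
Qed.

Lemma rational_centers_absurd : False.
Proof.
have [|X XE] := @rep_fun1 W T1 T1 (fun d => center (ap d (1 : N))).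
  by rewrite /center; solve_rep.
have [|||||||l [hl hc]] := cluster_point
  (DP := avoids) (RP := fun d e => (ap d (0 : N) : N) <=N ap e (0 : N)) (X := X) bw.
- exact: dec_avoids.
- solve_rep.
- by have [d hd _] := avoids_ex 0; exists d.
- by move=> d _; right.
- by move=> d e f _ _ _; apply: nle_trans.
- move=> d e _ _; have [n [h h']] := nmax (ap d (0 : N) : N) (ap e (0 : N)).
  by have [f hf fn] := avoids_ex n; exists f; rewrite fn.
- by move=> d _; rewrite XE; apply: inunit_clamp.
have [c nc] := rational_cover hl.
have [r [m [hr hm]]] := near_dle (proj1 hl) (isreal_cst _) nc.
(* The slack of [l] inside the interval around [c]. The errors below amount to at most 3 [e2 K] + 8
   [e2 n], so bounds of [dl / 16] suffice. *)
pose dl := V (radius c) m - (r + e2 m).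
have dl0 : 0 < dl / 16%:R by rewrite /dl; lra.
have [K hK] := e2_small dl0.
(* The code [pr c m] of this interval lies below n, so every index beyond [d0] has to avoid it. *)
have [n [jn hn]] := e2_small_above (pr c m + 1) dl0.
have [d0 hd0 d0n] := avoids_ex n.
have [d [hd d0d hdl]] := hc d0 hd0 K.
have dj : pr c m <N ap d (0 : N).
  apply: nlt_le_trans d0d; rewrite d0n; apply: nlt_le_trans jn; exact: nltS.
apply: (hd _ dj); rewrite pj1K pj2K.
have hn' : e2 (ap d (0 : N) : N) <= e2 n by apply: e2_le; rewrite -d0n.
have [] := hdl n; have [] := hr n; rewrite XE !V_cst.
move: dl0 hK hn; rewrite /dl; move: hn'; have := e2_gt0 n; have := e2_gt0 K => *.
by split; lra.
Qed.

End RationalCenters.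

(** * Second case: E^2 by Grilliot's trick at an uncovered point *)

Section Discontinuity.
Variable x0 : dom W T1.
Hypothesis ux0 : inunit x0.
Hypothesis no_center : forall c, ~ near x0 (center c) (radius c).

Let u (n : N) : N := clamp (ap x0 n : N).

Lemma u_dist (m n : N) : m <=N n -> val (u m) - val (u n) < e2 m /\ val (u n) - val (u m) < e2 m.
Proof.
by move=> mn; have [h h'] := real_dist (proj1 ux0) mn; apply: clamp_lipschitz.
Qed.

(* Grilliot's trick: the reals [ap S f] equal [x0] if [f] never takes the value 1, and
   otherwise one of the rational centers, where [Psi] is small. *)
Lemma stop_fun (s : N) : exists S : dom W (T1 ~> T1), forall f n,
  V (ap S f) n = val (u (s + bmin (fun m => ap f m = 1 :> N) n)).
Proof.
have [|S SE] := @rep_fun2 W T1 T0 T0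
  (fun f n => u (s + bmin (fun m => ap f m = 1 :> N) (n : N))).
  rewrite /u.
  have : rep (G := [:: T0; T1]) (t := T0)
      (fun e : tup W [:: T0; T1] => bmin (fun m => ap e.2.1 m = 1 :> N) (e.1 : N)).
    apply: (rep_bmin (P := fun m (e : tup W [:: T0; T1]) => ap e.2.1 m = 1 :> N)); solve_rep.
  by move=> rb; solve_rep.
by exists S => f n; rewrite /V SE.
Qed.

Lemma stop_bmin (f : dom W T1) (n : N) :
  is_bmin (fun m => ap f m = 1 :> N) n (bmin (fun m => ap f m = 1 :> N) n).
Proof.
apply: (bminP (G := [:: T1]) (P := fun m (e : tup W [:: T1]) => ap e.1 m = 1 :> N) _ (f, tt)).
solve_rep.
Qed.

(** At index [s], the value of Psi at [ap S f] exceeds 14 [e2 s] if f never takes the value 1 and is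
    at most 7 [e2 s] otherwise. Comparing this rational approximation with 10 [e2 s] decides which
    case holds. *)
Lemma E2_of_discontinuity : has_E2 W.
Proof.
have [|x1 x1E] := @rep_fun1 W T0 T0 (fun n => u n).
  by rewrite /u; solve_rep.
have V1 n : V x1 n = val (u n) by rewrite /V x1E.
have r1 : isreal x1 by move=> n i; rewrite !V1; apply: u_dist; apply: nleDr.
have [_ [a ha]] := pPsi.1 _ r1; rewrite V_rzero in ha.
(* Positivity gives more than 2 [e2 a] = 32 [e2 s] at index [a]; passing to index [s] loses 16
   [e2 s] and equality of reals another 2, which leaves 14. *)
pose s : N := a + 1 + 1 + 1 + 1.
have ea : e2 a = 16%:R * e2 s.
  by rewrite (e2S a) (e2S (a + 1)) (e2S (a + 1 + 1)) (e2S (a + 1 + 1 + 1)) -/s; lra.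
have [S SE] := stop_fun s.
have rS f : isreal (ap S f).
  move=> n i; rewrite !SE.
  have [le st mi] := stop_bmin f n; have [le' st' mi'] := stop_bmin f (n + i).
  set b := bmin _ n in le st mi *; set b' := bmin _ (n + i) in le' st' mi' *.
  have en := e2_gt0 n.
  (* Either the search has already succeeded and its result no longer changes, or both
     approximations of [x0] have index at least n. *)
  have [bn|bn] := le.
    suff -> : b' = b by split; lra.
    have [h|[//|h]] := nlt_total b' b.
      by case: (mi _ h); apply: st'; apply: nlt_le_trans (nlt_trans h bn) (nleDr n i).
    by case: (mi' _ h); apply: st.
  have bb' : b <=N b'.
    apply/nlt_neg => h; apply: (mi _ h); apply: st'.
    by apply: nlt_le_trans h _; rewrite bn; apply: nleDr.
  have sbb : s + b <=N s + b' by rewrite ![s + _]addrC; apply: nle_add2r.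
  have sn : e2 (s + b) <= e2 n by apply: e2_le; rewrite bn addrC; apply: nleDr.
  by have [] := u_dist sbb; split; lra.
have rPS f := (pPsi.1 _ (rS f)).1.
have es := e2_gt0 s.
have high f : (forall n : N, ap f n <> 1 :> N) -> 14%:R * e2 s < V (ap Psi (ap S f)) s.
  move=> nf; have : eqreal x1 (ap S f).
    move=> n; rewrite V1 SE; have [le st _] := stop_bmin f n.
    have -> : bmin (fun m => ap f m = 1 :> N) n = n by case: le => // /st /nf.
    have ns : n <=N s + n by rewrite addrC; apply: nleDr.
    by have [] := u_dist ns; have := e2_gt0 n; split; lra.
  move=> /(pPsi.2 _ _ (conj r1 (rS f))) /(_ s) [h _].
  have as_ : a <=N s by do 4 (apply: nle_trans (nleDr _ 1)); right.
  by have [] := real_dist (pPsi.1 _ r1).1 as_; lra.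
have low f (n : N) : ap f n = 1 :> N -> V (ap Psi (ap S f)) s <= 7%:R * e2 s.
  move=> fn; have [le st mi] := stop_bmin f (n + 1).
  set m := bmin _ _ in le st mi.
  have fm : ap f m = 1 :> N.
    apply: st; case: le => // e; case: (mi n) => //; rewrite e; exact: nltS.
  pose c : N := ap x0 (s + m).
  have eS : eqreal (ap S f) (center c).
    move=> k; rewrite SE V_cst; have [le' st' mi'] := stop_bmin f k.
    set b := bmin _ k in le' st' mi' *.
    have ek := e2_gt0 k; rewrite -/(u (s + m)).
    have [h|[->|h]] := nlt_total b m; [|by split; lra|by case: (mi' _ h)].
    have bk : b = k by case: le' => // /st' fb; case: (mi _ h).
    have sbm : s + b <=N s + m by rewrite ![s + _]addrC; left; apply: nlt_add2r.
    have sk : e2 (s + b) <= e2 k by apply: e2_le; rewrite bk addrC; apply: nleDr.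
    by have [] := u_dist sbm; split; lra.
  (* The center is within 4 [e2 (s + m)] of [x0], and its interval omits [x0]. The radius is thus at
     most 5 [e2 s] at index [s], and equality of reals adds 2. *)
  have [d1 d2] := clamp_unit_dist (s + m) ux0.
  have dc : dle x0 (center c) (e2 (s + m) + e2 (s + m) + (e2 (s + m) + e2 (s + m))).
    exact: dle_V_cst d1 d2 (proj1 ux0).
  have sm : e2 (s + m) <= e2 s by apply: e2_le; apply: nleDr.
  have [h'|h'] := ltP (e2 (s + m) + e2 (s + m) + (e2 (s + m) + e2 (s + m)) + e2 s) (V (radius c) s).
    by case: (@no_center c); apply: near_intro dc h'.
  by have [h1 h2] := pPsi.2 _ _ (conj (rS f) (isreal_cst _)) eS s; rewrite /radius in h'; lra.
have d : dec (G := [:: T1]) (fun e : tup W [:: T1] => V (ap Psi (ap S e.1)) s <= 10%:R * e2 s).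
  solve_rep.
have [E EE] := @rep_fun1 W T1 T0 (fun f => ind W (V (ap Psi (ap S f)) s <= 10%:R * e2 s)) d.
exists E => f; rewrite EE; apply: ind_iff; split=> [h|[n fn]].
  apply: contrapT => nf; suff : 14%:R * e2 s < V (ap Psi (ap S f)) s by lra.
  by apply: high => n fn; apply: nf; exists n.
by have := low f n fn; lra.
Qed.

End Discontinuity.

(** * Second case continued: the net of uncovered sequences *)

Section Sequences.
Hypothesis E2 : has_E2 W.

Lemma monus_fun : exists F : dom W (T0 ~> T0 ~> T0), forall k z : N,
  ap (ap F k) (k + z) = z :> N.
Proof.
have [|F FE] := @rep_fun2 W T0 T0 T0
  (fun k i => bmin (fun z => i <=N (k : N) + z) ((i : N) + 1)).
  apply: (rep_bmin (P := fun z (e : tup W [:: T0; T0]) => (e.1 : N) <=N (e.2.1 : N) + z));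
    solve_rep.
exists F => k z; rewrite FE; apply: bminE; split.
- by apply: nle_trans (nleDr _ 1); rewrite addrC; apply: nleDr.
- by right.
- move=> j jz; apply/nlt_neg; rewrite nlt_neg => h.
  apply: (nlt_neg j z).2 jz; move: h; rewrite ![k + _]addrC.
  by move=> [/nlt_add2|/naddI ->]; [left|right].
Qed.

(* A sequence of [k] reals together with one more real (column 0) is coded by a single
   function, with [k] as its value at 0. *)
Lemma columns_fun : exists C : dom W (T1 ~> T0 ~> T1), forall d (i n : N),
  ap (ap (ap C d) i) n = ap d (pr i n + 1 : N) :> N.
Proof. by apply: (rep_fun3 (a := T1) (b := T0) (c := T0) (t := T0)); solve_rep. Qed.

Definition col (d : dom W T1) (i : N) : dom W T1 := ap (ap (projT1 (cid columns_fun)) d) i.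

Lemma colE d (i n : N) : ap (col d i) n = ap d (pr i n + 1 : N) :> N.
Proof. exact: (projT2 (cid columns_fun)). Qed.

Lemma columns_ex (k : N) (x : dom W T1) (y : dom W (T0 ~> T1)) : exists d,
  [/\ ap d (0 : N) = k :> N, col d 0 = x & forall i : N, col d (i + 1) = ap y i].
Proof.
have [F FE] := monus_fun; pose pd (n : N) : N := ap (ap F (1 : N)) n.
have pdE (n : N) : pd (n + 1) = n by rewrite /pd addrC FE.
have [|d dE] := @rep_fun1 W T0 T0 (fun n => cond ((n : N) = 0) k
  (cond (pj1 (pd n) = 0) (ap x (pj2 (pd n)))
     (ap (ap y (pd (pj1 (pd n)))) (pj2 (pd n))))).
  by rewrite /pd; solve_rep.
have S0 (n : N) : n + 1 <> 0 by move=> h; apply: (nlt_neq (nltS0 n)).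
exists d; split=> [||i].
- by rewrite dE condT.
- apply: m_ext => n; rewrite [LHS]colE dE condF // pdE pj1K pj2K condT //.
- apply: m_ext => n; rewrite [LHS]colE dE condF // pdE pj1K pj2K condF // pdE //.
Qed.

Definition uncovered (d : dom W T1) : Prop :=
  (forall i : N, i <=N ap d (0 : N) -> inunit (col d i)) /\
  (forall i : N, i <N ap d (0 : N) -> ~ near (col d 0) (col d (i + 1)) (ap Psi (col d (i + 1)))).

(** Inclusion of the sets of entries, with entries compared as functions on the numbers and column 0
    ignored. This is an arithmetical preorder. *)
Definition included (d e : dom W T1) : Prop :=
  forall i : N, i <N ap d (0 : N) -> exists j : N, j <N ap e (0 : N) /\
    forall n : N, ap (col d (i + 1)) n = ap (col e (j + 1)) n :> N.

(** Being a real of the unit interval and being [near] quantify over numbers; here and in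
    [dec_included] the functional E^2 is put to use. *)
Lemma dec_uncovered : dec (G := [:: T1]) (fun e : tup W [:: T1] => uncovered e.1).
Proof.
by rewrite /uncovered /inunit /isreal /lereal /near /col; solve_rep.
Qed.

Lemma dec_included :
  dec (G := [:: T1; T1]) (fun e : tup W [:: T1; T1] => included e.2.1 e.1).
Proof. by rewrite /included /col; solve_rep. Qed.

Lemma uncovered_ex (k : N) (y : dom W (T0 ~> T1)) :
  (forall i : N, i <N k -> inunit (ap y i)) ->
  exists d, [/\ uncovered d, ap d (0 : N) = k :> N & forall i : N, col d (i + 1) = ap y i].
Proof.
move=> hy; have [x [hx hn]] := no_cover hy.
have [d [dk d0 dS]] := columns_ex k x y; exists d; split=> //; split.
  move=> i; rewrite dk; have [/npred_ex [j ->] h|<- _] := nle0 i; last by rewrite d0.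
  rewrite dS; apply: hy; apply: nlt_le_trans (nltS j) h.
by move=> i; rewrite dk d0 dS; apply: hn.
Qed.

Lemma tail_ex (d : dom W T1) : exists y : dom W (T0 ~> T1), forall i : N, ap y i = col d (i + 1).
Proof. by apply: (@rep_fun1 W T0 T1); rewrite /col; solve_rep. Qed.

Lemma uncovered_tail (d : dom W T1) (i : N) :
  uncovered d -> i <N ap d (0 : N) -> inunit (col d (i + 1)).
Proof. by move=> [h _] /nlt_succ; apply: h. Qed.

(** The upper bound is the concatenation of the two sequences, with a new uncovered point supplied
    by [no_cover]; the points of [d] and [e] are dropped. *)
Lemma included_directed d e : uncovered d -> uncovered e ->
  exists f, [/\ uncovered f, included d f & included e f].
Proof.
move=> hd he; have [F FE] := monus_fun.
have [y yE] := tail_ex d; have [z zE] := tail_ex e.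
pose k : N := ap d (0 : N); pose k' : N := ap e (0 : N).
have [|w wE] := @rep_fun2 W T0 T0 T0 (fun i n =>
  cond ((i : N) <N k) (ap (ap y i) n) (ap (ap z (ap (ap F k) i)) n)); first solve_rep.
have w1 (i : N) : i <N k -> ap w i = col d (i + 1).
  by move=> ik; apply: m_ext => n; rewrite wE condT // yE.
have w2 (i : N) : ap w (k + i) = col e (i + 1).
  apply: m_ext => n; rewrite wE condF ?FE ?zE // => h.
  by apply: (nltxx (nlt_le_trans h (nleDr k i))).
have [|f [hf fk fS]] := @uncovered_ex (k + k') w.
  move=> i ik; have [h|/nlt_neg /nsub_ex [j ej]] := EM (i <N k).
    by rewrite w1 //; apply: uncovered_tail.
  rewrite -ej w2; apply: uncovered_tail => //.
  by move: ik; rewrite -ej ![k + _]addrC => /nlt_add2.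
exists f; split=> // i ik.
- exists i; rewrite fk; split; first by apply: nlt_le_trans ik (nleDr _ _).
  by move=> n; rewrite fS w1.
- exists (k + i); rewrite fk; split; last by move=> n; rewrite fS w2.
  by rewrite ![k + _]addrC; apply: nlt_add2r.
Qed.

Lemma sequences_absurd : False.
Proof.
have [|X XE] := @rep_fun1 W T1 T1 (fun d => col d 0); first by rewrite /col; solve_rep.
have [|||||||l [hl hc]] := cluster_point (DP := uncovered) (RP := included) (X := X) bw.
- exact: dec_uncovered.
- exact: dec_included.
(* The empty sequence is an index, with an arbitrary [y] as filler. *)
- have [|d [hd _ _]] := @uncovered_ex 0 (ap (mpi W T1 T0) (rzero W)).
    by move=> i h; case: (nltxx (nlt_le_trans h (nle0 i))).
  by exists d.
- by move=> d _ i ik; exists i.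
- move=> d e f _ _ _ de ef i /de [j [/ef [m [mf em]] ej]]; exists m; split=> // n.
  by rewrite ej.
- exact: included_directed.
- by move=> d [hd _]; rewrite XE; apply: hd; apply: nle0.
(* The cluster point itself forms a one-term sequence. Every index beyond it has [l] among its
   entries, so its point must avoid the interval around [l]. *)
have [|d0 [hd0 k0 c0]] := @uncovered_ex 1 (ap (mpi W T1 T0) l).
  by move=> i _; rewrite piE.
have [_ [a ha]] := pPsi.1 _ (proj1 hl); rewrite V_rzero in ha.
have e1 := e2S a; have e2' := e2S (a + 1).
(* With [e2 a] equal to 4 [e2 (a + 1 + 1)], closeness 3 plus approximation error 4 stays below the
   lower bound 8 for Psi at [l]. *)
have [d [hd d0d hdl]] := hc d0 hd0 (a + 1 + 1).
have [|j [jd ej]] := d0d 0; first by rewrite k0; apply: nlt01.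
have l0 : col d0 (0 + 1) = l by rewrite c0 piE.
have lj : col d (j + 1) = l by apply: m_ext => n; rewrite -l0; symmetry; apply: ej.
apply: (hd.2 j jd); rewrite lj -XE.
by apply: (near_intro (m := a) hdl); have := e2_gt0 (a + 1 + 1); lra.
Qed.

End Sequences.

Lemma cover_absurd : False.
Proof.
have [h|h] := EM (forall l, inunit l -> exists c, near l (center c) (radius c)).
  exact: rational_centers_absurd h.
have [x0 h0] : exists x0, ~ (inunit x0 -> exists c, near x0 (center c) (radius c)).
  by apply: contrapT => h'; apply: h => l hl; apply: contrapT => nc; apply: h'; exists l => /(_ hl).
have ux0 : inunit x0 by apply: contrapT => nu; apply: h0.
apply: sequences_absurd; apply: (E2_of_discontinuity ux0) => c hc.
by apply: h0 => _; exists c.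
Qed.

End Cover.

Theorem theorem3p37 : RCA0w ⊕ BW_net ⊢ HBU.
Proof.
apply: completeness => [r t|M hM]; first by left; apply: ax_ext.
pose W : rca := Rca (fun A hA => hM A (or_introl hA)).
have bw : sat (mnil W) BW_net := hM BW_net (or_intror erefl).
apply: (@HBUP W) => Psi pPsi; apply: contrapT => nc.
apply: (cover_absurd bw pPsi) => k y hy; apply: contrapT => nx; apply: nc.
exists k, y; split=> // x hx; apply: contrapT => nn; apply: nx; exists x; split=> // i ik hi.
by apply: nn; exists i.
Qed.
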